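(* Let $g_t$ be the hypoelliptic Brownian motion on the Heisenberg group $\mathbb{H}$ and let $g^{\ast}_t:=\max_{0\le s\le t}|g_s|$. Then there exists a deterministic constant $c\in(0,\infty)$ such that \[ \liminf_{t\to\infty}\phi(t)\,g^{\ast}_t=c\quad\text{almost surely},\qquad \phi(t):=\sqrt{\frac{\log\log t}{t}}. \]
   Context: The Heisenberg group $\mathbb{H}$ is $\mathbb{R}^2\times\mathbb{R}$ with multiplication $(\mathbf{v}_1,z_1)\cdot(\mathbf{v}_2,z_2)=(\mathbf{v}_1+\mathbf{v}_2,\ z_1+z_2+\tfrac12\omega(\mathbf{v}_1,\mathbf{v}_2))$, where $\omega((x_1,y_1),(x_2,y_2))=x_1y_2-x_2y_1$; the identity is $e=(0,0,0)$ and $(\mathbf{v},z)^{-1}=(-\mathbf{v},-z)$. The homogeneous norm on $\mathbb{H}$ is $|(\mathbf{x},z)|:=\left(\|\mathbf{x}\|_{\mathbb{R}^2}^4+z^2\right)^{1/4}$. Let $\bm{W}_t=(W_1(t),W_2(t))$ be a standard two-dimensional Brownian motion on a filtered probability space $(\Omega,\mathcal{F},\mathcal{F}_t,\mathbb{P})$. The hypoelliptic Brownian motion on $\mathbb{H}$ is $g_t:=(\bm{W}_t,A_t)$, where $A_t:=\frac12\int_0^t\omega(\bm{W}_s,d\bm{W}_s)=\frac12\int_0^t (W_1(s)\,dW_2(s)-W_2(s)\,dW_1(s))$ is Lévy's stochastic area (Itô integral). *)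

(* Defs.v *)
From HB Require Import structures.
From mathcomp Require Import all_boot all_order all_algebra.
From mathcomp Require Import all_classical all_reals all_analysis.
Set Implicit Arguments. Unset Strict Implicit. Unset Printing Implicit Defensive.
Import Order.TTheory GRing.Theory Num.Theory.
Import numFieldNormedType.Exports.
Local Open Scope classical_set_scope.
Local Open Scope ring_scope.

(* A (standard, two-dimensional) Brownian motion started at 0 on the
   probability space (T, P): W j t w is the j-th coordinate (j = 0, 1) at
   time t >= 0.  Paths are continuous on [0, +oo), W_0 = 0, and the
   finite-dimensional distributions are those of independent centred
   Gaussian increments: for 0 = t_0 < t_1 < ... < t_n, the 2n increments
   W_j(t_{k+1}) - W_j(t_k) are mutually independent with law N(0, t_{k+1}-t_k)
   (normal_prob takes mean and standard deviation). *)
Definition is_BM2 {R : realType} {d : measure_display} {T : measurableType d}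
    (P : probability T R) (W : 'I_2 -> R -> T -> R) : Prop :=
  (forall j t, measurable_fun setT (W j t)) /\
  (forall j w, W j 0 w = 0) /\
  (forall j w, {within `[0, +oo[, continuous (fun t => W j t w)}) /\
  (forall (n : nat) (t : 'I_n.+1 -> R) (B : 'I_n -> 'I_2 -> set R),
     t ord0 = 0 ->
     (forall k : 'I_n, t (inord k) < t (lift ord0 k)) ->
     (forall k j, measurable (B k j)) ->
     P [set w | forall (k : 'I_n) (j : 'I_2),
                  B k j (W j (t (lift ord0 k)) w - W j (t (inord k)) w)]
     = (\prod_(k < n) \prod_(j < 2)
          normal_prob 0 (Num.sqrt (t (lift ord0 k) - t (inord k))) (B k j))%E).

(* Left-point Riemann sum for Levy's area (1/2) int_0^t (W1 dW2 - W2 dW1)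
   along the dyadic partition of [0, t] with 2^n intervals. *)
Definition levy_sum {R : realType} {T : Type} (W : 'I_2 -> R -> T -> R)
    (t : R) (n : nat) (w : T) : R :=
  let tk (k : nat) := k%:R * t / (2 ^ n)%:R in
  2^-1 * \sum_(k < 2 ^ n)
     (W ord0 (tk k) w * (W ord_max (tk k.+1) w - W ord_max (tk k) w)
      - W ord_max (tk k) w * (W ord0 (tk k.+1) w - W ord0 (tk k) w)).

(* A is (a continuous version of) Levy's stochastic area, i.e. the Ito
   integral A_t = (1/2) int_0^t (W1 dW2 - W2 dW1): for every t >= 0, A_t is
   the L^2(P)-limit of the left-point (Ito) Riemann sums. *)
Definition is_levy_area {R : realType} {d : measure_display} {T : measurableType d}
    (P : probability T R) (W : 'I_2 -> R -> T -> R) (A : R -> T -> R) : Prop :=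
  (forall t, measurable_fun setT (A t)) /\
  (forall w, {within `[0, +oo[, continuous (fun t => A t w)}) /\
  (forall t, 0 <= t ->
     (fun n => (\int[P]_w ((levy_sum W t n w - A t w) ^+ 2)%:E)%E)
       @ \oo --> 0%E).

Definition hnorm {R : realType} (x y z : R) : R :=
  ((x ^+ 2 + y ^+ 2) ^+ 2 + z ^+ 2) `^ (4^-1).

Definition gstar {R : realType} {T : Type} (W : 'I_2 -> R -> T -> R)
    (A : R -> T -> R) (t : R) (w : T) : R :=
  sup ((fun s => hnorm (W ord0 s w) (W ord_max s w) (A s w)) @` `[0, t]).

Definition phi {R : realType} (t : R) : R := Num.sqrt (ln (ln t) / t).

Definition liminf_pinfty {R : realType} (f : R -> R) : \bar R :=
  ereal_sup (range (fun T0 : R => ereal_inf ((fun t => (f t)%:E) @` [set t | T0 <= t]))).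

(* Main.v *)
Require Import Defs.
From HB Require Import structures.
From mathcomp Require Import all_boot all_order all_algebra.
From mathcomp Require Import all_classical all_reals all_analysis.
From mathcomp Require Import measurable_realfun.
From mathcomp Require Import ring lra zify.
Set Implicit Arguments. Unset Strict Implicit. Unset Printing Implicit Defensive.
Import Order.TTheory GRing.Theory Num.Theory.
Import numFieldNormedType.Exports HBNNSimple.
Local Open Scope classical_set_scope.
Local Open Scope ring_scope.

(* The law of the planar path is carried to the space of paths observed at
   dyadic times; there it is determined by its finite-dimensional distributions,
   and along dyadic times the Levy area is almost surely a limit of Riemann sums,
   hence a function of the path.  So one constant serves all realisations.

   For x >= 0 the event that g^*_n <= y / phi(n) infinitely often for every
   y > x does not depend on an initial segment of the path (a left translation
   changes the homogeneous norm by a bounded amount), so it has probability 0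
   or 1, and c is the infimum of the x for which it is 1.

   Brownian scaling and the Markov property give
   q1^n <= P(g^*_n <= r) <= q2^n.  For the lower bound the path is made to run
   along small loops whose displacement and area counteract the current ones.
   The upper estimate and Borel-Cantelli at times 4^p log p give c > 0.  The lower
   estimate, applied to blocks of length 4^(k^2) log k, and a last-exit
   decomposition give c < oo.

   Between consecutive integers t |-> g^*_t is monotone and phi varies slowly, so
   the liminf over integers is the liminf over reals. *)

(** * Normal laws *)

(** The constant has to be named before any probability space is given, and no Brownian motion is at
    hand to define it. It is read off a law on path space if a suitable one exists; if none does,
    there is no realisation and the claim is vacuous. The boundedness of the area over dyadic times
    is transferred from a realisation, where the area is continuous by assumption. The size of the
    area of a short piece of path is hard to prescribe, so only its sign is: reflecting one
    coordinate preserves the law and reverses the area, hence either sign keeps positive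
    probability. The size of the area of a loop comes from the polygon spanned by four pieces. For
    $c<\infty$ both a block and its past have to be small. Smallness of the blocks relative to their
    starting points is independent from block to block, that of the pasts is not, so the second
    Borel-Cantelli lemma does not apply to the conjunction; the decomposition by the last block
    takes its place. Scalings are by powers of 4 in time, so that dyadic times stay dyadic. *)

Definition image_measure d d' (T1 : measurableType d) (T2 : measurableType d')
    (R : realType) (m : {measure set T1 -> \bar R}) (f : T1 -> T2)
    (mf : measurable_fun setT f) : {measure set T2 -> \bar R} :=
  measure_function_pushforward__canonical__measure_function_Measure m mf.

Section normal_law.
Context {R : realType}.
Local Notation leb := (@lebesgue_measure R).

(** Both sides agree on indicators by hypothesis, hence on simple functions, and monotone
    convergence does the rest. *)
Lemma ge0_integral_density (m : {measure set (measurableTypeR R) -> \bar R})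
    (g : measurableTypeR R -> R) :
  measurable_fun setT g -> (forall x, 0 <= g x) ->
  (forall V : set (measurableTypeR R), measurable V ->
     m V = (\int[leb]_(x in V) (g x)%:E)%E) ->
  forall f : measurableTypeR R -> \bar R, measurable_fun setT f -> (forall x, (0 <= f x)%E) ->
  (\int[m]_x f x = \int[leb]_x (f x * (g x)%:E))%E.
Proof.
move=> mg g0 mE f mf f0.
pose f_ := nnsfun_approx measurableT mf.
transitivity (lim (\int[m]_x (f_ n x)%:E @[n --> \oo])%E).
  rewrite -monotone_convergence//=.
  - apply: eq_integral => ? /[!inE] xD; apply/esym/cvg_lim => //=.
    exact: cvg_nnsfun_approx.
  - by move=> n; exact/measurable_EFinP/measurable_funTS.
  - by move=> n ? _; rewrite lee_fin.
  - by move=> ? _ ? ? mn; rewrite lee_fin; exact/lefP/nd_nnsfun_approx.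
transitivity (lim (\int[leb]_x ((f_ n x)%:E * (g x)%:E) @[n --> \oo])%E); last first.
  rewrite -monotone_convergence//=.
  - apply: eq_integral => x _; apply/cvg_lim => //=.
    apply: cvgeZr => //; exact: cvg_nnsfun_approx.
  - move=> n; apply: emeasurable_funM; exact/measurable_EFinP/measurable_funTS.
  - by move=> n x _; rewrite mule_ge0 // lee_fin.
  - move=> x _ i j ij; rewrite lee_wpmul2r ?lee_fin //.
    by move: ij => /(nd_nnsfun_approx measurableT mf)/lefP.
apply: congr_lim; apply/funext => n /=.
transitivity (\sum_(k \in range (f_ n))
    \int[m]_x (k * \1_(f_ n @^-1` [set k]) x)%:E)%E.
  under eq_integral do rewrite fimfunE -fsumEFin//.
  rewrite ge0_integral_fsum//.
  - by move=> y; exact/measurable_EFinP/measurable_funM.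
  - by move=> y x _; rewrite nnfun_muleindic_ge0.
transitivity (\sum_(k \in range (f_ n))
    \int[leb]_x ((k * \1_(f_ n @^-1` [set k]) x)%:E * (g x)%:E))%E; last first.
  rewrite -ge0_integral_fsum//=.
  - apply: eq_integral => x _.
    rewrite [in RHS]fimfunE -fsumEFin// ge0_mule_fsuml // => y.
    by rewrite nnfun_muleindic_ge0.
  - by move=> y; apply: emeasurable_funM; apply/measurable_EFinP => //; exact: measurable_funM.
  - by move=> y x _; rewrite mule_ge0 ?lee_fin // -lee_fin nnfun_muleindic_ge0.
apply: eq_fsbigr => r; rewrite inE => -[x0 _ xr].
have r0 : 0 <= r by rewrite -xr.
rewrite integralZl_indic_nnsfun// integral_indic//= setIT mE //.
rewrite [in RHS](_ : (fun _ => _) =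
  (fun x => (r%:E * ((g x)%:E * (\1_(f_ n @^-1` [set r]) x)%:E))%E)); last first.
  by apply/funext => x; rewrite -!EFinM; congr EFin; rewrite -mulrA [in LHS](mulrC (\1__ _)).
rewrite ge0_integralZl//.
- by congr (_ * _)%E; rewrite [LHS]integral_mkcond epatch_indic.
- by apply: emeasurable_funM; apply/measurable_EFinP => //.
- by move=> x _; rewrite mule_ge0 ?lee_fin.
Qed.


(** The preimage measure multiplied by [b] agrees with Lebesgue measure on half-open intervals,
    which determine it. *)
Lemma lebesgue_measure_scale (b : R) (A : set (measurableTypeR R)) : 0 < b ->
  measurable A ->
  leb ((fun x => b * x) @^-1` A) = ((b^-1)%:E * leb A)%E.
Proof.
move=> b0 mA.
have mb : measurable_fun setT (fun x : measurableTypeR R => b * x : measurableTypeR R).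
  exact: mulrl_measurable.
pose m1 : {measure set (measurableTypeR R) -> \bar R} :=
  mscale (NngNum (ltW b0)) (image_measure leb mb).
have H : leb A = m1 A.
  apply: lebesgue_measure_unique => // _ [[x y]] _ <-.
  rewrite /m1 /= /mscale /= /pushforward.
  rewrite (_ : _ @^-1` _ = `](b^-1 * x), (b^-1 * y)]%classic); last first.
    by apply/seteqP; split => z /=; rewrite !in_itv /= ltr_pdivrMl// ler_pdivlMl.
  rewrite !lebesgue_measure_itv/= !lte_fin ltr_pM2l ?invr_gt0 //.
  case: ifP => _; last by rewrite mule0.
  by congr EFin; rewrite -mulrBr mulrA divff ?gt_eqF// mul1r.
rewrite H /m1 /= /mscale /= /pushforward muleA -EFinM mulVf ?gt_eqF// mul1e.
by [].
Qed.

Lemma normal_prob_scale (s b : R) (B : set R) : 0 < s -> 0 < b -> measurable B ->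
  normal_prob 0 s ((fun x => b * x) @^-1` B) = normal_prob 0 (b * s) B.
Proof.
move=> s0 b0 mB; rewrite /normal_prob.
have mb : measurable_fun setT (fun x : measurableTypeR R => b * x : measurableTypeR R).
  exact: mulrl_measurable.
have bE : b != 0 by rewrite gt_eqF.
rewrite (_ : (fun x => _) = ((fun y : measurableTypeR R => (b * normal_pdf 0 (b * s) y)%:E) \o
   (fun x : measurableTypeR R => b * x : measurableTypeR R))); last first.
  apply/funext => x /=; congr EFin.
  rewrite !normal_pdfE ?mulf_neq0 ?gt_eqF// /normal_fun /normal_peak mulrA.
  congr (_ * expR _).
    rewrite (_ : (b * s) ^+ 2 * pi *+ 2 = b ^+ 2 * (s ^+ 2 * pi *+ 2)); last by ring.
    by rewrite sqrtrM ?sqr_ge0// sqrtr_sqr gtr0_norm// invfM mulrA divff // mul1r.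
  rewrite !subr0 !exprMn -mulrnAr; field.
  by rewrite ?bE ?gt_eqF.
pose h (y : measurableTypeR R) := (b * normal_pdf 0 (b * s) y)%:E.
pose mulb (x : measurableTypeR R) : measurableTypeR R := b * x.
transitivity (\int[pushforward leb mulb]_(y in B) h y)%E.
  apply/esym; apply: (@ge0_integral_pushforward _ _ _ _ _ _ mb leb) => //.
  - by apply/measurable_EFinP/measurable_funM => //; apply: measurable_funTS; exact: measurable_normal_pdf.
  - by move=> y _; rewrite lee_fin mulr_ge0 ?normal_pdf_ge0 // ltW.
pose m1 : {measure set (measurableTypeR R) -> \bar R} :=
  mscale (NngNum (ltW (eq_ind_r is_true b0 (invr_gt0 b)))) leb.
transitivity (\int[m1]_(y in B) h y)%E.
  apply: eq_measure_integral => A mA _.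
  by rewrite /m1 /= /mscale /= -lebesgue_measure_scale.
rewrite ge0_integral_mscale //; last 2 first.
- by apply/measurable_EFinP/measurable_funM => //; apply: measurable_funTS; exact: measurable_normal_pdf.
- by move=> y _; rewrite lee_fin mulr_ge0 ?normal_pdf_ge0 // ltW.
rewrite /h; under eq_integral do rewrite EFinM.
rewrite ge0_integralZl //.
- by rewrite muleA -EFinM /= mulVf // mul1e.
- by apply/measurable_EFinP; apply: measurable_funTS; exact: measurable_normal_pdf.
- by move=> y _; rewrite lee_fin normal_pdf_ge0.
- by rewrite lee_fin ltW.
Qed.

Lemma normal_prob_opp (s : R) (B : set R) : 0 < s -> measurable B ->
  normal_prob 0 s (-%R @^-1` B) = normal_prob 0 s B.
Proof.
move=> s0 mB; rewrite /normal_prob.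
have sE : s != 0 by rewrite gt_eqF.
rewrite [LHS](eq_integral ((fun y => (normal_pdf 0 s y)%:E) \o
   (-%R : measurableTypeR R -> measurableTypeR R))); last first.
  by move=> x _ /=; rewrite !normal_pdfE // /normal_fun !subr0 sqrrN.
pose opp (x : measurableTypeR R) : measurableTypeR R := - x.
transitivity (\int[pushforward leb opp]_(y in B)
   (normal_pdf 0 s y)%:E)%E.
  apply/esym; apply: (@ge0_integral_pushforward _ _ (measurableTypeR R)) => //.
  - exact: oppr_measurable.
  - by apply/measurable_EFinP; apply: measurable_funTS; exact: measurable_normal_pdf.
  - by move=> y _; rewrite lee_fin normal_pdf_ge0.
have mopp : measurable_fun setT opp by exact: oppr_measurable.
apply: (@eq_measure_integral _ _ _ _ leb (image_measure leb mopp)) => A mA _.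
exact: (lebesgue_measureN mA).

Qed.

Lemma normal_prob_itv_gt0 (s a b : R) : 0 < s -> a < b ->
  (0 < normal_prob 0 s `[a, b])%E.
Proof.
move=> s0 ab; rewrite /normal_prob.
(* On [[a, b]] the density is at least its value at distance [M] from 0, the largest distance in the
   interval. *)
pose M := Num.max `|a| `|b|.
pose l := normal_peak s * expR (- M ^+ 2 / (s ^+ 2 *+ 2)).
have l0 : 0 < l by rewrite mulr_gt0 ?expR_gt0 ?normal_peak_gt0 ?gt_eqF.
apply: (@lt_le_trans _ _ (\int[leb]_(x in `[a, b]) l%:E)%E).
  rewrite integral_cst //= lebesgue_measure_itv /= lte_fin ab.
  by rewrite -EFinD -EFinM lte_fin mulr_gt0 ?subr_gt0.
apply: ge0_le_integral => //.
- by move=> x _; rewrite lee_fin ltW.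
- by apply/measurable_EFinP; apply: measurable_funTS; exact: measurable_normal_pdf.
move=> x /=; rewrite in_itv /= => /andP[ax xb].
rewrite lee_fin normal_pdfE ?gt_eqF// /normal_fun subr0 /l.
rewrite ler_wpM2l ?normal_peak_ge0 // ler_expR !mulNr lerN2 ler_pM2r; last first.
  by rewrite invr_gt0 pmulrn_lgt0 // exprn_gt0.
have xM : `|x| <= M.
  rewrite le_max !ler_norml.
  case: (lerP 0 x) => x0; [apply/orP; right|apply/orP; left].
    by have := ler_norm b; move=> hb; apply/andP; split; lra.
  by have := ler_norm (- a); rewrite normrN => ha; apply/andP; split; lra.
by rewrite -(real_normK (num_real x)) lerXn2r ?nnegrE // (le_trans _ xM).
Qed.

Lemma normal_prob_lt1 (s a b : R) : 0 < s ->
  (normal_prob 0 s `[a, b] < 1)%E.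
Proof.
move=> s0.
(* A disjoint interval of positive mass is left out. *)
pose J : set R := `[b + 1, b + 1 + 1]%classic.
have H : (0 < normal_prob 0 s J)%E by apply: normal_prob_itv_gt0 => //; rewrite ltrDl.
have D : `[a, b]%classic `&` J = set0 :> set R.
  apply/seteqP; split => // x [] /=; rewrite /J /= !in_itv /= => /andP[_ xb] /andP[bx _].
  by move: (le_trans bx xb); lra.
have : (normal_prob 0 s (`[a, b] `|` J) <= 1)%E.
  apply: (@probability_le1 _ _ _ (normal_prob 0 s)); apply: measurableU.
    exact: measurable_itv.
  exact: measurable_itv.
rewrite (@measureU _ _ _ (normal_prob 0 s)) => [H1|||//]; [|exact: measurable_itv..].
rewrite (lt_le_trans _ H1) // lteDl //.
by apply: (@fin_num_measure _ _ _ (normal_prob 0 s)).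
Qed.

(** Domination by a wider normal law: $x^2$ times the standard density is at most 6 times the
    density of deviation 2, because $x^2e^{-3x^2/8}\le 3$. *)
Lemma normal_second_moment_lty :
  (\int[normal_prob 0 1]_(x in [set: R]) (x ^+ 2)%:E < +oo)%E.
Proof.
have key (x : R) : x ^+ 2 * (normal_peak 1 * expR (- x ^+ 2 / (1 ^+ 2 *+ 2))) <=
    6 * (normal_peak 2 * expR (- x ^+ 2 / (2 ^+ 2 *+ 2))).
  have pk : normal_peak 1 = 2 * normal_peak 2 :> R.
    rewrite /normal_peak (_ : 2 ^+ 2 * pi *+ 2 = 2 ^+ 2 * (1 ^+ 2 * pi *+ 2)); last by ring.
    by rewrite [in RHS]sqrtrM ?sqr_ge0// sqrtr_sqr ger0_norm // invfM mulrA divff ?mul1r.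
  rewrite pk (_ : - x ^+ 2 / (1 ^+ 2 *+ 2) = - x ^+ 2 / (2 ^+ 2 *+ 2) + - (3 / 8 * x ^+ 2)); last by field.
  rewrite expRD; set p : R := normal_peak 2; set E1 := expR (_ / _); set E2 := expR (- _).
  have -> : x ^+ 2 * (2 * p * (E1 * E2)) = (p * E1) * (2 * x ^+ 2 * E2) by ring.
  have -> : 6 * (p * E1) = (p * E1) * 6 by ring.
  rewrite ler_wpM2l ?mulr_ge0 ?normal_peak_ge0 ?expR_ge0 //.
  rewrite /E2 expRN ler_pdivrMr ?expR_gt0 //.
  have := expR_ge1Dx (3 / 8 * x ^+ 2); have := sqr_ge0 x; lra.
have msq : measurable_fun setT (fun x : measurableTypeR R => (x ^+ 2)%:E : \bar R).
  by apply/measurable_EFinP; exact: exprn_measurable.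
rewrite (@ge0_integral_density (normal_prob 0 1) (normal_pdf 0 1)) //.
- apply: (@le_lt_trans _ _ (\int[leb]_x (6 * normal_pdf 0 2 x)%:E)%E).
    apply: ge0_le_integral => //.
    + by move=> x _; rewrite mule_ge0 // lee_fin ?sqr_ge0 ?normal_pdf_ge0.
    + by apply: emeasurable_funM => //; apply/measurable_EFinP; exact: measurable_normal_pdf.
    + by apply/measurable_EFinP/measurable_funM => //; exact: measurable_normal_pdf.
    move=> x _; rewrite -EFinM lee_fin !normal_pdfE // /normal_fun !subr0.
    exact: key.
  under eq_integral do rewrite EFinM.
  rewrite ge0_integralZl //.
  + by rewrite integral_normal_pdf mule1 ltry.
  + by apply/measurable_EFinP; exact: measurable_normal_pdf.
  + by move=> x _; rewrite lee_fin normal_pdf_ge0.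
- exact: measurable_normal_pdf.
- by move=> x; exact: normal_pdf_ge0.
- by move=> x; rewrite lee_fin sqr_ge0.
Qed.

End normal_law.

(** * Path space *)

(** Locked, so that simplification and unification treat dyadic times as atoms. *)
HB.lock Definition dy {R : realType} (p k : nat) : R := k%:R / 2 ^+ p.
Canonical dy_unlockable := Unlockable dy.unlock.

(** Working with displacements makes the shifted path usable without recentring. *)
Definition co {R : realType} (e : 'I_2 -> R -> R) (j : 'I_2) (t : R) : R :=
  e j t - e j 0.

(* Only the values at dyadic times, relative to the starting point, are
   observed: the sigma-algebra is countably generated. *)
Definition cylinders (R : realType) : set (set ('I_2 -> R -> R)) :=
  [set A | exists j p k, exists2 B : set R, measurable B &
     A = [set e | B (co e j (dy p k))]].

Notation pathSpace R := (g_sigma_algebraType (@cylinders R)).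

Definition incr {R : realType} (m k : nat) (j : 'I_2) (e : 'I_2 -> R -> R) : R :=
  co e j (dy m k.+1) - co e j (dy m k).

(** Level [m] has mesh $2^{-m}$ and horizon $2^m$, so that resolution and horizon grow together. *)
Definition rect {R : realType} (m : nat) (B : nat -> 'I_2 -> set R) :
    set ('I_2 -> R -> R) :=
  [set e | forall k j, (k < 4 ^ m)%N -> B k j (incr m k j e)].

Section path_space.
Context {R : realType}.

Lemma dy0 p : dy p 0 = 0 :> R.
Proof. by rewrite unlock mul0r. Qed.

Lemma dyD p k l : dy p (k + l) = dy p k + dy p l :> R.
Proof. by rewrite unlock natrD mulrDl. Qed.

Lemma dy_ge0 p k : 0 <= dy p k :> R.
Proof. by rewrite unlock divr_ge0 // exprn_ge0. Qed.

Lemma dyMe p q k : dy (p + q) (k * 2 ^ q) = dy p k :> R.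
Proof.
rewrite unlock natrM natrX exprD invfM [_^-1 * _]mulrC -mulrA (mulrA (2 ^+ q)) divff ?mul1r//.
Qed.

Lemma dy_int n : dy 0 n = n%:R :> R.
Proof. by rewrite unlock expr0 divr1. Qed.

Lemma dy_intM p n : dy p (n * 2 ^ p) = n%:R :> R.
Proof. by rewrite -[p]add0n dyMe dy_int. Qed.

Lemma ler_dy p k l : (dy p k <= dy p l :> R) = (k <= l)%N.
Proof. by rewrite unlock ler_pM2r ?ler_nat // invr_gt0 exprn_gt0. Qed.

Lemma ltr_dy p k l : (dy p k < dy p l :> R) = (k < l)%N.
Proof. by rewrite unlock ltr_pM2r ?ltr_nat // invr_gt0 exprn_gt0. Qed.

Lemma co0 (e : 'I_2 -> R -> R) j : co e j 0 = 0.
Proof. by rewrite /co subrr. Qed.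

Lemma measurable_co j p k : measurable_fun setT (fun e : pathSpace R => co e j (dy p k)).
Proof.
move=> _ B mB; rewrite setTI; apply: sub_sigma_algebra.
by exists j, p, k, B.
Qed.

Lemma measurable_to_path d (T : measurableType d) (f : T -> pathSpace R) :
  (forall j p k, measurable_fun setT (fun w => co (f w) j (dy p k))) ->
  measurable_fun setT f.
Proof.
move=> mf; apply: (@measurability _ _ _ _ setT f (@cylinders R)) => //.
move=> _ [_ [j [p [k [B mB ->]]]] <-].
rewrite setTI (_ : _ @^-1` _ = setT `&` (fun w => co (f w) j (dy p k)) @^-1` B) ?setTI//.
by rewrite -[X in measurable X]setTI; exact: mf.
Qed.

Let F m : set (set ('I_2 -> R -> R)) :=
  [set A | exists2 B : nat -> 'I_2 -> set R, (forall k j, measurable (B k j)) & A = rect m B].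

Let setIF m : setI_closed (F m).
Proof.
move=> _ _ [B mB ->] [C mC ->]; exists (fun k j => B k j `&` C k j).
  by move=> k j; exact: measurableI.
apply/seteqP; split=> e /=.
  by move=> [H1 H2] k j kn; split; [exact: H1|exact: H2].
by move=> H; split=> k j kn; have [] := H k j kn.
Qed.

Let FT m : F m setT.
Proof.
exists (fun _ _ => setT); first by move=> *; exact: measurableT.
by apply/seteqP; split.
Qed.

Let measurable_incrF m k j : (k < 4 ^ m)%N ->
  measurable_fun setT (incr m k j : g_sigma_algebraType (F m) -> R).
Proof.
move=> km _ B mB; rewrite setTI; apply: sub_sigma_algebra.
exists (fun k' j' => if (k' == k) && (j' == j) then B else setT).
  by move=> k' j'; case: ifP => _ //; exact: measurableT.
apply/seteqP; split=> e /=.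
  by move=> Be k' j' _; case: ifP => // /andP[/eqP -> /eqP ->].
by move=> /(_ k j km); rewrite !eqxx.
Qed.

Let measurable_coF m k j : (k <= 4 ^ m)%N ->
  measurable_fun setT (fun e : g_sigma_algebraType (F m) => co e j (dy m k)).
Proof.
elim: k => [|k IH] km.
  rewrite (_ : (fun _ => _) = cst 0); first exact: measurable_cst.
  by apply/funext => e; rewrite dy0 co0.
rewrite (_ : (fun _ => _) = (fun e => co e j (dy m k) + incr m k j e)).
  apply: (@measurable_funD _ (g_sigma_algebraType (F m))).
    exact: (IH (ltnW km)).
  exact: measurable_incrF.
by apply/funext => e; rewrite /incr addrC subrK.
Qed.

Let measurable_co_le m n k j : (m <= n)%N -> (k <= 4 ^ m)%N ->
  measurable_fun setT (fun e : g_sigma_algebraType (F n) => co e j (dy m k)).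
Proof.
move=> mn km; rewrite -(dyMe m (n - m)) subnKC //; apply: measurable_coF.
rewrite -{2}(subnKC mn) expnD leq_mul //.
by case: (n - m)%N => // d; rewrite leq_exp2r.
Qed.

Let sub_F m n : (m <= n)%N -> F m `<=` <<s F n >>.
Proof.
move=> mn _ [B mB ->].
pose X : Type := g_sigma_algebraType (F n).
rewrite [rect m B](_ : _ = \bigcap_(k in [set k | (k < 4 ^ m)%N])
   \bigcap_(j in [set: 'I_2]) (setT `&` (incr m k j : X -> R) @^-1` B k j)); last first.
  apply/seteqP; split=> e /=.
    by move=> H k /= km j _; split=> //; exact: H.
  by move=> H k j km; have [] := H k km j.
apply: (@bigcap_measurable _ (g_sigma_algebraType (F n))); first by exists 0%N; rewrite /= expn_gt0.
move=> k /= km.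
apply: (@fin_bigcap_measurable _ (g_sigma_algebraType (F n))) => // j _.
apply: (@measurable_funB _ (g_sigma_algebraType (F n)) _ setT (fun e => co e j (dy m k.+1))) => //.
- exact: measurable_co_le.
- by apply: measurable_co_le => //; exact: ltnW.
Qed.

Lemma measurable_rect m (B : nat -> 'I_2 -> set R) : (forall k j, measurable (B k j)) ->
  measurable (rect m B : set (pathSpace R)).
Proof.
move=> mB.
rewrite [rect m B](_ : _ = \bigcap_(k in [set k | (k < 4 ^ m)%N])
   \bigcap_(j in [set: 'I_2]) (setT `&` (incr m k j : pathSpace R -> R) @^-1` B k j)); last first.
  apply/seteqP; split=> e /=.
    by move=> H k /= km j _; split=> //; exact: H.
  by move=> H k j km; have [] := H k km j.
apply: bigcap_measurable; first by exists 0%N; rewrite /= expn_gt0.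
move=> k /= km.
apply: fin_bigcap_measurable => // j _.
apply: (@measurable_funB _ (pathSpace R) _ setT (fun e => co e j (dy m k.+1))) => //.
- exact: measurable_co.
- exact: measurable_co.
Qed.

Let mF m : F m `<=` (measurable : set (set (pathSpace R))).
Proof. by move=> _ [B mB ->]; exact: measurable_rect. Qed.

(* Two uses of the pi-lambda theorem: the rectangles of a fixed level form a
   pi-system, and so does the increasing union of the sigma-algebras they
   generate. *)
Lemma path_measure_unique (m1 m2 : {measure set (pathSpace R) -> \bar R}) :
  (m1 setT < +oo)%E ->
  (forall m B, (forall k j, measurable (B k j)) -> m1 (rect m B) = m2 (rect m B)) ->
  forall A, measurable A -> m1 A = m2 A.
Proof.
move=> m1oo m12.
have step1 m A : <<s F m >> A -> m1 A = m2 A.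
  apply: (@g_sigma_algebra_measure_unique _ R (pathSpace R) (F m) (@mF m) (fun=> setT)) => //.
  - exact: bigcup_const.
  - by move=> _ [B mB ->]; exact: m12.
have sF m n : (m <= n)%N -> <<s F m >> `<=` <<s F n >>.
  move=> mn; apply: smallest_sub; [exact: smallest_sigma_algebra|exact: sub_F].
have mH m : <<s F m >> `<=` (measurable : set (set (pathSpace R))).
  apply: smallest_sub; [exact: sigma_algebra_measurable|exact: mF].
pose H : set (set (pathSpace R)) := \bigcup_m <<s F m >>.
apply: (measure_unique H (fun=> setT)) => //.
- apply/seteqP; split.
    apply: smallest_sub; first exact: smallest_sigma_algebra.
    move=> _ [j [p [k [B mB ->]]]]; apply: sub_sigma_algebra.
    (* At this level the mesh refines $2^{-p}$ and, as $k\le 2^k$, the horizon contains the time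
       $k/2^p$. *)
    exists (p + k)%N => //.
    rewrite [X in <<s _ >> X](_ : _ = setT `&` (fun e : g_sigma_algebraType (F (p + k)) =>
       co e j (dy p k)) @^-1` B); last by rewrite setTI.
    rewrite -(dyMe p k); apply: measurable_coF => //.
    rewrite expnD; apply: leq_trans (leq_pmull _ _); last by rewrite expn_gt0.
    rewrite -[4%N]/(2 * 2)%N expnMn leq_mul2r; apply/orP; right.
    exact/ltnW/ltn_expl.
  apply: smallest_sub; first exact: sigma_algebra_measurable.
  by move=> A [m _]; exact: mH.
- move=> A B [m _ FA] [n _ FB]; exists (maxn m n) => //.
  apply: (@measurableI _ (g_sigma_algebraType (F (maxn m n)))).
    exact: sF (leq_maxl _ _) _ FA.
  exact: sF (leq_maxr _ _) _ FB.
- by move=> _; exists 0%N => //; apply: sub_sigma_algebra; exact: FT.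
- exact: bigcup_const.
- by move=> A [m _]; exact: step1.
Qed.

End path_space.

(** * Brownian laws *)

Definition brownian_fdd {R : realType} (mu : set (pathSpace R) -> \bar R) :=
  forall (n : nat) (t : nat -> R) (B : nat -> 'I_2 -> set R),
    t 0%N = 0 ->
    (forall k, (k < n)%N -> t k < t k.+1) ->
    (forall k, (k <= n)%N -> exists p i, t k = dy p i) ->
    (forall k j, measurable (B k j)) ->
    mu [set e | forall k j, (k < n)%N -> B k j (co e j (t k.+1) - co e j (t k))] =
    (\prod_(k < n) \prod_(j < 2)
       normal_prob 0 (Num.sqrt (t k.+1 - t k)) (B k j))%E.

(** The past of time [N] consists of the preimages under [path_stop N], the future of the preimages
    under [path_shift N]. *)
Definition path_stop {R : realType} (N : nat) (e : 'I_2 -> R -> R) : 'I_2 -> R -> R :=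
  fun j t => e j (Num.min t N%:R).

Definition path_shift {R : realType} (N : nat) (e : 'I_2 -> R -> R) : 'I_2 -> R -> R :=
  fun j t => e j (N%:R + t).

Section markov.
Context {R : realType}.
Implicit Types (e : 'I_2 -> R -> R) (N m p k : nat).

Lemma co_stop N e j t : co (path_stop N e) j t = co e j (Num.min t N%:R).
Proof. by rewrite /co /path_stop (min_idPl (ler0n _ _)). Qed.

Lemma co_stop_le N e j t : t <= N%:R -> co (path_stop N e) j t = co e j t.
Proof. by move=> tN; rewrite co_stop (min_idPl tN). Qed.

Lemma co_shift N e j t : co (path_shift N e) j t = co e j (N%:R + t) - co e j N%:R.
Proof. by rewrite /co /path_shift addr0 opprB addrA subrK. Qed.

Lemma incr_shift N m k j e :
  incr m k j (path_shift N e) = co e j (N%:R + dy m k.+1) - co e j (N%:R + dy m k).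
Proof. by rewrite /incr !co_shift; ring. Qed.

Lemma shiftD N M e : path_shift N (path_shift M e) = path_shift (M + N) e.
Proof. by apply/funext => j; apply/funext => t; rewrite /path_shift addrA natrD. Qed.

Lemma addr_dy N p k : N%:R + dy p k = dy p (N * 2 ^ p + k) :> R.
Proof. by rewrite dyD dy_intM. Qed.

Lemma dyS p k : dy p k.+1 = dy p k + dy p 1 :> R.
Proof. by rewrite -addn1 dyD. Qed.

Lemma measurable_stop N : measurable_fun setT (path_stop N : pathSpace R -> pathSpace R).
Proof.
apply: measurable_to_path => j p k.
have [kN|Nk] := leqP k (N * 2 ^ p).
  rewrite (_ : (fun _ => _) = (fun e => co e j (dy p k))); first exact: measurable_co.
  by apply/funext => e; rewrite co_stop_le // -(dy_intM p N) ler_dy.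
rewrite (_ : (fun _ => _) = (fun e => co e j (dy p (N * 2 ^ p)))); first exact: measurable_co.
apply/funext => e; rewrite co_stop (min_idPr _) ?dy_intM //.
by rewrite -(dy_intM p N) ler_dy ltnW.
Qed.

Lemma measurable_shift N : measurable_fun setT (path_shift N : pathSpace R -> pathSpace R).
Proof.
apply: measurable_to_path => j p k.
rewrite (_ : (fun _ => _) = (fun e => co e j (dy p (N * 2 ^ p + k)) - co e j (dy p (N * 2 ^ p)))).
  by apply: (@measurable_funB _ (pathSpace R)); exact: measurable_co.
by apply/funext => e; rewrite co_shift addr_dy dy_intM.
Qed.

Lemma measurable_preimage d d' (T1 : measurableType d) (T2 : measurableType d')
    (f : T1 -> T2) (A : set T2) :
  measurable_fun setT f -> measurable A -> measurable (f @^-1` A).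
Proof. by move=> mf mA; rewrite -[X in measurable X]setTI; exact: mf. Qed.

Variable mu : probability (pathSpace R) R.
Hypothesis fdd : brownian_fdd mu.

Lemma fdd_grid m n (B : nat -> 'I_2 -> set R) : (forall k j, measurable (B k j)) ->
  mu [set e | forall k j, (k < n)%N -> B k j (incr m k j e)] =
  (\prod_(k < n) \prod_(j < 2) normal_prob 0 (Num.sqrt (dy m 1)) (B k j))%E.
Proof.
move=> mB.
have := @fdd n (dy m) B (dy0 m) (fun k _ => _) (fun k _ => ex_intro _ m (ex_intro _ k erefl)) mB.
move=> ->; last by move=> k; rewrite ltr_dy.
by apply: eq_bigr => k _; apply: eq_bigr => j _; rewrite dyS addrC addKr.
Qed.

Lemma fdd_past_future N m m' (B C : nat -> 'I_2 -> set R) :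
  (forall k j, measurable (B k j)) -> (forall k j, measurable (C k j)) ->
  mu ([set e | forall k j, (k < N * 2 ^ m)%N -> B k j (incr m k j e)] `&`
      path_shift N @^-1` rect m' C) =
  (mu [set e | forall k j, (k < N * 2 ^ m)%N -> B k j (incr m k j e)] *
   mu (rect m' C))%E.
Proof.
move=> mB mC; set a := (N * 2 ^ m)%N.
(* One partition serves both events: mesh $2^{-m}$ up to time [N], mesh $2^{-m'}$ afterwards. *)
pose t k := if (k <= a)%N then dy m k else N%:R + dy m' (k - a) : R.
pose D k j := if (k < a)%N then B k j else C (k - a)%N j.
have tl k : (k <= a)%N -> t k = dy m k by rewrite /t => ->.
have tr k : (a <= k)%N -> t k = N%:R + dy m' (k - a).
  rewrite /t leq_eqVlt => /orP[/eqP <-|]; last by rewrite ltnNge => /negbTE ->.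
  by rewrite leqnn subnn dy0 addr0 dy_intM.
transitivity (mu [set e | forall k j, (k < a + 4 ^ m')%N -> D k j (co e j (t k.+1) - co e j (t k))]).
  congr (mu _); apply/seteqP; split=> e /=.
    move=> [H1 H2] k j kn; rewrite /D; case: ltnP => ka.
      by rewrite !tl ?(ltnW ka) //; exact: H1.
    rewrite !tr ?(leqW ka) // subSn //.
    have ka' : (k - a < 4 ^ m')%N by rewrite ltn_subLR.
    by have := H2 (k - a)%N j ka'; rewrite incr_shift.
  move=> H; split=> k j ka.
    have := H k j (leq_trans ka (leq_addr _ _)); rewrite /D ka !tl ?(ltnW ka) //.
  have := H (a + k)%N j; rewrite ltn_add2l => /(_ ka).
  rewrite /D ltnNge leq_addr /= !tr ?leq_addr //; last by rewrite leqW ?leq_addr.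
  by rewrite -addnS !addKn incr_shift.
have t_lt k : (k < a + 4 ^ m')%N -> t k < t k.+1.
  move=> _; case: (ltnP k a) => ka; first by rewrite (tl _ ka) (tl _ (ltnW ka)) ltr_dy.
  by rewrite (tr _ ka) (tr _ (leqW ka)) ltrD2l ltr_dy subSn.
have t_dy k : (k <= a + 4 ^ m')%N -> exists p i, t k = dy p i.
  move=> _; case: (leqP k a) => ka; first by exists m, k; rewrite tl.
  by exists m', (N * 2 ^ m' + (k - a))%N; rewrite (tr _ (ltnW ka)) addr_dy.
have t0 : t 0%N = 0 by rewrite tl // dy0.
have mD k j : measurable (D k j) by rewrite /D; case: ifP.
rewrite (fdd t0 t_lt t_dy mD) big_split_ord /=; congr (_ * _)%E.
  rewrite (@fdd_grid m a B mB); apply: eq_bigr => k _; apply: eq_bigr => j _.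
  have ka := ltn_ord k.
  rewrite /= /D ka (tl _ ka) (tl _ (ltnW ka)).
  by rewrite dyS addrC addKr.
rewrite [rect m' C](_ : _ = [set e | forall k j, (k < 4 ^ m')%N -> C k j (incr m' k j e)]) // (@fdd_grid m' _ C mC); apply: eq_bigr => k _; apply: eq_bigr => j _.
have ak : (a <= a + k)%N by rewrite leq_addr.
rewrite /= /D ltnNge ak /= (tr _ ak) (tr _ (leqW ak)) -addnS !addKn.
rewrite (_ : N%:R + dy m' k.+1 - (N%:R + dy m' k) = dy m' 1) //.
by rewrite dyS; ring.
Qed.

(** Past time [N] the stopped path has zero increments: a constraint there holds either on every
    path or on none. *)
Lemma stop_rect N m (B : nat -> 'I_2 -> set R) : (forall k j, measurable (B k j)) ->
  path_stop N @^-1` rect m B = set0 \/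
  exists2 B' : nat -> 'I_2 -> set R, (forall k j, measurable (B' k j)) &
    path_stop N @^-1` rect m B =
    [set e | forall k j, (k < N * 2 ^ m)%N -> B' k j (incr m k j e)].
Proof.
move=> mB; set a := (N * 2 ^ m)%N.
have iE k j e : incr m k j (path_stop N e) = if (k < a)%N then incr m k j e else 0.
  rewrite /incr; case: ltnP => ka.
    by rewrite !co_stop_le // -(dy_intM m N) ler_dy // ltnW.
  rewrite !co_stop !(min_idPr _) ?subrr // -(dy_intM m N) ler_dy // leqW //.
have [H|H] := pselect (forall k j, (k < 4 ^ m)%N -> (a <= k)%N -> B k j 0).
  right; exists (fun k j => if (k < 4 ^ m)%N then B k j else setT).
    by move=> k j; case: ifP => // _; exact: measurableT.
  apply/seteqP; split=> e /=.
    by move=> He k j ka; case: ifP => // km; have := He k j km; rewrite iE ka.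
  move=> He k j km; rewrite iE; case: ltnP => ka; last exact: H.
  by have := He k j ka; rewrite km.
left; apply/seteqP; split=> // e /= He; apply: H => k j km ka.
by have := He k j km; rewrite iE ltnNge ka.
Qed.

Lemma probability_fineK d (T : measurableType d) (P : probability T R) (A : set T) :
  measurable A -> (fine (P A))%:E = P A.
Proof. by move=> mA; rewrite fineK //; exact: fin_num_measure. Qed.

Definition nng_prob d (T : measurableType d) (P : probability T R) (A : set T) : {nonneg R} :=
  NngNum (fine_ge0 (measure_ge0 P A)).

(** The Markov property at an integer time. Uniqueness of path measures is used twice: for the
    future with a rectangle as past, then for the past with an arbitrary future. *)
Theorem past_future_indep N (Q V : set (pathSpace R)) : measurable Q -> measurable V ->
  mu (path_stop N @^-1` Q `&` path_shift N @^-1` V) = (mu (path_stop N @^-1` Q) * mu V)%E.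
Proof.
move=> mQ mV.
have lty (A : set (pathSpace R)) : measurable A -> (mu A < +oo)%E.
  by move=> mA; rewrite (le_lt_trans (probability_le1 mu mA)) // ltry.
have past_rect m (B : nat -> 'I_2 -> set R) (V' : set (pathSpace R)) : (forall k j, measurable (B k j)) -> measurable V' ->
    mu (path_stop N @^-1` rect m B `&` path_shift N @^-1` V') = (mu (path_stop N @^-1` rect m B) * mu V')%E.
  move=> mB mV'.
  have mD : measurable (path_stop N @^-1` rect m B : set (pathSpace R)).
    exact: measurable_preimage (measurable_stop N) (measurable_rect m mB).
  pose m1 := image_measure (mrestr mu mD) (measurable_shift N).
  pose m2 : {measure set (pathSpace R) -> \bar R} := mscale (nng_prob mu (path_stop N @^-1` rect m B)) mu.
  have : m1 V' = m2 V'.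
    apply: path_measure_unique => //.
      by rewrite /m1 /= /pushforward /mrestr preimage_setT setTI lty.
    move=> m' C mC; rewrite /m1 /m2 /= /pushforward /mrestr /mscale /= probability_fineK // setIC.
    have [->|[B' mB' ->]] := stop_rect N m mB.
      by rewrite set0I measure0 mul0e.
    exact: fdd_past_future.
  by rewrite /m1 /m2 /= /pushforward /mrestr /mscale /= probability_fineK // setIC.
have mD : measurable (path_shift N @^-1` V : set (pathSpace R)).
  exact: measurable_preimage (measurable_shift N) mV.
pose m1 := image_measure (mrestr mu mD) (measurable_stop N).
pose m2 : {measure set (pathSpace R) -> \bar R} :=
  mscale (nng_prob mu V) (image_measure mu (measurable_stop N)).
have : m1 Q = m2 Q.
  apply: path_measure_unique => //.
    by rewrite /m1 /= /pushforward /mrestr preimage_setT setTI lty.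
  move=> m B mB; rewrite /m1 /m2 /= /pushforward /mrestr /mscale /= probability_fineK //.
  by rewrite past_rect // muleC.
by rewrite /m1 /m2 /= /pushforward /mrestr /mscale /= probability_fineK // muleC.
Qed.

Corollary shift_preserves N (V : set (pathSpace R)) : measurable V ->
  mu (path_shift N @^-1` V) = mu V.
Proof.
move=> mV; have := past_future_indep N measurableT mV.
by rewrite preimage_setT setTI probability_setT mul1e.
Qed.

End markov.

(** Brownian scaling by 4 in time and 2 in space, which maps dyadic times to dyadic times. *)
Definition scale4 {R : realType} (e : 'I_2 -> R -> R) : 'I_2 -> R -> R :=
  fun j t => 2^-1 * e j (4 * t).

(** A reflection, which preserves the law and reverses the area. *)
Definition path_flip {R : realType} (i : 'I_2) (e : 'I_2 -> R -> R) : 'I_2 -> R -> R :=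
  fun j t => if j == i then - e j t else e j t.

Section symmetries.
Context {R : realType}.
Implicit Types (e : 'I_2 -> R -> R).

Lemma co_scale4 e j t : co (scale4 e) j t = 2^-1 * co e j (4 * t).
Proof. by rewrite /co /scale4 mulr0 mulrBr. Qed.

Lemma co_flip i e j t : co (path_flip i e) j t = if j == i then - co e j t else co e j t.
Proof. by rewrite /co /path_flip; case: ifP => // _; rewrite opprD. Qed.

Lemma dy4 p k : 4 * dy p k = dy p (4 * k) :> R.
Proof. by rewrite unlock natrM mulrA. Qed.

Lemma incr_scale4 m k j e :
  incr m k j (scale4 e) = 2^-1 * (co e j (dy m (4 * k.+1)) - co e j (dy m (4 * k))).
Proof. by rewrite /incr !co_scale4 !dy4; ring. Qed.

Lemma incr_flip i m k j e :
  incr m k j (path_flip i e) = if j == i then - incr m k j e else incr m k j e.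
Proof. by rewrite /incr !co_flip; case: ifP => // _; ring. Qed.

Lemma measurable_scale4 : measurable_fun setT (scale4 : pathSpace R -> pathSpace R).
Proof.
apply: measurable_to_path => j p k.
rewrite (_ : (fun _ => _) = (fun e => 2^-1 * co e j (dy p (4 * k)))).
  by apply: (@measurable_funM _ (pathSpace R)) => //; exact: measurable_co.
by apply/funext => e; rewrite co_scale4 dy4.
Qed.

Lemma measurable_flip i : measurable_fun setT (path_flip i : pathSpace R -> pathSpace R).
Proof.
apply: measurable_to_path => j p k.
rewrite (_ : (fun _ => _) =
  (fun e => if j == i then - co e j (dy p k) else co e j (dy p k))); last first.
  by apply/funext => e; rewrite co_flip.
case: (j == i); last exact: measurable_co.
by apply: (@measurable_funN _ (pathSpace R)); exact: measurable_co.
Qed.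

Variable mu : probability (pathSpace R) R.
Hypothesis fdd : brownian_fdd mu.

Lemma probability_lty (A : set (pathSpace R)) : measurable A -> (mu A < +oo)%E.
Proof. by move=> mA; rewrite (le_lt_trans (probability_le1 mu mA)) // ltry. Qed.

Lemma scale4_preserves (A : set (pathSpace R)) : measurable A ->
  mu (scale4 @^-1` A) = mu A.
Proof.
move=> mA; apply: (path_measure_unique (m1 := image_measure mu measurable_scale4)) => //.
  by rewrite /= /pushforward preimage_setT probability_lty.
move=> m B mB; rewrite /= /pushforward.
have mhalf : measurable_fun setT (fun x : R => 2^-1 * x) by exact: mulrl_measurable.
rewrite [rect m B in RHS]/rect fdd_grid //.
pose C k j := (fun x : R => 2^-1 * x) @^-1` B k j.
transitivity (mu [set e | forall k j, (k < 4 ^ m)%N -> C k j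
   (co e j (dy m (4 * k.+1)) - co e j (dy m (4 * k)))]).
  congr (mu _); apply/seteqP; split => e /= He k j km; have := He k j km;
  by rewrite /C /= incr_scale4.
rewrite (fdd (t := fun k => dy m (4 * k))).
- apply: eq_bigr => k _; apply: eq_bigr => j _.
  have h0 : 0 < dy m 1 :> R by rewrite -(dy0 m) ltr_dy.
  have dE : dy m (4 * k.+1) - dy m (4 * k) = 2 ^+ 2 * dy m 1 :> R.
    by rewrite -!dy4 dyS; ring.
  have sE : Num.sqrt (2 ^+ 2 * dy m 1) = 2 * Num.sqrt (dy m 1) :> R.
    rewrite sqrtrM; last by rewrite sqr_ge0.
    by rewrite sqrtr_sqr ger0_norm.
  have s0 : 0 < 2 * Num.sqrt (dy m 1) :> R by rewrite mulr_gt0 // sqrtr_gt0.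
  rewrite dE sE /C (normal_prob_scale s0 _ (mB k j)); last by rewrite invr_gt0.
  by rewrite mulrA mulVf ?mul1r // pnatr_eq0.
- by rewrite muln0 dy0.
- by move=> k _; rewrite ltr_dy ltn_pmul2l.
- by move=> k _; exists m, (4 * k)%N.
- by move=> k j; apply: measurable_preimage mhalf (mB k j).
Qed.

Lemma flip_preserves i (A : set (pathSpace R)) : measurable A ->
  mu (path_flip i @^-1` A) = mu A.
Proof.
move=> mA; apply: (path_measure_unique (m1 := image_measure mu (measurable_flip i))) => //.
  by rewrite /= /pushforward preimage_setT probability_lty.
move=> m B mB; rewrite /= /pushforward.
pose C k j := if j == i then -%R @^-1` B k j else B k j.
have mC k j : measurable (C k j).
  rewrite /C; case: ifP => // _; apply: measurable_preimage (mB k j).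
  exact: oppr_measurable.
transitivity (mu (rect m C)).
  congr (mu _); apply/seteqP; split => e /= He k j km; have := He k j km;
  by rewrite /C /= incr_flip; case: ifP.
rewrite /rect !fdd_grid //; apply: eq_bigr => k _; apply: eq_bigr => j _.
rewrite /C; case: ifP => // _; apply: normal_prob_opp => //.
by rewrite sqrtr_gt0 -(dy0 m) ltr_dy.
Qed.

End symmetries.

(** * Second moments of Riemann sums *)

Section independence.
Context {R : realType} d (T : measurableType d) (P : probability T R).

(** The restriction of [P] to [V] and the multiple [P V] of [P] coincide on a pi-system, hence on
    what it generates. *)
Lemma indep_generated1 (G : set (set T)) (V : set T) :
  G `<=` measurable -> setI_closed G -> G setT -> measurable V ->
  (forall A, G A -> P (A `&` V) = (P A * P V)%E) ->
  forall A, <<s G >> A -> P (A `&` V) = (P A * P V)%E.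
Proof.
move=> mG IG GT mV PG A sA.
pose m2 : {measure set T -> \bar R} := mscale (nng_prob P V) P.
have -> : (P A * P V)%E = m2 A by rewrite /m2 /= /mscale /= probability_fineK // muleC.
have : mrestr P mV A = m2 A.
  apply: (@g_sigma_algebra_measure_unique _ R T G mG (fun=> setT)) => //.
  - exact: bigcup_const.
  - by move=> B GB; rewrite /m2 /= /mscale /= probability_fineK // muleC; exact: PG.
  - move=> _; rewrite /= /mrestr setTI.
    by rewrite (le_lt_trans (probability_le1 P mV)) // ltry.
by [].
Qed.

Lemma indep_generated (G H : set (set T)) :
  G `<=` measurable -> setI_closed G -> G setT ->
  H `<=` measurable -> setI_closed H -> H setT ->
  (forall A B, G A -> H B -> P (A `&` B) = (P A * P B)%E) ->
  forall A B, <<s G >> A -> <<s H >> B -> P (A `&` B) = (P A * P B)%E.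
Proof.
move=> mG IG GT mH IH HT PGH A B sA sB.
have mA : measurable A by move: A sA; apply: smallest_sub => //; exact: sigma_algebra_measurable.
rewrite setIC muleC.
apply: (@indep_generated1 H) => // C HC.
rewrite setIC muleC; apply: (@indep_generated1 G) => //; first exact: mH.
by move=> D GD; exact: PGH.
Qed.

Definition indep_rv (X Y : T -> R) :=
  forall B C : set R, measurable B -> measurable C ->
    P (X @^-1` B `&` Y @^-1` C) = (P (X @^-1` B) * P (Y @^-1` C))%E.

(** By independence the joint law is the product of the marginal laws, and Fubini's theorem factors
    the integral. Integrability of the product comes from the same computation with absolute
    values. *)
Lemma integral_indep (X Y : T -> R) :
  P.-integrable setT (EFin \o X) -> P.-integrable setT (EFin \o Y) ->
  indep_rv X Y ->
  P.-integrable setT (fun w => (X w * Y w)%:E) /\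
  (\int[P]_w (X w * Y w)%:E = (\int[P]_w (X w)%:E) * (\int[P]_w (Y w)%:E))%E.
Proof.
move=> iX iY XY.
have mX : measurable_fun setT X by apply/measurable_EFinP; exact: measurable_int iX.
have mY : measurable_fun setT Y by apply/measurable_EFinP; exact: measurable_int iY.
pose X' : {mfun T >-> R} := HB.pack X (isMeasurableFun.Build _ _ _ _ X mX).
pose Y' : {mfun T >-> R} := HB.pack Y (isMeasurableFun.Build _ _ _ _ Y mY).
pose m1 := distribution P X'; pose m2 := distribution P Y'.
have mXY : measurable_fun setT (fun w => (X w, Y w)) by exact: measurable_fun_pair.
pose m := image_measure P mXY.
have mE A : measurable A -> (m1 \x m2)%E A = m A.
  apply: product_measure_unique => B C mB mC.
  by rewrite /m /= /pushforward; exact: XY.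
pose f (z : R * R) := (z.1 * z.2)%:E : \bar R.
have mf : measurable_fun setT f.
  by apply/measurable_EFinP; apply: measurable_funM.
have absX : (\int[m1]_x `|x%:E| < +oo)%E.
  rewrite ge0_integral_distribution //; first by have /integrableP[] := iX.
  exact: measurableT_comp.
have absY : (\int[m2]_x `|x%:E| < +oo)%E.
  rewrite ge0_integral_distribution //; first by have /integrableP[] := iY.
  exact: measurableT_comp.
have imf : (m1 \x m2)%E.-integrable setT f.
  apply/integrable12ltyP => //.
  rewrite [X in (X < _)%E](_ : _ = (\int[m1]_x (`|x%:E| * \int[m2]_y `|y%:E|))%E); last first.
    apply: eq_integral => x _; rewrite -ge0_integralZl //.
      by apply: eq_integral => y _; rewrite /f /= normrM.
    exact: measurableT_comp.
  rewrite ge0_integralZr //; do ?[exact: measurableT_comp|exact: integral_ge0].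
  by rewrite lte_mul_pinfty // ?ge0_fin_numE // integral_ge0.
have im1 : m1.-integrable setT EFin by apply/integrableP; split.
have im2 : m2.-integrable setT EFin by apply/integrableP; split.
have imf' : m.-integrable setT f.
  apply/integrableP; split => //.
  have /integrableP[_] := imf; congr (_ < _)%E.
  by apply: eq_measure_integral => A mA _; exact: mE.
have iXY : P.-integrable setT (fun w => (X w * Y w)%:E).
  apply/integrableP; split; first by apply/measurable_EFinP; exact: measurable_funM.
  have /integrableP[_] := imf'; rewrite ge0_integral_pushforward //.
  exact: measurableT_comp.
split => //.
transitivity (\int[m]_z f z)%E; first by rewrite integral_pushforward.
transitivity (\int[(m1 \x m2)%E]_z f z)%E.
  by apply: eq_measure_integral => A mA _; apply/esym; exact: mE.
rewrite -integral12_prod_meas1 // /fubini_F.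
transitivity (\int[m1]_x (x%:E * \int[m2]_y y%:E))%E.
  by apply: eq_integral => x _; rewrite -integralZl.
have fin2 : (\int[m2]_y y%:E)%E \is a fin_num by exact: integrable_fin_num.
by rewrite -(fineK fin2) integralZr // fineK // !integral_distribution.
Qed.

End independence.

(** The variance of the standard normal law, left unevaluated; its finiteness is what the estimates
    below use. *)
Definition normal_var (R : realType) : R :=
  fine (\int[normal_prob 0 1]_(x in [set: R]) (x ^+ 2)%:E)%E.

Section normal_moments.
Context {R : realType}.
Local Notation v2 := (normal_var R).
Local Notation RR := (measurableTypeR R).

Lemma integral_normal_sq (s : R) : 0 < s ->
  (\int[normal_prob 0 s]_(x in [set: RR]) (x ^+ 2)%:E = (s ^+ 2 * v2)%:E)%E.
Proof.
move=> s0.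
have ms : measurable_fun setT (fun x : RR => s * x : RR) by exact: mulrl_measurable.
have msq : measurable_fun setT (fun x : RR => (x ^+ 2)%:E : \bar R).
  by apply/measurable_EFinP; exact: exprn_measurable.
transitivity (\int[image_measure (normal_prob 0 1) ms]_(x in [set: RR]) (x ^+ 2)%:E)%E.
  apply: eq_measure_integral => A mA _.
  by have := normal_prob_scale ltr01 s0 mA; rewrite mulr1 => h; exact: (esym h).
rewrite ge0_integral_pushforward //; last by move=> x _; rewrite lee_fin sqr_ge0.
rewrite preimage_setT /comp.
under eq_integral do rewrite exprMn EFinM.
rewrite ge0_integralZl //; last 2 first.
- by move=> x _; rewrite lee_fin sqr_ge0.
- by rewrite lee_fin sqr_ge0.
rewrite [RHS]EFinM /normal_var fineK // ge0_fin_numE; first exact: normal_second_moment_lty.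
by apply: integral_ge0 => x _; rewrite lee_fin sqr_ge0.
Qed.

Lemma integrable_normal_id (s : R) : 0 < s ->
  (normal_prob 0 s).-integrable [set: RR] (EFin : RR -> \bar R).
Proof.
have key (x : R) : `|x| <= 1 + x ^+ 2 by case: (ger0P x) => ?; nra.
move=> s0; apply/integrableP; split; first exact: EFin_measurable.
apply: (@le_lt_trans _ _ (\int[normal_prob 0 s]_(x in [set: RR]) (1 + (x ^+ 2)%:E))%E).
  apply: ge0_le_integral => //.
  - exact: measurableT_comp.
  - by apply: emeasurable_funD => //; apply/measurable_EFinP; exact: exprn_measurable.
  by move=> x _; rewrite -EFinD lee_fin; exact: key.
rewrite ge0_integralD //.
- rewrite integral_normal_sq // integral_cst //= (@probability_setT _ _ _ (normal_prob 0 s)).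
  by rewrite mule1 -EFinD ltry.
- by move=> x _; rewrite lee_fin sqr_ge0.
- by apply/measurable_EFinP; exact: exprn_measurable.
Qed.

(** By symmetry the integral equals its own opposite. *)
Lemma integral_normal_id (s : R) : 0 < s ->
  (\int[normal_prob 0 s]_(x in [set: RR]) x%:E = 0)%E.
Proof.
move=> s0; have iid := integrable_normal_id s0.
have mo : measurable_fun setT (-%R : RR -> RR) by exact: oppr_measurable.
have : (\int[normal_prob 0 s]_(x in [set: RR]) x%:E =
        \int[image_measure (normal_prob 0 s) mo]_(x in [set: RR]) x%:E)%E.
  by apply: eq_measure_integral => A mA _; rewrite /= /pushforward normal_prob_opp.
rewrite integral_pushforward //; last first.
  by rewrite (_ : _ \o _ = -%E \o (EFin : RR -> \bar R)) //; exact: integrableN.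
rewrite preimage_setT.
rewrite [X in _ = X -> _](_ : _ = (- \int[normal_prob 0 s]_(x in [set: RR]) x%:E)%E); last first.
  rewrite -integralN //.
  exact: integrable_add_def.
have := integrable_fin_num measurableT iid.
case: (\int[_]_(_ in _) _)%E => // r _ [] rr; congr EFin; lra.
Qed.

End normal_moments.

Section increments.
Context {R : realType} (mu : probability (pathSpace R) R).
Hypothesis fdd : brownian_fdd mu.
Local Notation v2 := (normal_var R).
Local Notation RR := (measurableTypeR R).

Lemma dy1_gt0 m : 0 < dy m 1 :> R.
Proof. by rewrite -(dy0 m) ltr_dy. Qed.

Lemma measurable_incr m k j : measurable_fun setT (incr m k j : pathSpace R -> R).
Proof. by apply: (@measurable_funB _ (pathSpace R)); exact: measurable_co. Qed.

(** No increment is constrained by both families, so each factor of the product formula belongs to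
    one of them. *)
Lemma fdd_split m n (B C : nat -> 'I_2 -> set R) :
  (forall k j, measurable (B k j)) -> (forall k j, measurable (C k j)) ->
  (forall k j, B k j = setT \/ C k j = setT) ->
  mu ([set e | forall k j, (k < n)%N -> B k j (incr m k j e)] `&`
      [set e | forall k j, (k < n)%N -> C k j (incr m k j e)]) =
  (mu [set e | forall k j, (k < n)%N -> B k j (incr m k j e)] *
   mu [set e | forall k j, (k < n)%N -> C k j (incr m k j e)])%E.
Proof.
move=> mB mC BC.
transitivity (mu [set e | forall k j, (k < n)%N -> (B k j `&` C k j) (incr m k j e)]).
  congr (mu _); apply/seteqP; split => e /=.
    by move=> [H1 H2] k j kn; split; [exact: H1|exact: H2].
  by move=> H; split=> k j kn; have [] := H k j kn.
rewrite (@fdd_grid _ _ fdd m n (fun k j => B k j `&` C k j)); last by move=> k j; exact: measurableI.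
rewrite (fdd_grid fdd m n mB) (fdd_grid fdd m n mC).
rewrite -big_split /=; apply: eq_bigr => k _; rewrite -big_split /=; apply: eq_bigr => j _.
have NT := @probability_setT _ _ _ (normal_prob 0 (Num.sqrt (dy m 1 : R))).
by case: (BC k j) => ->; rewrite ?setTI ?setIT NT ?mul1e ?mule1.
Qed.

Lemma single_incr m n i j (B : set R) : (i < n)%N ->
  (incr m i j : pathSpace R -> R) @^-1` B =
  [set e | forall k j', (k < n)%N ->
     (if (k == i) && (j' == j) then B else setT) (incr m k j' e)].
Proof.
move=> im; apply/seteqP; split => e /=.
  by move=> Be k j' _; case: ifP => // /andP[/eqP -> /eqP ->].
by move=> /(_ i j im); rewrite !eqxx.
Qed.

Lemma incr_law m i j (B : set R) : measurable B ->
  mu (incr m i j @^-1` B) = normal_prob 0 (Num.sqrt (dy m 1)) B.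
Proof.
move=> mB; rewrite (single_incr m j B (ltnSn i)).
have NT := @probability_setT _ _ _ (normal_prob 0 (Num.sqrt (dy m 1 : R))).
pose BB k j' : set R := if (k == i) && (j' == j) then B else setT.
rewrite (@fdd_grid _ _ fdd m i.+1 BB); last first.
  by move=> k j'; rewrite /BB; case: ifP => // _; exact: measurableT.
rewrite big_ord_recr /= big1 ?mul1e; last first.
  move=> k _; rewrite big1 // => j' _.
  by rewrite /BB (ltn_eqF (ltn_ord k)) /= NT.
rewrite (bigD1 j) //= /BB !eqxx /= big1 ?mule1 // => j' /negbTE ->.
by rewrite NT.
Qed.

Lemma integrable_incr m i j : mu.-integrable setT (EFin \o incr m i j).
Proof.
have mi : measurable_fun setT (incr m i j : pathSpace R -> RR) by exact: measurable_incr.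
apply/integrableP; split; first exact/measurable_EFinP.
rewrite -(@ge0_integral_pushforward _ _ _ _ _ _ mi mu setT (fun x => `|x%:E|%E)) //; last exact: measurableT_comp.
have /integrableP[_] := integrable_normal_id (eq_ind_r is_true (dy1_gt0 m) (sqrtr_gt0 (dy m 1))).
congr (_ < _)%E.
apply: (@eq_measure_integral _ _ _ _ (image_measure mu mi)) => A mA _.
by rewrite /= /pushforward incr_law.
Qed.

Lemma integral_incr m i j : (\int[mu]_e (incr m i j e)%:E = 0)%E.
Proof.
have mi : measurable_fun setT (incr m i j : pathSpace R -> RR) by exact: measurable_incr.
rewrite -(@integral_pushforward _ _ _ _ _ _ mi mu setT EFin) //; last exact: integrable_incr.
rewrite -[RHS](integral_normal_id (eq_ind_r is_true (dy1_gt0 m) (sqrtr_gt0 (dy m 1)))).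
apply: (@eq_measure_integral _ _ _ _ (normal_prob 0 (Num.sqrt (dy m 1))) (image_measure mu mi)) => A mA _.
by rewrite /= /pushforward incr_law.
Qed.

Lemma integral_incr_sq m i j : (\int[mu]_e (incr m i j e ^+ 2)%:E = (dy m 1 * v2)%:E)%E.
Proof.
have mi : measurable_fun setT (incr m i j : pathSpace R -> RR) by exact: measurable_incr.
have h0 := dy1_gt0 m.
transitivity (\int[image_measure mu mi]_(x in [set: RR]) (x ^+ 2)%:E)%E.
  rewrite ge0_integral_pushforward //; last by move=> x _; rewrite lee_fin sqr_ge0.
  by apply/measurable_EFinP; exact: exprn_measurable.
rewrite -[dy m 1 in RHS](sqr_sqrtr (ltW h0)) -integral_normal_sq ?sqrtr_gt0 //.
by apply: eq_measure_integral => A mA _; rewrite /= /pushforward incr_law.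
Qed.

Lemma integrable_incr_prod m i i' j :
  mu.-integrable setT (EFin \o (fun e => incr m i j e * incr m i' j e)).
Proof.
have mi k := measurable_incr m k j.
have isq k : mu.-integrable setT (fun e => (incr m k j e ^+ 2)%:E).
  apply/integrableP; split; first by apply/measurable_EFinP; exact: measurable_funX.
  under eq_integral do rewrite /= ger0_norm ?sqr_ge0 //.
  by rewrite integral_incr_sq ltry.
apply: (@le_integrable _ (pathSpace R) R mu setT measurableT _
  ((fun e : pathSpace R => (incr m i j e ^+ 2)%:E) \+ (fun e => (incr m i' j e ^+ 2)%:E))%E).
- by apply/measurable_EFinP; exact: measurable_funM.
- move=> e _ /=; rewrite lee_fin normrM [leRHS]ger0_norm ?addr_ge0 ?sqr_ge0 //.
  rewrite -[incr m i j e ^+ 2](@real_normK _ _) ?num_real //.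
  rewrite -[incr m i' j e ^+ 2](@real_normK _ _) ?num_real //.
  set a := `|_|; set b := `|_|; nra.
- exact: integrableD.
Qed.

Lemma integral_incr_prod m i i' j :
  (\int[mu]_e (incr m i j e * incr m i' j e)%:E =
   (if i == i' then dy m 1 * v2 else 0)%:E)%E.
Proof.
case: eqVneq => [<-|ii'].
  by rewrite -(integral_incr_sq m i j); under eq_integral do rewrite -expr2.
suff ind : indep_rv mu (incr m i j) (incr m i' j).
  have [_ ->] := integral_indep (integrable_incr m i j) (integrable_incr m i' j) ind.
  by rewrite !integral_incr mule0.
move=> B C mB mC.
have li : (i < (maxn i i').+1)%N by rewrite ltnS leq_maxl.
have li' : (i' < (maxn i i').+1)%N by rewrite ltnS leq_maxr.
rewrite (single_incr m j B li) (single_incr m j C li').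
apply: (@fdd_split m _ (fun k j' => if (k == i) && (j' == j) then B else setT)
  (fun k j' => if (k == i') && (j' == j) then C else setT)).
- by move=> k j'; case: ifP => // _; exact: measurableT.
- by move=> k j'; case: ifP => // _; exact: measurableT.
- move=> k j'; have [->|] := eqVneq k i; last by left.
  by right; rewrite (negbTE ii').
Qed.

Definition incr_pair m (a : nat * nat) (e : 'I_2 -> R -> R) : R :=
  incr m a.1 ord0 e * incr m a.2 ord_max e.

(** The products of an increment of the first coordinate with one of the second are orthogonal in
    $L^2$: the coordinates are independent, which reduces the fourth-order moment to two
    covariances. *)
Lemma integral_incr_pair m a b :
  mu.-integrable setT (fun e => (incr_pair m a e * incr_pair m b e)%:E) /\
  (\int[mu]_e (incr_pair m a e * incr_pair m b e)%:E =
   (if a == b then (dy m 1 * v2) ^+ 2 else 0)%:E)%E.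
Proof.
pose X (e : pathSpace R) := incr m a.1 ord0 e * incr m b.1 ord0 e.
pose Y (e : pathSpace R) := incr m a.2 ord_max e * incr m b.2 ord_max e.
have XYE : (fun e => (incr_pair m a e * incr_pair m b e)%:E) =
    (fun e => (X e * Y e)%:E : \bar R).
  by apply/funext => e; rewrite /incr_pair /X /Y; congr EFin; ring.
rewrite XYE.
suff ind : indep_rv mu X Y.
  have [iXY ->] := integral_indep (integrable_incr_prod m a.1 b.1 ord0)
    (integrable_incr_prod m a.2 b.2 ord_max) ind.
  split => //; rewrite !integral_incr_prod -EFinM; congr EFin.
  rewrite -[a == b]/((a.1 == b.1) && (a.2 == b.2)).
  by case: eqP => _ /=; [case: eqP => _; [rewrite expr2|rewrite mulr0]|rewrite mul0r].
pose G i i' j : set (set (pathSpace R)) := [set A | exists2 B : set R * set R,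
   measurable B.1 /\ measurable B.2 &
   A = incr m i j @^-1` B.1 `&` incr m i' j @^-1` B.2].
have mG i i' j : G i i' j `<=` measurable.
  move=> _ [[B C] [/= mB mC] ->].
  by apply: measurableI; apply: measurable_preimage => //; exact: measurable_incr.
have IG i i' j : setI_closed (G i i' j).
  move=> _ _ [[B C] [/= mB mC] ->] [[B' C'] [/= mB' mC'] ->].
  exists (B `&` B', C `&` C'); first by split; exact: measurableI.
  by rewrite /= !preimage_setI setIACA.
have GT i i' j : G i i' j setT.
  by exists (setT, setT); [split; exact: measurableT|rewrite /= !preimage_setT setTI].
have mprod i i' j (B : set R) : measurable B ->
    <<s G i i' j >> ((fun e => incr m i j e * incr m i' j e) @^-1` B).
  move=> mB.
  pose S := g_sigma_algebraType (G i i' j).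
  have m1 : measurable_fun setT (incr m i j : S -> R).
    move=> _ C mC; rewrite setTI; apply: sub_sigma_algebra.
    by exists (C, setT); [split => //; exact: measurableT|rewrite /= preimage_setT setIT].
  have m2 : measurable_fun setT (incr m i' j : S -> R).
    move=> _ C mC; rewrite setTI; apply: sub_sigma_algebra.
    by exists (setT, C); [split => //; exact: measurableT|rewrite /= preimage_setT setTI].
  have := measurable_funM m1 m2 measurableT mB.
  by rewrite setTI.
move=> B C mB mC.
apply: (@indep_generated R _ _ mu (G a.1 b.1 ord0) (G a.2 b.2 ord_max)) => //;
  try exact: mprod.
move=> _ _ [[B1 B2] [/= mB1 mB2] ->] [[C1 C2] [/= mC1 mC2] ->].
pose n := (maxn (maxn a.1 b.1) (maxn a.2 b.2)).+1.
have l1 : (a.1 < n)%N by rewrite ltnS !leq_max leqnn.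
have l2 : (b.1 < n)%N by rewrite ltnS !leq_max leqnn !orbT.
have l3 : (a.2 < n)%N by rewrite ltnS !leq_max leqnn !orbT.
have l4 : (b.2 < n)%N by rewrite ltnS !leq_max leqnn !orbT.
have twoE i i' j (A A' : set R) : (i < n)%N -> (i' < n)%N ->
   incr m i j @^-1` A `&` incr m i' j @^-1` A' =
   [set e | forall k j', (k < n)%N ->
     ((if (k == i) && (j' == j) then A else setT) `&`
      (if (k == i') && (j' == j) then A' else setT)) (incr m k j' e)].
  move=> li li'; rewrite (single_incr m j A li) (single_incr m j A' li').
  apply/seteqP; split => e /=.
    by move=> [H1 H2] k j' kn; split; [exact: H1|exact: H2].
  by move=> H; split => k j' kn; have [] := H k j' kn.
rewrite !twoE //.
apply: (@fdd_split m n (fun k j' => (if (k == a.1) && (j' == ord0) then B1 else setT) `&`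
      (if (k == b.1) && (j' == ord0) then B2 else setT))
  (fun k j' => (if (k == a.2) && (j' == ord_max) then C1 else setT) `&`
      (if (k == b.2) && (j' == ord_max) then C2 else setT))).
- by move=> k j'; apply: measurableI; case: ifP => // _; exact: measurableT.
- by move=> k j'; apply: measurableI; case: ifP => // _; exact: measurableT.
- move=> k j'; case: (eqVneq j' ord0) => [->|_].
    by right; rewrite !andbF setTI.
  by left; rewrite !andbF setTI.
Qed.

(** Parseval's identity in this orthogonal family. *)
Lemma integral_quad_form m n (C : nat -> nat -> R) :
  (\int[mu]_e ((\sum_(i < n) \sum_(j < n) C i j * incr_pair m (val i, val j) e) ^+ 2)%:E =
   ((dy m 1 * v2) ^+ 2 * \sum_(i < n) \sum_(j < n) C i j ^+ 2)%:E)%E.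
Proof.
pose I := ('I_n * 'I_n)%type.
pose na (a : I) : nat * nat := (val a.1, val a.2).
pose D (a : I) := C a.1 a.2.
have E1 e : \sum_(i < n) \sum_(j < n) C i j * incr_pair m (val i, val j) e =
   \sum_(a : I) D a * incr_pair m (na a) e by rewrite pair_bigA.
rewrite pair_bigA -/I /=.
transitivity (\int[mu]_e (\sum_(c : I * I) ((D c.1 * D c.2)%:E *
    (incr_pair m (na c.1) e * incr_pair m (na c.2) e)%:E))%E)%E.
  apply: eq_integral => e _; rewrite E1 expr2 mulr_suml.
  under eq_bigr do rewrite mulr_sumr.
  rewrite pair_bigA /= -sumEFin; apply: eq_bigr => c _.
  by rewrite -EFinM; congr EFin; ring.
rewrite integral_sum //; last first.
  by move=> c; apply: integrableZl => //; have [] := integral_incr_pair m (na c.1) (na c.2).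
have iE (c : I * I) : (\int[mu]_e ((D c.1 * D c.2)%:E *
    (incr_pair m (na c.1) e * incr_pair m (na c.2) e)%:E) =
    (D c.1 * D c.2 * (if c.1 == c.2 then (dy m 1 * v2) ^+ 2 else 0))%:E)%E.
  have [ic icE] := integral_incr_pair m (na c.1) (na c.2).
  by rewrite integralZl // icE -EFinM.
rewrite (eq_bigr _ (fun c _ => iE c)).
rewrite sumEFin; congr EFin.
rewrite -(pair_bigA _ (fun a b => D a * D b * (if a == b then (dy m 1 * v2) ^+ 2 else 0))) /=.
rewrite mulr_sumr; apply: eq_bigr => a _.
rewrite (bigD1 a) //= eqxx big1 ?addr0 => [|b /negbTE ba].
  by rewrite /D; ring.
by rewrite eq_sym ba mulr0.
Qed.

End increments.

(** There are [n] blocks of [K] steps of mesh $2^{-m}$ each. Blocks of any integer length are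
    allowed, because the Riemann sums that define the area at time $k/2^p$ have step $k/2^{p+n}$. *)
Definition levy_coarse {R : realType} (m K n : nat) (e : 'I_2 -> R -> R) : R :=
  2^-1 * \sum_(b < n)
    (co e ord0 (dy m (b * K)) * (co e ord_max (dy m (b.+1 * K)) - co e ord_max (dy m (b * K)))
     - co e ord_max (dy m (b * K)) * (co e ord0 (dy m (b.+1 * K)) - co e ord0 (dy m (b * K)))).

Definition levy_fine {R : realType} (m n : nat) (e : 'I_2 -> R -> R) : R :=
  levy_coarse m 1 n e.

Section riemann_sums.
Context {R : realType}.
Implicit Types (e : 'I_2 -> R -> R).

Lemma co_dyE m k j e : co e j (dy m k) = \sum_(i < k) incr m i j e.
Proof.
elim: k => [|k IH]; first by rewrite big_ord0 dy0 co0.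
by rewrite big_ord_recr /= -IH /incr; ring.
Qed.

Lemma co_dyB m k l j e : (k <= l)%N ->
  co e j (dy m l) - co e j (dy m k) = \sum_(i < l | (k <= i)%N) incr m i j e.
Proof.
move=> kl; rewrite !co_dyE (bigID (fun i : 'I_l => (k <= i)%N)) /=.
rewrite (_ : \sum_(i < k) _ = \sum_(i < l | ~~ (k <= i)%N) incr m i j e); first by rewrite addrK.
rewrite (big_ord_widen _ (fun i => incr m i j e) kl).
by apply: eq_bigl => i; rewrite -ltnNge.
Qed.

(** Within a block the increments telescope; the integrand is frozen at the left end of the block
    that contains step [j]. *)
Lemma levy_coarseE m K n e : (0 < K)%N -> levy_coarse m K n e =
  2^-1 * \sum_(j < n * K) (co e ord0 (dy m (j %/ K * K)) * incr m j ord_max e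
                           - co e ord_max (dy m (j %/ K * K)) * incr m j ord0 e).
Proof.
move=> K0; rewrite /levy_coarse; congr (_ * _).
elim: n => [|n IH]; first by rewrite !big_ord0.
rewrite big_ord_recr /= IH.
have cast : (n.+1 * K = n * K + K)%N by rewrite mulSn addnC.
rewrite -[in RHS](big_mkord xpredT (fun j => co e ord0 (dy m (j %/ K * K)) * incr m j ord_max e
                           - co e ord_max (dy m (j %/ K * K)) * incr m j ord0 e)).
rewrite cast (big_cat_nat _ (n := n * K)) //= ?leq_addr // big_mkord; congr (_ + _).
have blk j : \sum_(n * K <= i < n * K + K) incr m i j e =
    co e j (dy m (n * K + K)) - co e j (dy m (n * K)).
  rewrite co_dyB ?leq_addr // -(big_mkord (fun i => (n * K <= i)%N) (fun i => incr m i j e)).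
  rewrite [in RHS](big_cat_nat _ (n := n * K)) //= ?leq_addr //.
  rewrite [X in _ = X + _]big_nat_cond [X in _ = X + _]big_pred0; last first.
    by move=> i; apply/negbTE/negP => /andP[/andP[_ h]]; rewrite leqNgt h.
  rewrite add0r big_nat_cond [in RHS]big_nat_cond; apply: eq_bigl => i.
  by case: (n * K <= i)%N; rewrite ?andbT ?andbF.
rewrite (eq_big_nat _ _ (F2 := fun j => co e ord0 (dy m (n * K)) * incr m j ord_max e
      - co e ord_max (dy m (n * K)) * incr m j ord0 e)); last first.
  move=> j /andP[nj jn]; rewrite (_ : j %/ K = n)%N //.
  by rewrite -(subnKC nj) divnMDl // divn_small ?addn0 // ltn_subLR.
by rewrite sumrB -!mulr_sumr !blk.
Qed.

(** The coefficient of the product of $\Delta_iW_1$ and $\Delta_jW_2$: it is $\pm 1/2$ according to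
    the order of two distinct steps of the same block, and 0 otherwise. *)
Definition block_coef (K i j : nat) : R :=
  2^-1 * (((j %/ K * K <= i < j)%N)%:R - ((i %/ K * K <= j < i)%N)%:R).

Lemma fine_coarseE m K n e : (0 < K)%N ->
  levy_fine m (n * K) e - levy_coarse m K n e =
  \sum_(i < n * K) \sum_(j < n * K) block_coef K i j * incr_pair m (val i, val j) e.
Proof.
move=> K0; rewrite /levy_fine !levy_coarseE // muln1 -mulrBr -sumrB.
have widen j q (jn : (j < n * K)%N) :
    co e q (dy m j) - co e q (dy m (j %/ K * K)) =
    \sum_(i < n * K) ((j %/ K * K <= i < j)%N)%:R * incr m i q e.
  rewrite co_dyB ?leq_trunc_div // (big_ord_widen_cond _ (fun i => (j %/ K * K <= i)%N)
      (fun i => incr m i q e) (ltnW jn)) big_mkcond /=.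
  by apply: eq_bigr => i _; case: ifP; rewrite ?mul1r ?mul0r.
rewrite (eq_bigr (fun j : 'I_(n * K) =>
   (\sum_(i < n * K) ((j %/ K * K <= i < j)%N)%:R * incr m i ord0 e) * incr m j ord_max e -
   (\sum_(i < n * K) ((j %/ K * K <= i < j)%N)%:R * incr m i ord_max e) * incr m j ord0 e)); last first.
  by move=> j _; rewrite -!widen // divn1 muln1; ring.
rewrite sumrB.
under eq_bigr do rewrite mulr_suml.
rewrite exchange_big /=.
under [X in _ - X]eq_bigr do rewrite mulr_suml.
rewrite -sumrB mulr_sumr; apply: eq_bigr => i _.
rewrite -sumrB mulr_sumr; apply: eq_bigr => j _.
by rewrite /block_coef /incr_pair /=; ring.
Qed.

(** Each step precedes or follows at most [K] others of its block. *)
Lemma block_coef_sum K n : (0 < K)%N ->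
  \sum_(i < n * K) \sum_(j < n * K) block_coef K i j ^+ 2 <= 2^-1 * (n * K * K)%:R.
Proof.
move=> K0.
have sq i j : block_coef K i j ^+ 2 <=
    4^-1 * (((j %/ K * K <= i < j)%N)%:R + ((i %/ K * K <= j < i)%N)%:R).
  rewrite /block_coef; case: (_ <= i < j)%N; case: (_ <= j < i)%N => /=; lra.
have cnt j : \sum_(i < n * K) (((j %/ K * K <= i < j)%N)%:R : R) <= K%:R.
  rewrite -natr_sum ler_nat -(big_mkord xpredT (fun i => nat_of_bool (j %/ K * K <= i < j)%N)).
  have [a] : exists a, a = (j %/ K * K)%N by eexists.
  move=> /esym aE; have ja : (j <= a + K)%N.
    by rewrite -aE {1}(divn_eq j K) leq_add2l ltnW // ltn_mod.
  rewrite aE -big_mkcond /= sum1_count.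
  rewrite (@leq_trans (size [seq i <- iota 0 (n * K) | (a <= i < j)%N]))//.
    by rewrite size_filter /index_iota subn0.
  rewrite -(size_iota a K); apply: uniq_leq_size; first by rewrite filter_uniq // iota_uniq.
  move=> i; rewrite mem_filter !mem_iota => /andP[/andP[-> ij] _] /=.
  exact: leq_trans ij ja.
apply: (@le_trans _ _ (\sum_(i < n * K) \sum_(j < n * K)
   4^-1 * (((j %/ K * K <= i < j)%N)%:R + ((i %/ K * K <= j < i)%N)%:R))).
  by apply: ler_sum => i _; apply: ler_sum => j _; exact: sq.
under eq_bigr do rewrite -mulr_sumr big_split /=.
rewrite -mulr_sumr big_split /= exchange_big /=.
have := ler_sum (index_enum 'I_(n * K)) (fun (i : 'I_(n * K)) (_ : true) => cnt i).
rewrite sumr_const card_ord -[K%:R *+ _]mulr_natl -natrM => H.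
lra.
Qed.

Variable mu : probability (pathSpace R) R.
Hypothesis fdd : brownian_fdd mu.

(** In terms of time, the bound is a constant times the total time $nK2^{-m}$ times the block length
    $K2^{-m}$. *)
Lemma integral_fine_coarse m K n : (0 < K)%N ->
  (\int[mu]_e ((levy_fine m (n * K) e - levy_coarse m K n e) ^+ 2)%:E <=
   ((dy m 1 * normal_var R) ^+ 2 * (n * K * K)%:R)%:E)%E.
Proof.
move=> K0; under eq_integral do rewrite (fine_coarseE _ _ _ K0).
rewrite (integral_quad_form fdd) lee_fin ler_wpM2l ?sqr_ge0 //.
rewrite (le_trans (block_coef_sum n K0)) // ler_piMl //.
lra.
Qed.

End riemann_sums.

(** * Levy area along dyadic times *)

Section ae_monotone.
Context {R : realType} d (T : measurableType d) (P : {measure set T -> \bar R}).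

Lemma ae_mono (A B : T -> Prop) : (forall w, A w -> B w) ->
  {ae P, forall w, A w} -> {ae P, forall w, B w}.
Proof. by move=> AB; apply: filterS. Qed.

Lemma ae_mono2 (A B C : T -> Prop) : (forall w, A w -> B w -> C w) ->
  {ae P, forall w, A w} -> {ae P, forall w, B w} -> {ae P, forall w, C w}.
Proof. by move=> ABC; apply: filterS2. Qed.

End ae_monotone.

Section ae_geometric.
Context {R : realType} d (T : measurableType d) (P : {measure set T -> \bar R}).

(** The weights $(16/9)^n$ leave a convergent series, since $16/9\cdot 1/2=8/9$, so the weighted sum
    of squares is integrable and almost surely finite. The rate 9/16 has the rational square root
    3/4. *)
Lemma ae_geometric_decay (f : nat -> T -> R) (C : R) :
  (forall n, measurable_fun setT (f n)) -> 0 <= C ->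
  (forall n, (\int[P]_w ((f n w) ^+ 2)%:E <= (C / 2 ^+ n)%:E)%E) ->
  {ae P, forall w, exists M : R, forall n, (f n w) ^+ 2 <= M * (9 / 16) ^+ n}.
Proof.
move=> mf C0 fC.
pose g n w : \bar R := ((16 / 9) ^+ n * (f n w) ^+ 2)%:E.
have c0 n : 0 <= (16 / 9) ^+ n :> R by rewrite exprn_ge0 // divr_ge0.
have g0 n w : (0 <= g n w)%E by rewrite lee_fin mulr_ge0 // sqr_ge0.
have mg n : measurable_fun setT (g n).
  by apply/measurable_EFinP; apply: measurable_funM => //; exact: measurable_funX.
have sum_le : (\int[P]_w (\sum_(0 <= n <oo) g n w) <= (9 * C)%:E)%E.
  rewrite integral_nneseries //.
  apply: lime_le.
    by apply: is_cvg_nneseries => n _ _; apply: integral_ge0 => w _; exact: g0.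
  apply: nearW => N.
  apply: (@le_trans _ _ (\sum_(0 <= n < N) (C * (8 / 9) ^+ n)%:E)%E).
    apply: lee_sum => n _; rewrite /g.
    under eq_integral do rewrite EFinM.
    have mf2 : measurable_fun setT (fun w => (f n w ^+ 2)%:E) by apply/measurable_EFinP; exact: measurable_funX.
    have f20 w : setT w -> (0 <= (f n w ^+ 2)%:E)%E by rewrite lee_fin sqr_ge0.
    rewrite ge0_integralZl ?lee_fin //.
    apply: (@le_trans _ _ (((16 / 9) ^+ n)%:E * (C / 2 ^+ n)%:E)%E).
      by apply: lee_wpmul2l => //; rewrite lee_fin.
    rewrite -EFinM lee_fin mulrCA -exprVn -exprMn.
    by rewrite (_ : 16 / 9 / 2 = 8 / 9 :> R) //; field.
  rewrite sumEFin lee_fin -mulr_sumr mulrC ler_wpM2r //.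
  suff -> : \sum_(0 <= n < N) (8 / 9) ^+ n = 9 * (1 - (8 / 9) ^+ N) :> R.
    by rewrite ler_piMr // gerBl exprn_ge0 // divr_ge0.
  elim: N => [|N IH]; first by rewrite big_geq // expr0 subrr mulr0.
  by rewrite big_nat_recr //= IH exprS; field.
have mS : measurable_fun setT (fun w => (\sum_(0 <= n <oo) g n w)%E).
  exact: ge0_emeasurable_sum.
have int : P.-integrable setT (fun w => (\sum_(0 <= n <oo) g n w)%E).
  apply/integrableP; split => //.
  under eq_integral do rewrite gee0_abs ?nneseries_ge0 //.
  by rewrite (le_lt_trans sum_le) // ltry.
have := integrable_ae measurableT int; apply: filterS => w /(_ Logic.I) fin.
exists (fine (\sum_(0 <= n <oo) g n w)%E) => n.
have le : (g n w <= \sum_(0 <= n <oo) g n w)%E.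
  apply: (@le_trans _ _ (\sum_(0 <= i < n.+1) g i w)%E).
    by rewrite big_nat_recr //= leeDr // sume_ge0.
  exact: nneseries_lim_ge.
have {}le : (16 / 9) ^+ n * f n w ^+ 2 <= fine (\sum_(0 <= n <oo) g n w)%E.
  by rewrite -lee_fin fineK.
have -> : (9 / 16) ^+ n = ((16 / 9) ^+ n)^-1 :> R.
  by rewrite -exprVn; congr (_ ^+ _); field.
by rewrite ler_pdivlMr ?exprn_gt0 ?divr_gt0 // mulrC.
Qed.

Lemma geometric_decay_norm (u : nat -> R) (M : R) :
  (forall n, u n ^+ 2 <= M * (9 / 16) ^+ n) ->
  forall n, `|u n| <= geometric (Num.sqrt M) (3 / 4) n.
Proof.
move=> uM n /=.
have M0 : 0 <= M by have := uM 0%N; rewrite expr0 mulr1; apply: le_trans; exact: sqr_ge0.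
rewrite -sqrtr_sqr.
have c : 0 <= 3 / 4 :> R by lra.
have -> : Num.sqrt M * (3 / 4) ^+ n = Num.sqrt (M * (9 / 16) ^+ n).
  rewrite sqrtrM //; congr (_ * _).
  rewrite (_ : 9 / 16 = (3 / 4) ^+ 2); last by field.
  by rewrite exprAC sqrtr_sqr ger0_norm // exprn_ge0.
by rewrite ler_sqrt ?uM // mulr_ge0 // exprn_ge0; lra.
Qed.

Lemma geometric_decay_cvg0 (u : nat -> R) (M : R) :
  (forall n, u n ^+ 2 <= M * (9 / 16) ^+ n) -> u n @[n --> \oo] --> 0.
Proof.
move=> /geometric_decay_norm uM.
have c1 : `|3 / 4| < 1 :> R by rewrite ger0_norm; lra.
apply: (@squeeze_cvgr _ _ _ _ (fun n => - geometric (Num.sqrt M) (3 / 4) n)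
  (geometric (Num.sqrt M) (3 / 4))).
- by apply: nearW => n; rewrite -ler_norml; exact: uM.
- by rewrite -oppr0; apply: cvgN; exact: cvg_geometric.
- exact: cvg_geometric.
Qed.

Lemma geometric_decay_series (u : nat -> R) (M : R) :
  (forall n, (u n.+1 - u n) ^+ 2 <= M * (9 / 16) ^+ n) -> cvgn u.
Proof.
move=> /geometric_decay_norm uM.
have c1 : `|3 / 4| < 1 :> R by rewrite ger0_norm; lra.
have cv : cvgn (series (fun n => u n.+1 - u n)).
  apply: normed_cvg; apply: (series_le_cvg _ _ uM).
  - by move=> n; exact: normr_ge0.
  - by move=> n; exact: le_trans (normr_ge0 _) (uM n).
  - exact: is_cvg_geometric_series.
have -> : u = (fun n => u 0%N + series (fun n => u n.+1 - u n) n).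
  by apply/funext => n; rewrite /series /= telescope_sumr // addrC subrK.
by apply: is_cvgD => //; exact: is_cvg_cst.
Qed.

End ae_geometric.

Definition area_cvg {R : realType} (e : 'I_2 -> R -> R) :=
  forall p k, cvgn (fun q => levy_fine (p + q) (k * 2 ^ q) e).

(** The upper limit makes this measurable on the whole path space; it is the limit of the sums
    wherever [area_cvg] holds. *)
Definition area {R : realType} (p k : nat) (e : 'I_2 -> R -> R) : R :=
  fine (limn_esup (fun q => (levy_fine (p + q) (k * 2 ^ q) e)%:E)).

Section area.
Context {R : realType}.
Implicit Types (e : 'I_2 -> R -> R).

Lemma measurable_levy_coarse m K n :
  measurable_fun setT (levy_coarse m K n : pathSpace R -> R).
Proof.
have mc j k := @measurable_co R j m k.
rewrite /levy_coarse; apply: measurable_funM => //.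
apply: (@measurable_sum _ (pathSpace R)) => b.
by apply: measurable_funB; apply: measurable_funM => //; exact: measurable_funB.
Qed.

Lemma measurable_area p k : measurable_fun setT (area p k : pathSpace R -> R).
Proof.
apply: (@measurableT_comp _ _ _ _ _ _ (fine : \bar R -> R)); first exact: fine_measurable.
apply: measurable_fun_limn_esup => q.
by apply/measurable_EFinP; exact: measurable_levy_coarse.
Qed.

Lemma cvg_area p k e : area_cvg e ->
  levy_fine (p + q) (k * 2 ^ q) e @[q --> \oo] --> area p k e.
Proof.
move=> /(_ p k) cv; rewrite /area.
have : ((levy_fine (p + q) (k * 2 ^ q) e)%:E @[q --> \oo] -->
    (limn (fun q => levy_fine (p + q) (k * 2 ^ q) e))%:E)%E.
  by apply: cvg_EFin; [exact: nearW|exact: cv].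
by move=> /cvg_limn_einf_sup[_ ->] /=.
Qed.

Arguments cvg_area p k {e}.

Lemma levy_fineS m n e : levy_fine m n.+1 e = levy_fine m n e + 2^-1 *
   (co e ord0 (dy m n) * (co e ord_max (dy m n.+1) - co e ord_max (dy m n))
     - co e ord_max (dy m n) * (co e ord0 (dy m n.+1) - co e ord0 (dy m n))).
Proof. by rewrite /levy_fine /levy_coarse big_ord_recr /= mulrDr !muln1. Qed.

Lemma levy_fine0 m e : levy_fine m 0 e = 0.
Proof. by rewrite /levy_fine /levy_coarse big_ord0 mulr0. Qed.

(** Chen's relation for Riemann sums: concatenating paths amounts to multiplying in the Heisenberg
    group. *)
Lemma levy_fine_shift N m n e :
  levy_fine m (N * 2 ^ m + n) e = levy_fine m (N * 2 ^ m) e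
   + 2^-1 * (co e ord0 N%:R * (co e ord_max (N%:R + dy m n) - co e ord_max N%:R)
            - co e ord_max N%:R * (co e ord0 (N%:R + dy m n) - co e ord0 N%:R))
   + levy_fine m n (path_shift N e).
Proof.
elim: n => [|n IH]; first by rewrite addn0 dy0 addr0 levy_fine0; ring.
rewrite addnS !levy_fineS IH -addnS !co_shift !addr_dy.
by rewrite -!(dy_intM m N); ring.
Qed.

Lemma levy_fine_stop N m n e : (n <= N * 2 ^ m)%N ->
  levy_fine m n (path_stop N e) = levy_fine m n e.
Proof.
elim: n => [|n IH] nN; first by rewrite !levy_fine0.
have h1 : dy m n.+1 <= N%:R :> R by rewrite -(dy_intM m N) ler_dy.
have h2 : dy m n <= N%:R :> R by rewrite -(dy_intM m N) ler_dy ltnW.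
by rewrite !levy_fineS IH ?(ltnW nN) // !(co_stop_le _ _ h1) !(co_stop_le _ _ h2).
Qed.

Lemma levy_fine_flip i m n e : levy_fine m n (path_flip i e) = - levy_fine m n e.
Proof.
elim: n => [|n IH]; first by rewrite !levy_fine0 oppr0.
rewrite !levy_fineS IH !co_flip.
by case: (unliftP ord0 i) => [j ->|->] /=; [rewrite (ord1 j)|]; rewrite /=; ring.
Qed.

Lemma levy_fine_scale4 m n e :
  levy_fine m.+2 n (scale4 e) = 4^-1 * levy_fine m n e.
Proof.
have dE k : 4 * dy m.+2 k = dy m k :> R.
  by rewrite dy4 mulnC -addn2 -[4%N]/(2 ^ 2)%N dyMe.
elim: n => [|n IH]; first by rewrite !levy_fine0 mulr0.
by rewrite !levy_fineS IH !co_scale4 !dE; field.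
Qed.

Lemma levy_sum_coarse p k n e :
  levy_sum (fun j t e => co e j t) (dy p k) n e = levy_coarse (p + n) k (2 ^ n) e.
Proof.
have tE i : i%:R * dy p k / (2 ^ n)%:R = dy (p + n) (i * k) :> R.
  rewrite unlock natrM natrX exprD; field.
  by rewrite !expf_neq0.
by rewrite /levy_sum /levy_coarse; congr (_ * _); apply: eq_bigr => i _; rewrite !tE.
Qed.

Lemma levy_fine_coarse2 m n e : levy_coarse m.+1 2 n e = levy_fine m n e.
Proof.
have dE k : dy m.+1 (k * 2) = dy m k :> R by rewrite -addn1 -[2%N]/(2 ^ 1)%N dyMe.
rewrite /levy_fine /levy_coarse; congr (_ * _); apply: eq_bigr => i _.
by rewrite !dE !muln1.
Qed.

Lemma area_cvg_shift N e : area_cvg e -> area_cvg (path_shift N e).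
Proof.
move=> cv p k.
set w := 2^-1 * (co e ord0 N%:R * (co e ord_max (N%:R + dy p k) - co e ord_max N%:R)
            - co e ord_max N%:R * (co e ord0 (N%:R + dy p k) - co e ord0 N%:R)).
have -> : (fun q => levy_fine (p + q) (k * 2 ^ q) (path_shift N e)) =
   (fun q => levy_fine (p + q) ((N * 2 ^ p + k) * 2 ^ q) e -
             levy_fine (p + q) (N * 2 ^ p * 2 ^ q) e - w).
  apply/funext => q.
  have NE : (N * 2 ^ p * 2 ^ q = N * 2 ^ (p + q))%N by rewrite -mulnA -expnD.
  by rewrite mulnDl NE levy_fine_shift dyMe /w; ring.
apply: is_cvgB; last exact: is_cvg_cst.
by apply: is_cvgB; exact: cv.
Qed.

Lemma area_int p n e : area_cvg e -> area p (n * 2 ^ p) e = area 0 n e.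
Proof.
move=> cv; have := cvg_area 0 n cv; rewrite -(cvg_shiftn p) => h.
apply: cvg_unique h => //.
rewrite (_ : [sequence _]_n = (fun q => levy_fine (p + q) (n * 2 ^ p * 2 ^ q) e)).
  exact: cvg_area.
by apply/funext => q /=; rewrite add0n addnC -mulnA -expnD.
Qed.

Lemma area_shift N p k e : area_cvg e ->
  area p (N * 2 ^ p + k) e = area 0 N e
   + 2^-1 * (co e ord0 N%:R * co (path_shift N e) ord_max (dy p k)
            - co e ord_max N%:R * co (path_shift N e) ord0 (dy p k))
   + area p k (path_shift N e).
Proof.
move=> cv; have h := cvg_area p (N * 2 ^ p + k) cv.
apply: cvg_unique h _ => //.
rewrite -(area_int p N cv) !co_shift.
set w := 2^-1 * _.
rewrite (_ : (fun q => _) = (fun q => levy_fine (p + q) (N * 2 ^ p * 2 ^ q) e + w +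
   levy_fine (p + q) (k * 2 ^ q) (path_shift N e))).
  apply: cvgD; last by apply: cvg_area; exact: area_cvg_shift.
  by apply: cvgD; [exact: cvg_area|exact: cvg_cst].
apply/funext => q.
have NE : (N * 2 ^ p * 2 ^ q = N * 2 ^ (p + q))%N by rewrite -mulnA -expnD.
by rewrite mulnDl NE levy_fine_shift dyMe /w.
Qed.

Lemma area_stop N p k e : (k <= N * 2 ^ p)%N -> area p k (path_stop N e) = area p k e.
Proof.
move=> kN; rewrite /area; congr (fine (limn_esup _)); apply/funext => q.
by rewrite levy_fine_stop // expnD mulnA leq_mul2r kN orbT.
Qed.

Lemma area_flip i p k e : area_cvg e -> area p k (path_flip i e) = - area p k e.
Proof.
move=> cv; rewrite /area.
have h : ((levy_fine (p + q) (k * 2 ^ q) (path_flip i e))%:E @[q --> \oo] --> (- area p k e)%:E)%E.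
  apply: cvg_EFin; first exact: nearW.
  rewrite (_ : _ \o _ = (fun q => - levy_fine (p + q) (k * 2 ^ q) e)).
    by apply: cvgN; exact: cvg_area.
  by apply/funext => q /=; rewrite levy_fine_flip.
by have [_ ->] := cvg_limn_einf_sup h.
Qed.

Lemma area_scale4 p k e : area_cvg e -> area p k (scale4 e) = 4^-1 * area p (4 * k) e.
Proof.
move=> cv; rewrite {1}/area.
have h : ((levy_fine (p + q) (k * 2 ^ q) (scale4 e))%:E @[q --> \oo] --> (4^-1 * area p (4 * k) e)%:E)%E.
  rewrite -(cvg_shiftn 2); apply: cvg_EFin; first exact: nearW.
  rewrite (_ : _ \o _ = (fun q => 4^-1 * levy_fine (p + q) (4 * k * 2 ^ q) e)).
    by apply: cvgM; [exact: cvg_cst|exact: cvg_area].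
  apply/funext => q /=; rewrite addnA addn2 levy_fine_scale4 expnD mulnA.
  by rewrite mulnC mulnA.
by have [_ ->] := cvg_limn_einf_sup h.
Qed.

Variable mu : probability (pathSpace R) R.
Hypothesis fdd : brownian_fdd mu.

Lemma ae_forall_pair (Q : nat -> nat -> pathSpace R -> Prop) :
  (forall p k, {ae mu, forall e, Q p k e}) -> {ae mu, forall e, forall p k, Q p k e}.
Proof. by move=> h; apply: ae_foralln => p; apply: ae_foralln => k; exact: h. Qed.

Lemma inv_exp2_sq_le1 p : (2 ^- p) ^+ 2 <= 1 :> R.
Proof.
apply: exprn_ile1; first by rewrite invr_ge0 exprn_ge0.
by rewrite invf_le1 ?exprn_gt0 // exprn_ege1 // ler1n.
Qed.

(** Halving the mesh is the case [K = 2]: the mean square change at level [q] is of order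
    $2^{-q}$. *)
Lemma ae_area_cvg : {ae mu, forall e, area_cvg e}.
Proof.
apply: ae_forall_pair => p k.
have [] := @ae_geometric_decay R _ _ mu
  (fun q e => levy_fine (p + q.+1) (k * 2 ^ q.+1) e - levy_fine (p + q) (k * 2 ^ q) e)
  (normal_var R ^+ 2 * k%:R).
- by move=> q; apply: (@measurable_funB _ (pathSpace R)); exact: measurable_levy_coarse.
- by rewrite mulr_ge0 // sqr_ge0.
- move=> q; rewrite addnS expnS [(2 * _)%N]mulnC mulnA.
  under eq_integral do rewrite -(levy_fine_coarse2 (p + q)).
  rewrite (le_trans (integral_fine_coarse fdd _ _ _)) // lee_fin.
  rewrite unlock mul1r -addnS exprD (exprS _ q) !natrM natrX.
  rewrite (_ : _ * (k%:R * 2 ^+ q * 2 * 2) = (2 ^- p) ^+ 2 * (normal_var R ^+ 2 * k%:R / 2 ^+ q)); last first.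
    field; by rewrite !expf_neq0.
  apply: ler_piMl; last exact: inv_exp2_sq_le1.
  by rewrite divr_ge0 ?exprn_ge0 // mulr_ge0 ?sqr_ge0.
move=> A [mA A0 hA]; exists A; split => //; apply: subset_trans hA => e /= h [M hM]; apply: h.
exact: geometric_decay_series hM.
Qed.

(** The sums over $2^n$ equal intervals are block sums with the fixed block size [k], so their mean
    square distance to the dyadic sums decays like $2^{-n}$. *)
Lemma ae_cvg_levy_sum p k :
  {ae mu, forall e, levy_sum (fun j t e => co e j t) (dy p k) n e @[n --> \oo] --> area p k e}.
Proof.
(* Blocks of size 0 are excluded; at time 0 all the sums vanish. *)
case: k => [|k].
  have := ae_area_cvg; apply: ae_mono => e cv.
  rewrite (_ : (fun n => _) = (fun q => levy_fine (p + q) (0 * 2 ^ q) e)); first exact: cvg_area.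
  apply/funext => n; rewrite levy_sum_coarse mul0n levy_fine0.
  rewrite /levy_coarse big1 ?mulr0 // => i _.
  by rewrite !muln0 dy0 !co0; ring.
have h : {ae mu, forall e, exists M : R, forall q,
    (levy_fine (p + q) (k.+1 * 2 ^ q) e - levy_coarse (p + q) k.+1 (2 ^ q) e) ^+ 2 <= M * (9 / 16) ^+ q}.
  apply: (@ae_geometric_decay R _ _ mu _ (normal_var R ^+ 2 * (k.+1 * k.+1)%:R)) => [q||q].
  - by apply: (@measurable_funB _ (pathSpace R)); exact: measurable_levy_coarse.
  - by rewrite mulr_ge0 // sqr_ge0.
  rewrite [(k.+1 * 2 ^ _)%N]mulnC.
  rewrite (le_trans (integral_fine_coarse fdd _ _ _)) // lee_fin.
  rewrite unlock mul1r exprD !natrM natrX.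
  rewrite (_ : _ * (2 ^+ q * _ * _) = (2 ^- p) ^+ 2 * (normal_var R ^+ 2 * (k.+1%:R * k.+1%:R) / 2 ^+ q)); last first.
    field; by rewrite !expf_neq0.
  apply: ler_piMl; last exact: inv_exp2_sq_le1.
  by rewrite divr_ge0 ?exprn_ge0 // mulr_ge0 ?sqr_ge0 // mulr_ge0.
have h0 := ae_area_cvg; move: h0 h; apply: ae_mono2 => e cv [M hM].
rewrite -[area p k.+1 e]subr0 (_ : (fun n => _) = (fun q => levy_fine (p + q) (k.+1 * 2 ^ q) e -
   (levy_fine (p + q) (k.+1 * 2 ^ q) e - levy_coarse (p + q) k.+1 (2 ^ q) e))).
  by apply: cvgB; [exact: cvg_area|exact: (geometric_decay_cvg0 hM)].
by apply/funext => q; rewrite levy_sum_coarse; ring.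
Qed.

End area.
Arguments cvg_area {R} p k {e}.

(** * The homogeneous gauge *)

(** The fourth power of the homogeneous norm, so that the estimates stay polynomial. *)
Definition h4 {R : realType} (x y z : R) : R := (x ^+ 2 + y ^+ 2) ^+ 2 + z ^+ 2.

Definition hpt {R : realType} (p k : nat) (e : 'I_2 -> R -> R) : R :=
  h4 (co e ord0 (dy p k)) (co e ord_max (dy p k)) (area p k e).

(** For [rho >= 0], this is the event $g^*_n\le\rho$ as seen at dyadic times. *)
Definition stay {R : realType} (n : nat) (rho : R) : set ('I_2 -> R -> R) :=
  [set e | forall p k, (k <= n * 2 ^ p)%N -> hpt p k e <= rho ^+ 4].

Section geometry.
Context {R : realType}.
Implicit Types (x y z r c : R).

Lemma h4_ge0 x y z : 0 <= h4 x y z.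
Proof. by rewrite addr_ge0 ?sqr_ge0. Qed.

Lemma h4_bounds x y z r : 0 <= r -> h4 x y z <= r ^+ 4 ->
  [/\ x ^+ 2 + y ^+ 2 <= r ^+ 2, `|x| <= r, `|y| <= r & `|z| <= r ^+ 2].
Proof.
move=> r0; rewrite /h4 => h.
have r4 : r ^+ 4 = (r ^+ 2) ^+ 2 by rewrite -exprM.
have xy0 : 0 <= x ^+ 2 + y ^+ 2 by rewrite addr_ge0 ?sqr_ge0.
have xy : x ^+ 2 + y ^+ 2 <= r ^+ 2.
  rewrite -ler_sqr ?nnegrE ?sqr_ge0 // -r4 (le_trans _ h) // lerDl sqr_ge0 //.
split => //.
- rewrite -ler_sqr ?nnegrE // real_normK ?num_real // (le_trans _ xy) // lerDl sqr_ge0 //.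
- rewrite -ler_sqr ?nnegrE // real_normK ?num_real // (le_trans _ xy) // lerDr sqr_ge0 //.
- rewrite -ler_sqr ?nnegrE ?sqr_ge0 // real_normK ?num_real // -r4 (le_trans _ h) // lerDr sqr_ge0 //.
Qed.

Lemma h4_le x y z r E : 0 <= r -> 0 <= E -> x ^+ 2 + y ^+ 2 <= r + E -> `|z| <= r + E ->
  h4 x y z <= 2 * (r + E) ^+ 2.
Proof.
move=> r0 E0 hxy hz; rewrite /h4.
have xy0 : 0 <= x ^+ 2 + y ^+ 2 by rewrite addr_ge0 ?sqr_ge0.
have a1 : (x ^+ 2 + y ^+ 2) ^+ 2 <= (r + E) ^+ 2 by rewrite ler_sqr ?nnegrE // addr_ge0.
have a2 : z ^+ 2 <= (r + E) ^+ 2.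
  by rewrite -(real_normK (num_real z)) ler_sqr ?nnegrE ?addr_ge0.
lra.
Qed.

(** The squared horizontal norm is at most $4r^2$, the area at most $3r^2$, and
    $2(4r^2)^2\le(3r)^4$. *)
Lemma h4_quasi_triangle x0 y0 z0 x y z r : 0 <= r ->
  h4 x0 y0 z0 <= r ^+ 4 -> h4 x y z <= r ^+ 4 ->
  h4 (x0 + x) (y0 + y) (z0 + 2^-1 * (x0 * y - y0 * x) + z) <= (3 * r) ^+ 4.
Proof.
move=> r0 /(h4_bounds r0)[a1 a2 a3 a4] /(h4_bounds r0)[b1 b2 b3 b4].
have r20 : 0 <= r ^+ 2 by rewrite sqr_ge0.
apply: (@le_trans _ _ (2 * (r ^+ 2 + 3 * r ^+ 2) ^+ 2)).
  apply: h4_le => //; first by rewrite mulr_ge0.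
    have := sqr_ge0 (x0 - x); have := sqr_ge0 (y0 - y); lra.
  have t1 : `|x0 * y| <= r ^+ 2 by rewrite normrM expr2 ler_pM.
  have t2 : `|y0 * x| <= r ^+ 2 by rewrite normrM expr2 ler_pM.
  rewrite ler_norml.
  move: a4 b4 t1 t2; rewrite !ler_norml => /andP[? ?] /andP[? ?] /andP[? ?] /andP[? ?].
  by apply/andP; split; lra.
have -> : (3 * r) ^+ 4 = 81 * (r ^+ 2) ^+ 2 by ring.
have := sqr_ge0 (r ^+ 2); lra.
Qed.

(* In the coordinates (|v|^2, z) the gauge is a Euclidean norm, so that a fixed
   left translation changes the gauge by a bounded amount. *)
Lemma h4_translate x0 y0 z0 : exists2 c, 0 <= c & forall x y z r, 0 <= r ->
  h4 x y z <= r ^+ 4 ->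
  h4 (x0 + x) (y0 + y) (z0 + 2^-1 * (x0 * y - y0 * x) + z) <= (r + c) ^+ 4.
Proof.
pose k := `|x0| + `|y0| + `|z0|.
have k0 : 0 <= k by rewrite !addr_ge0.
pose D := 2 * k + 2 * k ^+ 2.
have k20 : 0 <= k ^+ 2 by rewrite sqr_ge0.
have D0 : 0 <= D by rewrite /D; lra.
exists (4 * D + 2); first lra.
move=> x y z r r0 hr; have [b1 b2 b3 b4] := h4_bounds r0 hr.
have xk : `|x0| <= k by rewrite /k -addrA lerDl addr_ge0.
have yk : `|y0| <= k by rewrite /k addrAC lerDr addr_ge0.
have zk : `|z0| <= k by rewrite /k lerDr addr_ge0.
(* Both coordinates of the gauge grow by at most $2E$; since $E$ is affine in $r$, the resulting
   quartic lies below $(r+4D+2)^4$. *)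
pose E := D * (r + 1).
have E0 : 0 <= E by rewrite mulr_ge0 // addr_ge0.
have kr : 0 <= k * r by rewrite mulr_ge0.
have EE : E = 2 * k * r + 2 * k + 2 * k ^+ 2 + 2 * k ^+ 2 * r by rewrite /E /D; ring.
have k2r : 0 <= k ^+ 2 * r by rewrite mulr_ge0.
have p1 : `|x0 * x| <= k * r by rewrite normrM ler_pM.
have p2 : `|y0 * y| <= k * r by rewrite normrM ler_pM.
have p3 : `|x0 * y| <= k * r by rewrite normrM ler_pM.
have p4 : `|y0 * x| <= k * r by rewrite normrM ler_pM.
have q1 : x0 ^+ 2 + y0 ^+ 2 <= k ^+ 2.
  rewrite -(real_normK (num_real x0)) -(real_normK (num_real y0)) /k.
  have ? := normr_ge0 x0; have ? := normr_ge0 y0; have ? := normr_ge0 z0; nra.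
have xyE : (x0 + x) ^+ 2 + (y0 + y) ^+ 2 <= x ^+ 2 + y ^+ 2 + 2 * E.
  move: p1 p2; rewrite !ler_norml => /andP[? ?] /andP[? ?]; rewrite EE; nra.
have zE : `|z0 + 2^-1 * (x0 * y - y0 * x) + z| <= `|z| + 2 * E.
  have : `|z0 + 2^-1 * (x0 * y - y0 * x)| <= 2 * E.
    rewrite ler_norml; move: p3 p4 zk; rewrite !ler_norml => /andP[? ?] /andP[? ?] /andP[? ?].
    by rewrite EE; apply/andP; split; lra.
  by move=> h; rewrite (le_trans (ler_normD _ _)) // addrC lerD2l.
have xy0 : 0 <= x ^+ 2 + y ^+ 2 by rewrite addr_ge0 ?sqr_ge0.
apply: (@le_trans _ _ ((x ^+ 2 + y ^+ 2 + 2 * E) ^+ 2 + (`|z| + 2 * E) ^+ 2)).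
  rewrite /h4 lerD //.
    by rewrite ler_sqr ?nnegrE //; [rewrite addr_ge0 ?sqr_ge0|lra].
  rewrite -(real_normK (num_real (_ + z))) ler_sqr ?nnegrE //.
  by have ? := normr_ge0 z; lra.
apply: (@le_trans _ _ (r ^+ 4 + 8 * E * r ^+ 2 + 8 * E ^+ 2)).
  have hr' : (x ^+ 2 + y ^+ 2) ^+ 2 + `|z| ^+ 2 <= r ^+ 4 by rewrite real_normK ?num_real.
  have := ler_wpM2l E0 (lerD b1 b4); lra.
rewrite -subr_ge0 (_ : _ - _ = r ^+ 3 * (8 * D + 8) + r ^+ 2 * (88 * D ^+ 2 + 88 * D + 24) +
  r * (256 * D ^+ 3 + 368 * D ^+ 2 + 192 * D + 32) +
  (256 * D ^+ 4 + 512 * D ^+ 3 + 376 * D ^+ 2 + 128 * D + 16)); last by rewrite /E; ring.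
have d2 := exprn_ge0 2 D0; have d3 := exprn_ge0 3 D0; have d4 := exprn_ge0 4 D0.
have r2 := exprn_ge0 2 r0; have r3 := exprn_ge0 3 r0.
have e1 := mulr_ge0 r3 D0; have e2 := mulr_ge0 r2 d2; have e3 := mulr_ge0 r2 D0.
have e4 := mulr_ge0 r0 d3; have e5 := mulr_ge0 r0 d2; have e6 := mulr_ge0 r0 D0.
lra.
Qed.

End geometry.

Section ae_measure.
Context {R : realType} d (T : measurableType d) (P : probability T R).

Lemma ae_le_measure (A B : set T) : measurable A -> measurable B ->
  {ae P, forall w, A w -> B w} -> (P A <= P B)%E.
Proof.
move=> mA mB [N [mN N0 AB]].
apply: (@le_trans _ _ (P (B `|` N))).
  apply: le_measure; rewrite ?inE //; first exact: measurableU.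
  move=> w Aw; have [?|nB] := pselect (B w); first by left.
  by right; apply: AB => /= /(_ Aw).
by rewrite (le_trans (measureU2 _ mB mN)) // [X in (_ + X)%E](_ : _ = 0%E) // adde0.
Qed.

Lemma ae_eq_measure (A B : set T) : measurable A -> measurable B ->
  {ae P, forall w, A w <-> B w} -> P A = P B.
Proof.
move=> mA mB AB; apply/eqP; rewrite eq_le; apply/andP; split; apply: ae_le_measure => //;
  by apply: ae_mono AB => w [].
Qed.

End ae_measure.

Section stay.
Context {R : realType}.
Implicit Types (e : 'I_2 -> R -> R) (rho : R).

Lemma area_refine p q k e : area_cvg e -> area (p + q) (k * 2 ^ q) e = area p k e.
Proof.
move=> cv; have := cvg_area p k cv; rewrite -(cvg_shiftn q) => h.
apply: cvg_unique h => //.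
rewrite (_ : [sequence _]_n = (fun i => levy_fine (p + q + i) (k * 2 ^ q * 2 ^ i) e)).
  exact: cvg_area.
by apply/funext => i /=; rewrite [(i + q)%N]addnC addnA -mulnA -expnD.
Qed.

Lemma hpt_refine p q k e : area_cvg e -> hpt (p + q) (k * 2 ^ q) e = hpt p k e.
Proof. by move=> cv; rewrite /hpt area_refine // dyMe. Qed.

Lemma measurable_hpt p k : measurable_fun setT (hpt p k : pathSpace R -> R).
Proof.
have mc j := @measurable_co R j p k.
have ma := @measurable_area R p k.
apply: measurable_funD; apply: measurable_funX => //.
by apply: measurable_funD; exact: measurable_funX.
Qed.

Lemma measurable_stay n rho : measurable (stay n rho : set (pathSpace R)).
Proof.
rewrite (_ : stay n rho = \bigcap_p \bigcap_(k in [set k | (k <= n * 2 ^ p)%N])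
    (setT `&` [set e : pathSpace R | hpt p k e <= rho ^+ 4])); last first.
  apply/seteqP; split => e /=.
    by move=> h p _ k /= kn; split => //; exact: h.
  by move=> h p k kn; have [] := h p Logic.I k kn.
apply: bigcapT_measurable => p; apply: bigcap_measurable; first by exists 0%N.
move=> k _; apply: measurable_fun_le => //.
exact: measurable_hpt.
Qed.

Lemma stay_le n n' rho rho' e : (n' <= n)%N -> 0 <= rho -> rho <= rho' ->
  stay n rho e -> stay n' rho' e.
Proof.
move=> nn r0 rr h p k kn; rewrite (le_trans (h p k _)) ?lerXn2r ?nnegrE //.
- by rewrite (leq_trans kn) // leq_mul2r nn orbT.
- exact: le_trans rr.
Qed.

Lemma stay_stop N n rho e : (n <= N)%N -> stay n rho (path_stop N e) <-> stay n rho e.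
Proof.
move=> nN.
have E p k : (k <= n * 2 ^ p)%N -> hpt p k (path_stop N e) = hpt p k e.
  move=> kn; have kN : (k <= N * 2 ^ p)%N by rewrite (leq_trans kn) // leq_mul2r nN orbT.
  have tN : dy p k <= N%:R :> R by rewrite -(dy_intM p N) ler_dy.
  by rewrite /hpt !(co_stop_le _ _ tN) area_stop.
by split => h p k kn; have := h p k kn; rewrite E.
Qed.

Lemma stay_scale4 n rho e : area_cvg e -> stay n rho (scale4 e) <-> stay (4 * n) (2 * rho) e.
Proof.
move=> cv.
have E p k : hpt p k (scale4 e) = 16^-1 * hpt p (4 * k) e.
  by rewrite /hpt /h4 !co_scale4 !dy4 area_scale4 //; field.
have rE : (2 * rho) ^+ 4 = 16 * rho ^+ 4 by ring.
split => h p k kn.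
  (* Refining by two levels turns the time $k/2^p$ into an index divisible by 4. *)
  have kn' : (k <= n * 2 ^ (p + 2))%N by rewrite expnD -[(2 ^ 2)%N]/4%N; lia.
  have := h (p + 2)%N k kn'; have := hpt_refine p 2 k cv.
  rewrite E rE [(4 * k)%N]mulnC -[(2 ^ 2)%N]/4%N => -> H.
  lra.
have := h p (4 * k)%N; rewrite rE E => H.
have {}H : hpt p (4 * k) e <= 16 * rho ^+ 4 by apply: H; lia.
lra.
Qed.

Lemma hpt_shift N p k e : area_cvg e ->
  hpt p (N * 2 ^ p + k) e =
  h4 (co e ord0 N%:R + co (path_shift N e) ord0 (dy p k))
     (co e ord_max N%:R + co (path_shift N e) ord_max (dy p k))
     (area 0 N e + 2^-1 * (co e ord0 N%:R * co (path_shift N e) ord_max (dy p k) -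
        co e ord_max N%:R * co (path_shift N e) ord0 (dy p k)) + area p k (path_shift N e)).
Proof.
move=> cv; rewrite /hpt area_shift //.
have E j : co e j (dy p (N * 2 ^ p + k)) = co e j N%:R + co (path_shift N e) j (dy p k).
  by rewrite co_shift addr_dy addrC subrK.
by rewrite !E.
Qed.

Lemma hpt_shift_inv N p k e : area_cvg e ->
  hpt p k (path_shift N e) =
  h4 (- co e ord0 N%:R + co e ord0 (dy p (N * 2 ^ p + k)))
     (- co e ord_max N%:R + co e ord_max (dy p (N * 2 ^ p + k)))
     (- area 0 N e + 2^-1 * (- co e ord0 N%:R * co e ord_max (dy p (N * 2 ^ p + k)) -
        - co e ord_max N%:R * co e ord0 (dy p (N * 2 ^ p + k))) + area p (N * 2 ^ p + k) e).
Proof.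
move=> cv; rewrite area_shift // /hpt !co_shift addr_dy.
by congr h4; ring.
Qed.

Lemma stay_split N n rho e :
  (forall p k, (k <= N * 2 ^ p)%N -> hpt p k e <= rho ^+ 4) ->
  (forall p k, (k <= n * 2 ^ p)%N -> hpt p (N * 2 ^ p + k) e <= rho ^+ 4) ->
  stay (N + n) rho e.
Proof.
move=> h1 h2 p k kn; have [kN|/ltnW Nk] := leqP k (N * 2 ^ p); first exact: h1.
by rewrite -(subnKC Nk); apply: h2; rewrite leq_subLR -mulnDl.
Qed.

(** The shifted path is the left translate by the inverse of the position at time [N]; the error [c]
    depends on the path, but neither on [n] nor on [rho]. *)
Lemma stay_shift_le N e : area_cvg e -> exists2 c : R, 0 <= c & forall n rho, 0 <= rho ->
  stay (N + n) rho e -> stay n (rho + c) (path_shift N e).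
Proof.
move=> cv; have [c c0 hc] := h4_translate (- co e ord0 N%:R) (- co e ord_max N%:R) (- area 0 N e).
exists c => // n rho r0 h p k kn; rewrite hpt_shift_inv //.
apply: hc => //; apply: h; by rewrite mulnDl leq_add2l.
Qed.

Lemma stay_shift_ge N M e : area_cvg e -> stay N M e ->
  exists2 c : R, 0 <= c & forall n rho, 0 <= rho ->
  stay n rho (path_shift N e) -> stay (N + n) (rho + c) e.
Proof.
move=> cv hM; have [c c0 hc] := h4_translate (co e ord0 N%:R) (co e ord_max N%:R) (area 0 N e).
exists (c + `|M|); first by rewrite addr_ge0.
move=> n rho r0 h; apply: stay_split => p k kn.
  rewrite (le_trans (hM p k kn)) // -[leLHS]ger0_norm ?exprn_even_ge0 // normrX.
  by rewrite lerXn2r ?nnegrE ?addr_ge0 // addrA lerDr addr_ge0.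
rewrite hpt_shift // (le_trans (hc _ _ _ _ r0 (h p k kn))) //.
by rewrite lerXn2r ?nnegrE ?addr_ge0 // addrA lerDl.
Qed.

Lemma stay_concat N n rho e : area_cvg e -> 0 <= rho ->
  stay N rho e -> stay n rho (path_shift N e) -> stay (N + n) (3 * rho) e.
Proof.
move=> cv r0 h1 h2; apply: stay_split => p k kn.
  rewrite (le_trans (h1 p k kn)) // lerXn2r ?nnegrE ?mulr_ge0 //; lra.
rewrite hpt_shift //; apply: h4_quasi_triangle => //; last exact: h2.
by rewrite -(dy_int N); exact: (h1 0%N N (leq_pmulr _ _)).
Qed.

Variable mu : probability (pathSpace R) R.
Hypothesis fdd : brownian_fdd mu.

Lemma stay_scaling q n rho : mu (stay (4 ^ q * n) (2 ^+ q * rho)) = mu (stay n rho).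
Proof.
elim: q => [|q IH]; first by rewrite mul1n mul1r.
rewrite -IH -(scale4_preserves fdd (measurable_stay (4 ^ q * n) _)).
apply: ae_eq_measure; first exact: measurable_stay.
  exact: measurable_preimage measurable_scale4 (measurable_stay _ _).
apply: ae_mono (ae_area_cvg fdd) => e cv.
by rewrite expnS exprS -mulnA -mulrA; have [h1 h2] := stay_scale4 (4 ^ q * n) (2 ^+ q * rho) cv; split.
Qed.

End stay.

(** * Small balls and tail events *)

Definition sg {R : realType} (b : bool) : R := if b then 1 else -1.

Section loop_geometry.
Context {R : realType}.
Implicit Types x y s t : R.

Lemma close_prod x y x' y' t : `|x'| <= 1 -> `|y'| <= 1 ->
  `|x - x'| <= t -> `|y - y'| <= t -> `|x * y - x' * y'| <= 2 * t + t ^+ 2.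
Proof.
move=> hx hy hxt hyt.
have t0 : 0 <= t := le_trans (normr_ge0 _) hxt.
have -> : x * y - x' * y' = (x - x') * (y - y') + (x - x') * y' + x' * (y - y') by ring.
rewrite (le_trans (ler_normD _ _)) // (_ : 2 * t + _ = t * t + t * 1 + 1 * t); last by ring.
rewrite lerD //; last by rewrite normrM ler_pM.
by rewrite (le_trans (ler_normD _ _)) // lerD // normrM ler_pM.
Qed.

Lemma close_prod50 x y x' y' : `|x'| <= 1 -> `|y'| <= 1 ->
  `|x - x'| <= 50^-1 -> `|y - y'| <= 50^-1 -> x' * y' - 20^-1 <= x * y <= x' * y' + 20^-1.
Proof.
move=> h1 h2 h3 h4; have := close_prod h1 h2 h3 h4.
by rewrite ler_norml => /andP[? ?]; apply/andP; split; lra.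
Qed.

(** The displacements are close to the sides of the unit square, run through in the direction given
    by [b]. The sum is twice the polygonal area, exactly 2 for the square, and each of the twelve
    products errs by at most 1/20. *)
Lemma loop_area b x1 y1 x2 y2 x3 y3 x4 y4 :
  `|x1 - 1| <= 50^-1 -> `|y1 - 0| <= 50^-1 ->
  `|x2 - 0| <= 50^-1 -> `|y2 - sg b| <= 50^-1 ->
  `|x3 - (-1)| <= 50^-1 -> `|y3 - 0| <= 50^-1 ->
  `|x4 - 0| <= 50^-1 -> `|y4 - - sg b| <= 50^-1 ->
  1 <= sg b * ((x1 * y2 - y1 * x2) + ((x1 + x2) * y3 - (y1 + y2) * x3)
     + ((x1 + x2 + x3) * y4 - (y1 + y2 + y3) * x4)).
Proof.
have n0 : `|0 : R| <= 1 by rewrite normr0.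
have n1 : `|1 : R| <= 1 by rewrite normr1.
have n2 : `|-1 : R| <= 1 by rewrite normrN normr1.
have : (sg b = 1 :> R) \/ (sg b = -1 :> R) by rewrite /sg; case: b; [left|right].
move: (sg b) => c hc.
have n3 : `|c| <= 1 by case: hc => ->; [exact: n1|exact: n2].
have n4 : `|- c| <= 1 by rewrite normrN.
move=> a1 b1 a2 b2 a3 b3 a4 b4.
have /andP[? ?] := close_prod50 n1 n3 a1 b2.
have /andP[? ?] := close_prod50 n0 n0 b1 a2.
have /andP[? ?] := close_prod50 n1 n0 a1 b3.
have /andP[? ?] := close_prod50 n0 n2 b1 a3.
have /andP[? ?] := close_prod50 n0 n0 a2 b3.
have /andP[? ?] := close_prod50 n3 n2 b2 a3.
have /andP[? ?] := close_prod50 n1 n4 a1 b4.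
have /andP[? ?] := close_prod50 n0 n0 b1 a4.
have /andP[? ?] := close_prod50 n0 n4 a2 b4.
have /andP[? ?] := close_prod50 n3 n0 b2 a4.
have /andP[? ?] := close_prod50 n2 n4 a3 b4.
have /andP[? ?] := close_prod50 n0 n0 b3 a4.
by case: hc => ?; subst c; lra.
Qed.

End loop_geometry.

(** * Loops of prescribed orientation *)

Section positivity.
Context {R : realType}.
Implicit Types (e : 'I_2 -> R -> R).

Lemma measurable_set_le (f g : pathSpace R -> R) :
  measurable_fun setT f -> measurable_fun setT g -> measurable [set e | f e <= g e].
Proof. by move=> mf mg; rewrite -[X in measurable X]setTI; exact: measurable_fun_le. Qed.

Lemma measurable_co_nat j n : measurable_fun setT (fun e : pathSpace R => co e j n%:R).
Proof. by rewrite -(dy_int n); exact: measurable_co. Qed.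

Definition other (i : 'I_2) : 'I_2 := if i == ord0 then ord_max else ord0.

(** A quarter of a loop, run in unit time along one side of the square. Of its own area only the
    sign is prescribed. *)
Definition piece (i : 'I_2) (a b eta : R) (s : bool) : set ('I_2 -> R -> R) :=
  [set e | [/\ a <= co e i 1%:R, co e i 1%:R <= b,
     `|co e (other i) 1%:R| <= eta & 0 <= sg s * area 0 1 e]].

Lemma measurable_piece i a b eta s : measurable (piece i a b eta s : set (pathSpace R)).
Proof.
have mc j := @measurable_co_nat j 1.
have ma := @measurable_area R 0 1.
rewrite (_ : piece i a b eta s = [set e : pathSpace R | a <= co e i 1%:R] `&`
   [set e : pathSpace R | co e i 1%:R <= b] `&` [set e : pathSpace R | `|co e (other i) 1%:R| <= eta] `&`
   [set e : pathSpace R | 0 <= sg s * area 0 1 e]); last first.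
  by apply/seteqP; split => e /=; [move=> [? ? ? ?]|move=> [[[? ?] ?] ?]].
apply: measurableI; last by apply: measurable_set_le => //; exact: measurable_funM.
apply: measurableI; last by apply: measurable_set_le => //; exact: measurableT_comp.
by apply: measurableI; apply: measurable_set_le.
Qed.

Lemma piece_stop i a b eta s : path_stop 1 @^-1` piece i a b eta s = piece i a b eta s.
Proof.
have c1 e j : co (path_stop 1 e) j 1%:R = co e j 1%:R by rewrite co_stop_le.
have a1 e : area 0 1 (path_stop 1 e) = area 0 1 e by rewrite area_stop.
by apply/seteqP; split => e /=; rewrite /piece /= !c1 a1.
Qed.

Variable mu : probability (pathSpace R) R.
Hypothesis fdd : brownian_fdd mu.

(** Reflecting the other coordinate exchanges the two signs of the area and keeps the remaining
    constraints, so both pieces have equal probability. Together they cover an event of positive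
    Gaussian probability. *)
Lemma piece_gt0 i a b eta s : a < b -> 0 < eta -> (0 < mu (piece i a b eta s))%E.
Proof.
move=> ab eta0.
have flipE : mu (piece i a b eta true) = mu (piece i a b eta false).
  rewrite -(flip_preserves fdd (other i) (measurable_piece i a b eta false)).
  apply: ae_eq_measure; first exact: measurable_piece.
    exact: measurable_preimage (measurable_flip _) (measurable_piece _ _ _ _ _).
  have oi : (i == other i) = false.
    by rewrite /other; case: ifP => [/eqP -> //|->].
  apply: ae_mono (ae_area_cvg fdd) => e cv.
  rewrite /piece /= !co_flip oi eqxx normrN area_flip // /sg.
  by split => -[? ? ? ?]; split => //; lra.
pose B (k : nat) j : set R := if j == i then `[a, b]%classic else `[- eta, eta]%classic.
have mB k j : measurable (B k j) by rewrite /B; case: ifP => _; exact: measurable_itv.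
have base : (0 < mu [set e | forall k j, (k < 1)%N -> B k j (incr 0 k j e)])%E.
  rewrite (fdd_grid fdd 0 1 mB) big_ord_recl big_ord0 mule1.
  have s0 : 0 < Num.sqrt (dy 0 1) :> R by rewrite sqrtr_gt0 dy1_gt0.
  have pos j : (0 < normal_prob 0 (Num.sqrt (dy 0 1)) (B 0%N j))%E.
    by rewrite /B; case: ifP => _; apply: normal_prob_itv_gt0 => //; lra.
  by rewrite big_ord_recl big_ord_recl big_ord0 mule1 mule_gt0.
have sub : [set e : pathSpace R | forall k j, (k < 1)%N -> B k j (incr 0 k j e)] `<=`
   piece i a b eta true `|` piece i a b eta false.
  move=> e /= h.
  have iE j : incr 0 0 j e = co e j 1%:R by rewrite /incr dy0 co0 subr0 dy_int.
  have := h 0%N i isT; rewrite /B eqxx iE /= in_itv /= => /andP[h1 h2].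
  have oi : (other i == i) = false.
    by rewrite /other; case: ifP => [/eqP -> //|/negbT]; rewrite eq_sym => /negbTE.
  have := h 0%N (other i) isT; rewrite /B oi iE /= in_itv /= -ler_norml => h3.
  case: (lerP 0 (area 0 1 e)) => ha; [left|right]; split => //; rewrite /sg ?mul1r //.
  by rewrite mulN1r oppr_ge0 ltW.
suff : (0 < mu (piece i a b eta true))%E by case: s => //; rewrite -flipE.
rewrite lt_neqAle measure_ge0 andbT; apply/eqP => h0.
have : (mu [set e | forall k j, (k < 1)%N -> B k j (incr 0 k j e)] <= 0)%E.
  have mp := @measurable_piece i a b eta.
  apply: (@le_trans _ _ (mu (piece i a b eta true `|` piece i a b eta false))).
    apply: le_measure => //; rewrite inE.
    - rewrite (_ : [set e | _] = \bigcap_(j in setT) (setT `&` (incr 0 0 j : pathSpace R -> R) @^-1` B 0%N j)).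
        apply: fin_bigcap_measurable => // j _; exact: measurable_incr.
      apply/seteqP; split => e /=; first by move=> h j _; split => //; exact: h.
      by move=> h [|k] j // _; have [] := h j Logic.I.
    - exact: measurableU.
  have : (mu (piece i a b eta true) + mu (piece i a b eta false) <= 0)%E.
    by rewrite -flipE -h0 adde0.
  exact: le_trans (measureU2 _ (mp true) (mp false)).
by move=> /(lt_le_trans base); rewrite ltxx.
Qed.

Lemma piece_indep i a b eta s (V : set (pathSpace R)) : measurable V ->
  mu (piece i a b eta s `&` path_shift 1 @^-1` V) = (mu (piece i a b eta s) * mu V)%E.
Proof.
move=> mV; rewrite -[in LHS](piece_stop i a b eta s).
by rewrite (past_future_indep fdd 1 (measurable_piece _ _ _ _ _) mV) piece_stop.
Qed.

(* [kap] bounds the horizontal position after each loop. *)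
Definition kap : R := 3 / 50.

Definition loop_end (s sx sy : bool) : set ('I_2 -> R -> R) :=
  [set e | [/\ 0 <= sg sx * co e ord0 4%:R, sg sx * co e ord0 4%:R <= kap,
     0 <= sg sy * co e ord_max 4%:R, sg sy * co e ord_max 4%:R <= kap &
     2^-1 <= sg s * area 0 4 e]].

Lemma measurable_loop_end s sx sy : measurable (loop_end s sx sy : set (pathSpace R)).
Proof.
have mc j := @measurable_co_nat j 4.
have ma := @measurable_area R 0 4.
have ms b j : measurable_fun setT (fun e : pathSpace R => sg b * co e j 4%:R).
  exact: measurable_funM.
rewrite (_ : loop_end s sx sy = [set e : pathSpace R | 0 <= sg sx * co e ord0 4%:R] `&`
   [set e : pathSpace R | sg sx * co e ord0 4%:R <= kap] `&`
   [set e : pathSpace R | 0 <= sg sy * co e ord_max 4%:R] `&`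
   [set e : pathSpace R | sg sy * co e ord_max 4%:R <= kap] `&`
   [set e : pathSpace R | 2^-1 <= sg s * area 0 4 e]); last first.
  by apply/seteqP; split => e /=; [move=> [? ? ? ? ?]|move=> [[[[? ?] ?] ?] ?]].
apply: measurableI; last by apply: measurable_set_le => //; exact: measurable_funM.
by do 3 (apply: measurableI; last by apply: measurable_set_le); apply: measurable_set_le.
Qed.

(* Half-open windows for the four sides of the unit square, displaced in the
   direction [sx], [sy] so that the loop drifts back towards the origin. *)
Definition win_lo (c : R) (b : bool) : R := if b then c + 100^-1 else c - 50^-1.
Definition win_hi (c : R) (b : bool) : R := if b then c + 50^-1 else c - 100^-1.

Lemma win_lt c b : win_lo c b < win_hi c b.
Proof. by rewrite /win_lo /win_hi; case: b; lra. Qed.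

Lemma win_close (c x : R) b : win_lo c b <= x -> x <= win_hi c b -> `|x - c| <= 50^-1.
Proof. by rewrite /win_lo /win_hi ler_norml; case: b => ? ?; apply/andP; split; lra. Qed.

Lemma win_small (x : R) : `|x| <= 100^-1 -> `|x - 0| <= 50^-1.
Proof. by rewrite subr0; lra. Qed.

(** Opposite sides add up to between 2/100 and 4/100 in the direction [b], and the two other sides
    change this by at most 2/100; hence the bound 6/100, which is [kap]. *)
Lemma win_sum (c x y u v : R) b :
  win_lo c b <= x -> x <= win_hi c b -> win_lo (- c) b <= y -> y <= win_hi (- c) b ->
  `|u| <= 100^-1 -> `|v| <= 100^-1 -> 0 <= sg b * (x + y + u + v) <= kap.
Proof.
rewrite /win_lo /win_hi /sg /kap !ler_norml => + + + + /andP[? ?] /andP[? ?].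
by case: b => ? ? ? ?; apply/andP; split; lra.
Qed.

Lemma loop_area_sum (c Q a b x y : R) : 1 <= c * Q -> 0 <= c * a -> 0 <= c * b ->
  0 <= c * x -> 0 <= c * y -> 2^-1 <= c * (2^-1 * Q + (a + b + x + y)).
Proof.
move=> *; rewrite (_ : c * _ = 2^-1 * (c * Q) + (c * a + c * b + c * x + c * y)); last by ring.
lra.
Qed.

(** Four successive pieces, independent by the Markov property. Chen's relation writes the area at
    time 4 as half the polygon sum, at least 1/2 in the direction [s], plus four areas of the same
    sign. *)
Lemma loop_gt0 s sx sy : (0 < mu (loop_end s sx sy))%E.
Proof.
have p100 : 0 < 100^-1 :> R by lra.
pose H1 := piece ord0 (win_lo 1 sx) (win_hi 1 sx) 100^-1 s.
pose H2 := piece ord_max (win_lo (sg s) sy) (win_hi (sg s) sy) 100^-1 s.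
pose H3 := piece ord0 (win_lo (-1) sx) (win_hi (-1) sx) 100^-1 s.
pose H4 := piece ord_max (win_lo (- sg s) sy) (win_hi (- sg s) sy) 100^-1 s.
have mp i a b eta : measurable (piece i a b eta s : set (pathSpace R)) by exact: measurable_piece.
have msh (V : set (pathSpace R)) : measurable V -> measurable (path_shift 1 @^-1` V : set (pathSpace R)).
  by move=> mV; exact: measurable_preimage (measurable_shift 1) mV.
pose Z3 : set (pathSpace R) := H3 `&` path_shift 1 @^-1` H4.
pose Z2 : set (pathSpace R) := H2 `&` path_shift 1 @^-1` Z3.
pose Z1 : set (pathSpace R) := H1 `&` path_shift 1 @^-1` Z2.
have mZ3 : measurable Z3 := measurableI _ _ (mp _ _ _ _) (msh _ (mp _ _ _ _)).
have mZ2 : measurable Z2 := measurableI _ _ (mp _ _ _ _) (msh _ mZ3).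
have mZ1 : measurable Z1 := measurableI _ _ (mp _ _ _ _) (msh _ mZ2).
have Z10 : (0 < mu Z1)%E.
  rewrite (piece_indep _ _ _ _ _ mZ2) (piece_indep _ _ _ _ _ mZ3) (piece_indep _ _ _ _ _ (mp _ _ _ _)).
  by do 3 (apply: mule_gt0; first by apply: piece_gt0 => //; exact: win_lt); apply: piece_gt0 => //; exact: win_lt.
apply: (lt_le_trans Z10); apply: ae_le_measure => //; first exact: measurable_loop_end.
apply: ae_mono (ae_area_cvg fdd) => e cv [h1 [h2 [h3 h4]]].
have {}h3 : H3 (path_shift 2 e) by move: h3; rewrite /= shiftD.
have {}h4 : H4 (path_shift 3 e) by move: h4; rewrite /= !shiftD.
pose x1 := co e ord0 1%:R; pose y1 := co e ord_max 1%:R.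
pose x2 := co (path_shift 1 e) ord0 1%:R; pose y2 := co (path_shift 1 e) ord_max 1%:R.
pose x3 := co (path_shift 2 e) ord0 1%:R; pose y3 := co (path_shift 2 e) ord_max 1%:R.
pose x4 := co (path_shift 3 e) ord0 1%:R; pose y4 := co (path_shift 3 e) ord_max 1%:R.
have cS N j : co e j N.+1%:R = co e j N%:R + co (path_shift N e) j 1%:R.
  by rewrite co_shift -natrD addn1; ring.
have aS N : area_cvg e -> area 0 N.+1 e = area 0 N e + 2^-1 * (co e ord0 N%:R * co (path_shift N e) ord_max 1%:R
    - co e ord_max N%:R * co (path_shift N e) ord0 1%:R) + area 0 1 (path_shift N e).
  by move=> _; have := @area_shift R N 0 1 e cv; rewrite expn0 muln1 addn1 dy_int.
have X2 j : co e j 2%:R = co e j 1%:R + co (path_shift 1 e) j 1%:R by rewrite cS.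
have X3 j : co e j 3%:R = co e j 1%:R + co (path_shift 1 e) j 1%:R + co (path_shift 2 e) j 1%:R.
  by rewrite cS X2.
have X4 j : co e j 4%:R = co e j 1%:R + co (path_shift 1 e) j 1%:R + co (path_shift 2 e) j 1%:R
    + co (path_shift 3 e) j 1%:R by rewrite cS X3.
have A4 : area 0 4 e = 2^-1 * ((x1 * y2 - y1 * x2) + ((x1 + x2) * y3 - (y1 + y2) * x3)
     + ((x1 + x2 + x3) * y4 - (y1 + y2 + y3) * x4)) +
     (area 0 1 e + area 0 1 (path_shift 1 e) + area 0 1 (path_shift 2 e) + area 0 1 (path_shift 3 e)).
  rewrite (aS 3) // (aS 2) // (aS 1%N) // !X3 !X2 -/x1 -/x2 -/x3 -/x4 -/y1 -/y2 -/y3 -/y4; ring.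
case: h1 => l1 u1 o1 s1; case: h2 => l2 u2 o2 s2; case: h3 => l3 u3 o3 s3; case: h4 => l4 u4 o4 s4.
rewrite /other /= -/x1 -/y1 in l1 u1 o1; rewrite /other /= -/x2 -/y2 in l2 u2 o2.
rewrite /other /= -/x3 -/y3 in l3 u3 o3; rewrite /other /= -/x4 -/y4 in l4 u4 o4.
have LA := @loop_area R s x1 y1 x2 y2 x3 y3 x4 y4 (win_close l1 u1) (win_small o1)
  (win_small o2) (win_close l2 u2) (win_close l3 u3) (win_small o3) (win_small o4) (win_close l4 u4).
have [] := (andP (win_sum l1 u1 l3 u3 o2 o4), andP (win_sum l2 u2 l4 u4 o1 o3)).
rewrite (_ : x1 + x3 + x2 + x4 = co e ord0 4%:R); last by rewrite X4 -/x1 -/x2 -/x3 -/x4; ring.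
rewrite (_ : y2 + y4 + y1 + y3 = co e ord_max 4%:R); last by rewrite X4 -/y1 -/y2 -/y3 -/y4; ring.
move=> [? ?] [? ?]; split => //.
by rewrite A4; exact: loop_area_sum.
Qed.

End positivity.

(** * Confinement by chained loops *)

Section chain.
Context {R : realType}.
Implicit Types (e : 'I_2 -> R -> R).

Lemma measure0_ae_not d (T : measurableType d) (P : {measure set T -> \bar R}) (A : set T) :
  measurable A -> P A = 0%E -> {ae P, forall w, ~ A w}.
Proof. by move=> mA A0; exists A; split => // w /= /contrapT. Qed.

Definition half_space (b : bool) (A : set (pathSpace R)) := if b then A else ~` A.

Lemma measurable_half_space b A : measurable A -> measurable (half_space b A).
Proof. by move=> mA; case: b => //; exact: measurableC. Qed.

Lemma le_measure_split d (T : measurableType d) (P : probability T R) (A D B : set T) (c : R) :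
  measurable A -> measurable D -> measurable B -> 0 <= c ->
  (c%:E * P (A `&` B) <= P (D `&` B))%E -> (c%:E * P (A `&` ~` B) <= P (D `&` ~` B))%E ->
  (c%:E * P A <= P D)%E.
Proof.
move=> mA mD mB c0 h1 h2.
rewrite [P A](measureDI P mA mB) [P D](measureDI P mD mB) !setDE.
by rewrite ge0_muleDr //; exact: leeD.
Qed.

Lemma sg_norm_le (c : bool) (u : R) : 0 <= sg c * u -> sg c * u <= kap -> `|u| <= kap.
Proof. by rewrite /sg ler_norml /kap; case: c => ? ?; apply/andP; split; lra. Qed.

(** The displacement is directed against the current position and neither exceeds [kap], so their
    sum does not either. *)
Lemma drift_back (x X : R) b : `|x| <= kap -> (b = (0 <= x)) ->
  0 <= sg (~~ b) * X -> sg (~~ b) * X <= kap -> `|x + X| <= kap.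
Proof.
rewrite !ler_norml /kap => /andP[h1 h2] bE; case: b bE => /= /esym; rewrite /sg.
  by move=> hx h3 h4; apply/andP; split; lra.
by move=> /negbT; rewrite -ltNge => hx h3 h4; apply/andP; split; lra.
Qed.

(** Here [w] is the cross term of the group law and [m] bounds the area of a loop. On the side of
    [z] the 1/2 gained by the loop pays for [w]; on the opposite side the margin 1 does. *)
Lemma drift_back_area (z Z w m : R) b : `|z| <= m + 1 -> `|w| <= 2^-1 -> `|Z| <= m ->
  (b = (0 <= z)) -> 2^-1 <= sg (~~ b) * Z -> `|z + w + Z| <= m + 1.
Proof.
rewrite !ler_norml => /andP[h1 h2] /andP[h3 h4] /andP[h5 h6] bE.
case: b bE => /= /esym; rewrite /sg.
  by move=> hz h7; apply/andP; split; lra.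
by move=> /negbT; rewrite -ltNge => hz h7; apply/andP; split; lra.
Qed.

Variable M : nat.

(* Each loop of duration 4 ends on the opposite side of the current position and
   area, so the confinement persists at a constant price per loop. *)
Definition home (n : nat) : set ('I_2 -> R -> R) :=
  [set e | [/\ stay (4 * n) (3 * (M%:R + 2)) e, `|co e ord0 (4 * n)%:R| <= kap,
    `|co e ord_max (4 * n)%:R| <= kap & `|area 0 (4 * n) e| <= M%:R ^+ 2 + 1]].

Lemma measurable_home n : measurable (home n : set (pathSpace R)).
Proof.
have mc j : measurable_fun setT (fun e : pathSpace R => `|co e j (4 * n)%:R|).
  by apply: measurableT_comp => //; exact: measurable_co_nat.
have ma : measurable_fun setT (fun e : pathSpace R => `|area 0 (4 * n) e|).
  by apply: measurableT_comp => //; exact: measurable_area.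
rewrite (_ : home n = stay (4 * n) (3 * (M%:R + 2)) `&`
   [set e : pathSpace R | `|co e ord0 (4 * n)%:R| <= kap] `&`
   [set e : pathSpace R | `|co e ord_max (4 * n)%:R| <= kap] `&`
   [set e : pathSpace R | `|area 0 (4 * n) e| <= M%:R ^+ 2 + 1]); last first.
  by apply/seteqP; split => e /=; [move=> [? ? ? ?]|move=> [[[? ?] ?] ?]].
apply: measurableI; last exact: measurable_set_le.
apply: measurableI; last exact: measurable_set_le.
apply: measurableI; last exact: measurable_set_le.
exact: measurable_stay.
Qed.

Lemma home_step n e b bx by_ : area_cvg e -> home n e ->
  b = (0 <= area 0 (4 * n) e) -> bx = (0 <= co e ord0 (4 * n)%:R) ->
  by_ = (0 <= co e ord_max (4 * n)%:R) ->
  loop_end (~~ b) (~~ bx) (~~ by_) (path_shift (4 * n) e) ->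
  stay 4 M%:R (path_shift (4 * n) e) -> home n.+1 e.
Proof.
set N := (4 * n)%N => cv [hs hx hy hz] bE bxE byE [lx1 lx2 ly1 ly2 la] st.
have NE : (4 * n.+1 = N + 4)%N by rewrite /N mulnS addnC.
rewrite /home /= NE.
have cE j : co e j (N + 4)%:R = co e j N%:R + co (path_shift N e) j 4%:R.
  by rewrite co_shift -natrD; ring.
have aE := @area_shift R N 0 4 e cv; rewrite expn0 muln1 dy_int in aE.
have M0 : 0 <= M%:R :> R by exact: ler0n.
have [_ _ _ hA] := h4_bounds M0 (st 0%N 4%N (leqnn _)).
have X := drift_back hx bxE lx1 lx2; have Y := drift_back hy byE ly1 ly2.
have k2 u v : `|u| <= kap -> `|v| <= kap -> `|u * v| <= 2^-1 :> R.
  move=> hu hv; rewrite normrM (@le_trans _ _ (kap * kap)) ?ler_pM //.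
  by rewrite /kap; lra.
split.
- apply: stay_split => [p k kN|p k k4]; first exact: hs.
  (* The loop starts at gauge at most [M + 2] and stays within [M] of its start; the quasi-triangle
     inequality turns this into the radius [3 * (M + 2)]. *)
  rewrite hpt_shift //; apply: h4_quasi_triangle; first lra.
    move: hx hy hz; set x := co e _ _; set y := co e _ _; set z := area _ _ _ => hx hy hz.
    have x2 : x ^+ 2 <= 2^-1 by rewrite expr2; have := k2 _ _ hx hx; rewrite ler_norml => /andP[].
    have y2 : y ^+ 2 <= 2^-1 by rewrite expr2; have := k2 _ _ hy hy; rewrite ler_norml => /andP[].
    have M20 : 0 <= M%:R ^+ 2 :> R by exact: sqr_ge0.
    have z2 : z ^+ 2 <= (M%:R ^+ 2 + 1) ^+ 2.
      by rewrite -(real_normK (num_real z)) ler_sqr ?nnegrE //; lra.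
    have xy : (x ^+ 2 + y ^+ 2) ^+ 2 <= 1.
      have ? := sqr_ge0 x; have ? := sqr_ge0 y.
      by rewrite exprn_ile1 //; lra.
    rewrite /h4 (@le_trans _ _ (1 + (M%:R ^+ 2 + 1) ^+ 2)) ?lerD //.
    have e1 := exprn_ge0 3 M0.
    rewrite -subr_ge0 (_ : _ - _ = 8 * M%:R ^+ 3 + 22 * M%:R ^+ 2 + 32 * M%:R + 14 :> R); last by ring.
    lra.
  rewrite (le_trans (st p k k4)) // lerXn2r ?nnegrE //; lra.
- by rewrite cE.
- by rewrite cE.
- rewrite aE; apply: (drift_back_area hz _ hA bE la).
  have a1 := k2 _ _ hx (sg_norm_le ly1 ly2); have a2 := k2 _ _ hy (sg_norm_le lx1 lx2).
  move: a1 a2; rewrite !ler_norml => /andP[? ?] /andP[? ?].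
  by apply/andP; split; lra.
Qed.

Lemma home0 e : home 0 e.
Proof.
have a0 p : area p 0 e = 0.
  have h : (levy_fine (p + q) (0 * 2 ^ q) e)%:E @[q --> \oo] --> (0%:E : \bar R).
    rewrite (_ : (fun q => _) = (fun=> 0%:E)); first exact: cvg_cst.
    by apply/funext => q; rewrite mul0n levy_fine0.
  by rewrite /area; have [_ ->] := cvg_limn_einf_sup h.
split.
- move=> p k; rewrite muln0 mul0n leqn0 => /eqP ->.
  rewrite /hpt dy0 !co0 a0 (_ : h4 0 0 0 = 0); first by rewrite exprn_even_ge0.
  by rewrite /h4; ring.
- by rewrite muln0 co0 normr0 /kap; lra.
- by rewrite muln0 co0 normr0 /kap; lra.
- by rewrite muln0 a0 normr0 addr_ge0 ?sqr_ge0.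
Qed.

Lemma home_stop n e : home n (path_stop (4 * n) e) <-> home n e.
Proof.
have c j : co (path_stop (4 * n) e) j (4 * n)%:R = co e j (4 * n)%:R by rewrite co_stop_le.
have a : area 0 (4 * n) (path_stop (4 * n) e) = area 0 (4 * n) e by rewrite area_stop // expn0 muln1.
have [h1 h2] := @stay_stop R (4 * n) (4 * n) (3 * (M%:R + 2)) e (leqnn _).
by rewrite /home /= !c a; split => -[? ? ? ?]; split => //; [exact: h1|exact: h2].
Qed.

Variable mu : probability (pathSpace R) R.
Hypothesis fdd : brownian_fdd mu.

(** The signs of the area and of the two coordinates at time $4n$ cut [home n] into eight cells. On
    each cell one fixed loop leads back and is independent of the past, so at least the fraction
    [delta] of the cell survives. *)
Lemma home_prob (delta : R) n : 0 <= delta ->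
  (forall s sx sy, (delta%:E <= mu (loop_end s sx sy `&` stay 4 M%:R))%E) ->
  ((delta ^+ n)%:E <= mu (home n))%E.
Proof.
move=> d0 hd; elim: n => [|n IH].
  rewrite expr0 (_ : home 0 = setT) ?probability_setT //.
  by apply/seteqP; split => // e _; exact: home0.
rewrite exprS EFinM; apply: (@le_trans _ _ (delta%:E * mu (home n))%E).
  by apply: lee_wpmul2l => //; rewrite lee_fin.
set N := (4 * n)%N.
pose Az : set (pathSpace R) := [set e | 0 <= area 0 N e].
pose Ac j : set (pathSpace R) := [set e | 0 <= co e j N%:R].
have mAz : measurable Az by apply: measurable_set_le => //; exact: measurable_area.
have mAc j : measurable (Ac j) by apply: measurable_set_le => //; exact: measurable_co_nat.
have mh k := @measurable_home k.
have cell b bx by_ : (delta%:E * mu (home n `&` half_space b Az `&` half_space bx (Ac ord0) `&` half_space by_ (Ac ord_max))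
    <= mu (home n.+1 `&` half_space b Az `&` half_space bx (Ac ord0) `&` half_space by_ (Ac ord_max)))%E.
  set Q := (home n `&` _ `&` _ `&` _); set Q' := (home n.+1 `&` _ `&` _ `&` _).
  have mQ : measurable (Q : set (pathSpace R)) by do 3 (apply: measurableI; last exact: measurable_half_space).
  have mQ' : measurable (Q' : set (pathSpace R)) by do 3 (apply: measurableI; last exact: measurable_half_space).
  pose U : set (pathSpace R) := loop_end (~~ b) (~~ bx) (~~ by_) `&` stay 4 M%:R.
  have mU : measurable U by apply: measurableI; [exact: measurable_loop_end|exact: measurable_stay].
  have QE : path_stop N @^-1` Q = Q.
    have c j e : co (path_stop N e) j N%:R = co e j N%:R by rewrite co_stop_le.
    have a e : area 0 N (path_stop N e) = area 0 N e by rewrite area_stop // expn0 muln1.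
    have zE e : half_space b Az (path_stop N e) = half_space b Az e.
      by rewrite /half_space /Az; case: (b); rewrite /= ?a // /setC /= a.
    have cE j b' e : half_space b' (Ac j) (path_stop N e) = half_space b' (Ac j) e.
      by rewrite /half_space /Ac; case: (b'); rewrite /= ?c // /setC /= c.
    apply/seteqP; split => e [[[h hz] hx] hy].
      have {}h := (home_stop n e).1 h; by rewrite zE in hz; rewrite !cE in hx hy; split; [split; [split|]|].
    by split; [split; [split; [exact: ((home_stop n e).2 h)|rewrite zE]|rewrite cE]|rewrite cE].
  apply: (@le_trans _ _ (mu (Q `&` path_shift N @^-1` U))).
    have := past_future_indep fdd N mQ mU; rewrite QE => ->.
    by rewrite muleC; apply: lee_wpmul2l; [exact: measure_ge0|exact: hd].
  apply: ae_le_measure => //.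
    by apply: measurableI => //; exact: measurable_preimage (measurable_shift N) mU.
  apply: ae_mono (ae_area_cvg fdd) => e cv [[[[h hz] hx] hy] [hl hst]].
  split; [split; [split => //|]|] => //.
  have bE : b = (0 <= area 0 N e).
    by move: hz; rewrite /half_space /Az; case: (b) => /= [->//|/negP/negbTE ->].
  have bxE : bx = (0 <= co e ord0 N%:R).
    by move: hx; rewrite /half_space /Ac; case: (bx) => /= [->//|/negP/negbTE ->].
  have byE : by_ = (0 <= co e ord_max N%:R).
    by move: hy; rewrite /half_space /Ac; case: (by_) => /= [->//|/negP/negbTE ->].
  exact: (home_step cv h bE bxE byE hl hst).
have m1 k b : measurable (home k `&` half_space b Az : set (pathSpace R)).
  by apply: measurableI => //; exact: measurable_half_space.
have m2 k b b' : measurable (home k `&` half_space b Az `&` half_space b' (Ac ord0) : set (pathSpace R)).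
  by apply: measurableI => //; exact: measurable_half_space.
have c2 b b' : (delta%:E * mu (home n `&` half_space b Az `&` half_space b' (Ac ord0))
    <= mu (home n.+1 `&` half_space b Az `&` half_space b' (Ac ord0)))%E.
  exact: (le_measure_split (m2 _ _ _) (m2 _ _ _) (mAc ord_max) d0 (cell b b' true) (cell b b' false)).
have c1 b : (delta%:E * mu (home n `&` half_space b Az) <= mu (home n.+1 `&` half_space b Az))%E.
  exact: (le_measure_split (m1 _ _) (m1 _ _) (mAc ord0) d0 (c2 b true) (c2 b false)).
exact: (le_measure_split (mh _) (mh _) mAz d0 (c1 true) (c1 false)).
Qed.

End chain.

(** * Lower small-ball estimate *)

Section small_ball_lower.
Context {R : realType} (mu : probability (pathSpace R) R).
Hypothesis fdd : brownian_fdd mu.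
Hypothesis bounded : {ae mu, forall e, forall n, exists M : R, stay n M e}.

Lemma stay_nat n M (e : 'I_2 -> R -> R) : stay n M e -> exists K : nat, stay n K%:R e.
Proof.
move=> h; exists (Num.truncn `|M|).+1 => p k kn; rewrite (le_trans (h p k kn)) //.
rewrite -[leLHS]ger0_norm ?exprn_even_ge0 // normrX lerXn2r ?nnegrE //.
by rewrite ltW // truncnS_gt.
Qed.

(** Almost every path is bounded up to time 4, so up to a null set the loop event is the union of
    these events over [M]. *)
Lemma loop_stay_gt0 s sx sy :
  exists M : nat, (0 < mu (loop_end s sx sy `&` stay 4 M%:R))%E.
Proof.
apply: contrapT => /forallNP h.
have := loop_gt0 fdd s sx sy; apply/negP; rewrite -leNgt -(measure0 mu).
have mI M : measurable (loop_end s sx sy `&` stay 4 M%:R : set (pathSpace R)).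
  by apply: measurableI; [exact: measurable_loop_end|exact: measurable_stay].
apply: ae_le_measure => //; first exact: measurable_loop_end.
have h0 : {ae mu, forall e, forall M : nat, ~ (loop_end s sx sy `&` stay 4 M%:R) e}.
  apply: ae_foralln => M; apply: measure0_ae_not => //.
  by apply/eqP; rewrite -measure_le0 leNgt; apply/negP; exact: h.
apply: ae_mono2 h0 bounded => e hn hb hl.
have [M hM] := hb 4%N; have [K hK] := stay_nat hM.
exact: (hn K).
Qed.

Theorem small_ball_lower : exists2 C : R, 0 < C & exists2 delta : R, 0 < delta &
  forall n, ((delta ^+ n)%:E <= mu (stay (4 * n) C))%E.
Proof.
pose I := (bool * bool * bool)%type.
have /choice[K hK] : forall c : I, exists M : nat,
    (0 < mu (loop_end c.1.1 c.1.2 c.2 `&` stay 4 M%:R))%E.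
  by move=> [[s sx] sy]; exact: loop_stay_gt0.
have mI c M : measurable (loop_end c.1.1 c.1.2 c.2 `&` stay 4 M%:R : set (pathSpace R)).
  by apply: measurableI; [exact: measurable_loop_end|exact: measurable_stay].
(* Common bounds for the eight loops: the sum dominates each radius [K c], and the product of the
   probabilities is below each [p c]. *)
pose M := (\sum_(c : I) K c)%N.
pose p (c : I) := fine (mu (loop_end c.1.1 c.1.2 c.2 `&` stay 4 (K c)%:R)).
have pE c : (p c)%:E = mu (loop_end c.1.1 c.1.2 c.2 `&` stay 4 (K c)%:R).
  by rewrite /p probability_fineK.
have p0 c : 0 < p c by rewrite -lte_fin pE.
have p1 c : p c <= 1 by rewrite -lee_fin pE probability_le1.
pose delta := \prod_(c : I) p c.
have d0 : 0 < delta by apply: prodr_gt0.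
exists (3 * (M%:R + 2)); first by rewrite mulr_gt0 // ltr_wpDl.
exists delta => // n.
apply: (@le_trans _ _ (mu (home M n))).
  apply: home_prob => //; first exact: ltW.
  move=> s sx sy; pose c : I := (s, sx, sy).
  apply: (@le_trans _ _ (p c)%:E).
    rewrite lee_fin /delta (bigD1 c) //= ler_piMr //; first exact: ltW.
    by apply: prodr_ile1 => c' _; rewrite (ltW (p0 _)) p1.
  rewrite pE; apply: le_measure; rewrite ?inE //; first exact: (mI c).
  move=> e [h1 h2]; split => //; apply: stay_le h2 => //.
  by rewrite ler_nat /M (bigD1 c) //= leq_addr.
apply: le_measure; rewrite ?inE; [exact: measurable_home|exact: measurable_stay|].
by move=> e [].
Qed.

End small_ball_lower.

(** * Upper small-ball estimate *)

Section small_ball_upper.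
Context {R : realType} (mu : probability (pathSpace R) R).
Hypothesis fdd : brownian_fdd mu.

(** Inside the unit gauge ball the first coordinate has increments of absolute value at most 2 over
    unit times, and these increments are independent. *)
Theorem small_ball_upper : exists2 q : R, 0 <= q < 1 &
  forall m, (mu (stay m 1) <= (q ^+ m)%:E)%E.
Proof.
pose J : set R := `[-2, 2]%classic.
have s0 : 0 < Num.sqrt (dy 0 1) :> R by rewrite sqrtr_gt0 dy1_gt0.
pose N : probability (measurableTypeR R) R := normal_prob 0 (Num.sqrt (dy 0 1)).
have NJ : (N J < 1)%E by exact: normal_prob_lt1.
have NJfin : N J \is a fin_num by apply: fin_num_measure; exact: measurable_itv.
have NT : N setT = 1%E by exact: probability_setT.
exists (fine (N J)).
  by rewrite fine_ge0 //= -lte_fin fineK.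
move=> m.
pose B (k : nat) (j : 'I_2) : set R := if j == ord0 then J else setT.
have mB k j : measurable (B k j).
  by rewrite /B; case: ifP => _; [exact: measurable_itv|exact: measurableT].
apply: (@le_trans _ _ (mu [set e | forall k j, (k < m)%N -> B k j (incr 0 k j e)])).
  apply: le_measure; rewrite ?inE; first exact: measurable_stay.
    rewrite (_ : [set e | _] = \bigcap_(k in [set k | (k < m)%N]) \bigcap_(j in setT)
       (setT `&` (incr 0 k j : pathSpace R -> R) @^-1` B k j)).
      apply: bigcap_measurableType => k _; apply: fin_bigcap_measurable => // j _.
      exact: measurable_incr.
    apply/seteqP; split => e /=; first by move=> h k km j _; split => //; exact: h.
    by move=> h k j km; have [] := h k km j Logic.I.
  move=> e h k j km; rewrite /B; case: ifP => // /eqP ->.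
  have [_ a1 _ _] := h4_bounds ler01 (h 0%N k.+1 (eq_ind_r (fun x => is_true (k < x)%N) km (muln1 m))).
  have [_ a2 _ _] := h4_bounds ler01 (h 0%N k (eq_ind_r (fun x => is_true (k <= x)%N) (ltnW km) (muln1 m))).
  move: a1 a2; rewrite /J /= in_itv /= /incr !ler_norml => /andP[? ?] /andP[? ?].
  by apply/andP; split; lra.
rewrite (fdd_grid fdd 0 m mB).
rewrite (eq_bigr (fun=> N J)); last first.
  move=> k _; rewrite big_ord_recl big_ord_recl big_ord0 mule1 /B /=.
  by rewrite -[X in (_ * X)%E]/(N setT) NT mule1.
rewrite -(fineK NJfin); elim: m => [|m IH]; first by rewrite big_ord0 expr0.
rewrite big_ord_recr /= exprSr EFinM; apply: lee_wpmul2r IH.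
by rewrite lee_fin fine_ge0.
Qed.

End small_ball_upper.

(** * Slow variation of the normalising function *)

Section phi_facts.
Context {R : realType}.
Implicit Types s t : R.

Lemma ln2_ge : 2^-1 <= ln 2 :> R.
Proof.
have h : ln (1 + - 2^-1) <= - 2^-1 :> R by apply: le_ln1Dx; lra.
move: h; rewrite (_ : 1 + - 2^-1 = 2^-1 :> R); last by lra.
by rewrite lnV ?posrE // lerN2.
Qed.

(** The threshold 16 is used throughout: above it $\log t\ge 2$ and $\log\log t\ge 1/2$. *)
Lemma ln_ge2 t : 16 <= t -> 2 <= ln t.
Proof.
move=> ht; apply: (@le_trans _ _ (ln 16)); last by rewrite ler_ln ?posrE //; lra.
rewrite (_ : 16 = 2 ^+ 4 :> R); last by ring.
by rewrite lnXn // -[leRHS]mulr_natr; have := ln2_ge; lra.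
Qed.

Lemma lnln_ge t : 16 <= t -> 2^-1 <= ln (ln t).
Proof.
move=> /ln_ge2 h; apply: (le_trans ln2_ge); rewrite ler_ln ?posrE //; lra.
Qed.

Lemma ln_ler_sub1 t : 0 < t -> ln t <= t - 1.
Proof.
move=> t0; rewrite {1}(_ : t = 1 + (t - 1)); last by ring.
by apply: le_ln1Dx; lra.
Qed.

Lemma phi_sqr t : 16 <= t -> phi t ^+ 2 = ln (ln t) / t.
Proof.
move=> ht; rewrite /phi sqr_sqrtr // divr_ge0 //; last lra.
by have := lnln_ge ht; lra.
Qed.

Lemma phi_gt0 t : 16 <= t -> 0 < phi t.
Proof.
move=> ht; rewrite /phi sqrtr_gt0 divr_gt0 //; last lra.
by have := lnln_ge ht; lra.
Qed.

(** Concavity of the logarithm gives $\log\log t\le\log\log s+(t/s-1)/\log s$, and $1/\log s\le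
    1/2\le\log\log s$. *)
Lemma phi_decr s t : 16 <= s -> s <= t -> phi t <= phi s.
Proof.
move=> hs st.
have ht : 16 <= t by lra.
rewrite -ler_sqr ?nnegrE; do ?exact/ltW/phi_gt0.
rewrite !phi_sqr //.
have s0 : 0 < s by lra. have t0 : 0 < t by lra.
have ls := ln_ge2 hs; have ls0 : 0 < ln s by lra.
have lls := lnln_ge hs.
have u1 : 1 <= t / s by rewrite ler_pdivlMr // mul1r.
have lt : ln t = ln s + ln (t / s).
  by rewrite -lnM ?posrE ?divr_gt0 // mulrCA divff ?mulr1 // gt_eqF.
have h1 : ln (t / s) <= t / s - 1 by apply: ln_ler_sub1; lra.
have h2 : ln (ln t) <= ln (ln s) + (t / s - 1) / ln s.
  have p : 0 < 1 + (t / s - 1) / ln s by rewrite ltr_wpDr // divr_ge0 //; lra.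
  apply: (@le_trans _ _ (ln (ln s * (1 + (t / s - 1) / ln s)))).
    rewrite ler_ln ?posrE ?mulr_gt0 //; last by have := ln_ge2 ht; lra.
    by rewrite mulrDr mulr1 mulrCA divff ?mulr1 ?gt_eqF // lt lerD2l.
  by rewrite lnM ?posrE // lerD2l; apply: le_ln1Dx; lra.
have h3 : (t / s - 1) / ln s <= (t / s - 1) * ln (ln s).
  rewrite ler_wpM2l //; first lra.
  apply: (@le_trans _ _ 2^-1) => //; rewrite lef_pV2 ?posrE //; lra.
rewrite ler_pdivrMr // mulrAC ler_pdivlMr // -ler_pdivlMr //.
apply: (@le_trans _ _ ((t / s) * ln (ln s))); last by rewrite mulrC mulrA.
by apply: (le_trans h2); clear -h3; lra.
Qed.

(** Since $\phi(t)^2t=\log\log t$ increases, [phi] decreases no faster than $t^{-1/2}$. *)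
Lemma phi_compare s t : 16 <= s -> s <= t -> phi s ^+ 2 * s <= phi t ^+ 2 * t.
Proof.
move=> hs st; have ht : 16 <= t by lra.
rewrite !phi_sqr // !divfK ?gt_eqF //; do ?lra.
have ls := ln_ge2 hs; have lt := ln_ge2 ht.
by rewrite !ler_ln ?posrE //; lra.
Qed.

(** From $\log\log t\le 2\sqrt t$ follows $\phi(t)^2\le 2/\sqrt t$. *)
Lemma phi_small (C : R) t : 0 <= C -> 16 <= t -> 4 * C ^+ 4 <= t -> C <= (phi t)^-1.
Proof.
move=> C0 ht hC; have p0 := phi_gt0 ht.
have t0 : 0 < t by lra.
rewrite -[leRHS]mul1r ler_pdivlMr //.
have [->|C_neq0] := eqVneq C 0; first by rewrite mul0r.
have Cp : 0 < C by rewrite lt_neqAle eq_sym C_neq0.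
rewrite -ler_sqr ?nnegrE ?mulr_ge0 ?(ltW p0) // expr1n exprMn phi_sqr //.
pose r := Num.sqrt t.
have r0 : 0 < r by rewrite sqrtr_gt0.
have rE : r ^+ 2 = t by rewrite sqr_sqrtr // ltW.
have h1 : ln (ln t) <= 2 * r.
  have lt := ln_ge2 ht.
  have a1 : ln (ln t) <= ln t - 1 by apply: ln_ler_sub1; lra.
  have a2 : ln t = 2 * ln r by rewrite -rE lnXn // mulr_natl.
  have a3 := ln_ler_sub1 r0; lra.
have h2 : 2 * C ^+ 2 <= r.
  rewrite -ler_sqr ?nnegrE ?mulr_ge0 ?sqr_ge0 ?(ltW r0) // rE.
  by rewrite (_ : (2 * C ^+ 2) ^+ 2 = 4 * C ^+ 4) //; ring.
rewrite mulrA ler_pdivrMr // mul1r.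
apply: (@le_trans _ _ (C ^+ 2 * (2 * r))); first by apply: ler_wpM2l h1; exact: sqr_ge0.
have := ler_wpM2r (ltW r0) h2; rewrite -rE; clear; lra.
Qed.

End phi_facts.

(** * Tail events and the zero-one law *)

Section tail_events.
Context {R : realType}.
Implicit Types (e : 'I_2 -> R -> R) (x y : R).

Definition often y : set ('I_2 -> R -> R) :=
  lim_sup_set (fun n => stay n (y / phi n%:R)).

(** The slack above [x] absorbs both the translation of the gauge and the change of [phi] when an
    initial segment is dropped. *)
Definition often_below x : set ('I_2 -> R -> R) :=
  \bigcap_i often (x + i.+1%:R^-1).

Lemma measurable_often y : measurable (often y : set (pathSpace R)).
Proof.
apply: bigcapT_measurable => n; apply: bigcup_measurable => k _.
exact: measurable_stay.
Qed.

Lemma measurable_often_below x : measurable (often_below x : set (pathSpace R)).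
Proof. by apply: bigcapT_measurable => i; exact: measurable_often. Qed.

Lemma oftenP y e : often y e <-> forall n, exists2 k, (n <= k)%N & stay k (y / phi k%:R) e.
Proof.
split=> [h n|h n _]; first by have [k nk hk] := h n Logic.I; exists k.
by have [k nk hk] := h n; exists k.
Qed.

Lemma often_le y y' e : 0 <= y -> y <= y' -> often y e -> often y' e.
Proof.
move=> y0 yy /oftenP h; apply/oftenP => n.
have [k nk hk] := h (n + 16)%N; exists k; first exact: leq_trans (leq_addr _ _) nk.
have k16 : 16 <= k%:R :> R by rewrite ler_nat; apply: leq_trans nk; exact: leq_addl.
have p0 := phi_gt0 k16.
apply: stay_le hk => //; first by rewrite divr_ge0 // ltW.
by rewrite ler_pM2r ?invr_gt0.
Qed.

Lemma eventually_phi_small (C : R) : 0 <= C -> exists n0 : nat, (16 <= n0)%N /\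
  forall n, (n0 <= n)%N -> C <= (phi n%:R)^-1.
Proof.
move=> C0; exists (16 + (Num.truncn (4 * C ^+ 4)).+1)%N; split; first exact: leq_addr.
move=> n hn; apply: phi_small => //.
  by rewrite ler_nat (leq_trans _ hn) // leq_addr.
rewrite (@le_trans _ _ (Num.truncn (4 * C ^+ 4)).+1%:R) ?(ltW (truncnS_gt _)) //.
by rewrite ler_nat (leq_trans _ hn) // leq_addl.
Qed.

(** The translation costs a constant [c], which is at most the slack $(y'-y)/\phi(k)$ once [k] is
    large; the decrease of [phi] works in the right direction. *)
Lemma often_unshift N e y y' : area_cvg e -> (exists M : R, stay N M e) ->
  0 <= y -> y < y' -> often y (path_shift N e) -> often y' e.
Proof.
move=> cv [M hM] y0 yy /oftenP h; apply/oftenP => n.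
have [c c0 hc] := stay_shift_ge cv hM.
have [n0 [n16 hn0]] := @eventually_phi_small (c / (y' - y)) (divr_ge0 c0 (eq_ind_r is_true (ltW yy) (subr_ge0 _ _))).
have [k nk hk] := h (n + n0)%N.
have k0 : (n0 <= k)%N := leq_trans (leq_addl _ _) nk.
have k16 : 16 <= k%:R :> R by rewrite ler_nat (leq_trans n16).
exists (N + k)%N; first by rewrite (leq_trans _ (leq_addl _ _)) // (leq_trans _ nk) // leq_addr.
have p0 := phi_gt0 k16.
have q0 : 0 <= y / phi k%:R by rewrite divr_ge0 // ltW.
have := hc k _ q0 hk; apply: stay_le => //; first by rewrite addr_ge0.
have Nk : k%:R <= (N + k)%:R :> R by rewrite ler_nat leq_addl.
have Nk16 : 16 <= (N + k)%:R :> R by exact: le_trans Nk.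
apply: (@le_trans _ _ (y' / phi k%:R)); last first.
  rewrite ler_wpM2l //; first by rewrite (le_trans y0) // ltW.
  by rewrite lef_pV2 ?posrE ?phi_gt0 // phi_decr.
have := hn0 k k0; rewrite ler_pdivrMr ?subr_gt0 // => h1.
rewrite (_ : y' / phi k%:R = y / phi k%:R + (phi k%:R)^-1 * (y' - y)); last by ring.
by rewrite lerD2l.
Qed.

(** Dropping the time [N] replaces $\phi(N+k)$ by the larger $\phi(k)$. The slack is halved at [w]:
    from [y] to [w] for this change, from [w] to [y'] for the translation. *)
Lemma often_shift N e y y' : area_cvg e ->
  0 <= y -> y < y' -> often y e -> often y' (path_shift N e).
Proof.
move=> cv y0 yy /oftenP h; apply/oftenP => n.
have [c c0 hc] := stay_shift_le N cv.
pose w := (y + y') / 2.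
have yw : y < w by rewrite /w; lra.
have wy : w < y' by rewrite /w; lra.
have D0 : 0 < w ^+ 2 - y ^+ 2 by rewrite subr_gt0 ltr_sqr ?nnegrE //; lra.
have [n0 [n16 hn0]] := @eventually_phi_small (c / (y' - w)) (divr_ge0 c0 (eq_ind_r is_true (ltW wy) (subr_ge0 _ _))).
(* For [k] beyond [n1], $y^2(N+k)\le w^2k$, whence $y\,\phi(k)\le w\,\phi(N+k)$. *)
pose n1 := (Num.truncn (y ^+ 2 * N%:R / (w ^+ 2 - y ^+ 2))).+1.
have [k' nk' hk'] := h (N + (n + n0 + n1))%N.
have Nk : (N <= k')%N := leq_trans (leq_addr _ _) nk'.
pose k := (k' - N)%N; have k'E : k' = (N + k)%N by rewrite /k subnKC.
have nk : (n + n0 + n1 <= k)%N by rewrite /k leq_subRL.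
exists k; first by rewrite (leq_trans _ nk) // -addnA leq_addr.
have k0 : (n0 <= k)%N by rewrite (leq_trans _ nk) // addnAC leq_addl.
have k1 : (n1 <= k)%N by rewrite (leq_trans _ nk) // leq_addl.
have k16 : 16 <= k%:R :> R by rewrite ler_nat (leq_trans n16).
have kp : 0 < k%:R :> R by lra.
have Nk' : k%:R <= (N + k)%:R :> R by rewrite ler_nat leq_addl.
have Nk16 : 16 <= (N + k)%:R :> R by exact: le_trans Nk'.
have f0 := phi_gt0 k16; have g0 := phi_gt0 Nk16.
rewrite k'E in hk'.
have q0 : 0 <= y / phi (N + k)%:R by rewrite divr_ge0 // ltW.
have := hc k _ q0 hk'; apply: stay_le => //; first by rewrite addr_ge0.
have cmp := phi_compare k16 Nk'.
set f := phi k%:R in f0 cmp *; set g := phi (N + k)%:R in g0 cmp q0 *.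
have kN : y ^+ 2 * N%:R <= (w ^+ 2 - y ^+ 2) * k%:R.
  rewrite [leRHS]mulrC -ler_pdivrMr //.
  by apply: (le_trans (ltW (truncnS_gt _))); rewrite ler_nat.
have yf : y * f <= w * g.
  rewrite -ler_sqr ?nnegrE ?mulr_ge0 ?(ltW f0) ?(ltW g0) //; last by lra.
  rewrite -(ler_pM2r kp) (exprMn 2 y f) (exprMn 2 w g).
  apply: (@le_trans _ _ (y ^+ 2 * (g ^+ 2 * (N + k)%:R))).
    by rewrite -mulrA ler_wpM2l ?sqr_ge0.
  have g2 : 0 <= g ^+ 2 by exact: sqr_ge0.
  have := ler_wpM2l g2 kN; rewrite natrD.
  move: (g ^+ 2) (y ^+ 2) (w ^+ 2) (k%:R : R) (N%:R : R) => A B D u v; clear; lra.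
have h1 := hn0 k k0; rewrite ler_pdivrMr ?subr_gt0 // -/f in h1.
apply: (@le_trans _ _ (w / f + f^-1 * (y' - w))).
  by apply: lerD => //; rewrite ler_pdivrMr // mulrAC ler_pdivlMr.
by rewrite (_ : w / f + f^-1 * (y' - w) = y' / f) //; ring.
Qed.

Lemma often_below_shift N e x : area_cvg e -> (exists M : R, stay N M e) -> 0 <= x ->
  often_below x e <-> often_below x (path_shift N e).
Proof.
move=> cv hM x0.
have lt i : x + i.+2%:R^-1 < x + i.+1%:R^-1 :> R.
  by rewrite ltrD2l ltf_pV2 ?posrE // ltr_nat.
have ge i : 0 <= x + i.+2%:R^-1 :> R by rewrite addr_ge0 // invr_ge0.
split => h i _.
  exact: (@often_shift N e _ _ cv (ge i) (lt i) (h i.+1 Logic.I)).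
exact: (@often_unshift N e _ _ cv hM (ge i) (lt i) (h i.+1 Logic.I)).
Qed.

Variable mu : probability (pathSpace R) R.
Hypothesis fdd : brownian_fdd mu.
Hypothesis bounded : {ae mu, forall e, forall n, exists M : R, stay n M e}.

Lemma rect_stop m (B : nat -> 'I_2 -> set R) :
  path_stop (2 ^ m) @^-1` rect m B = rect m B.
Proof.
have iE k j e : (k < 4 ^ m)%N -> incr m k j (path_stop (2 ^ m) e) = incr m k j e.
  move=> km; have E : (4 ^ m = 2 ^ m * 2 ^ m)%N by rewrite -[4%N]/(2 * 2)%N expnMn.
  rewrite E in km.
  by rewrite /incr !co_stop_le // -(dy_intM m (2 ^ m)) ler_dy // ltnW.
by apply/seteqP; split => e /= h k j km; have := h k j km; rewrite iE.
Qed.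

(* Kolmogorov's zero-one law: the event only depends on the path after any
   given time, hence it is independent of every event, itself included. *)
Theorem zero_one x : 0 <= x -> mu (often_below x) = 0%E \/ mu (often_below x) = 1%E.
Proof.
move=> x0; set U := often_below x.
have mU : measurable (U : set (pathSpace R)) by exact: measurable_often_below.
pose m2 : {measure set (pathSpace R) -> \bar R} := mscale (nng_prob mu U) mu.
have UU : mrestr mu mU U = m2 U.
  apply: path_measure_unique => //.
    by rewrite /= /mrestr setTI probability_lty.
  move=> m B mB; rewrite /m2 /= /mrestr /mscale /= probability_fineK // muleC.
  have mQ := measurable_rect m mB.
  transitivity (mu (rect m B `&` path_shift (2 ^ m) @^-1` U)).
    apply: ae_eq_measure; [exact: measurableI| |].
      by apply: measurableI => //; exact: measurable_preimage (measurable_shift _) mU.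
    apply: ae_mono2 (ae_area_cvg fdd) bounded => e cv /(_ (2 ^ m)%N) hM.
    have [h1 h2] := often_below_shift cv hM x0.
    by split => -[? ?]; split => //; [exact: h1|exact: h2].
  by have := past_future_indep fdd (2 ^ m) mQ mU; rewrite rect_stop.
move: UU; rewrite /mrestr /m2 /= /mscale /= setIid probability_fineK //.
rewrite -(probability_fineK mu mU) -EFinM => -[].
move: (fine _) => p pp.
have : p * (1 - p) = 0 by rewrite mulrBr mulr1 -pp subrr.
move=> /eqP; rewrite mulf_eq0 => /orP[/eqP ->|]; first by left.
by rewrite subr_eq0 => /eqP <-; right.
Qed.

End tail_events.

(** * The critical constant *)

Section lower_bound.
Context {R : realType} (mu : probability (pathSpace R) R).
Hypothesis fdd : brownian_fdd mu.

Lemma sum_inv_sqr_le N : \sum_(0 <= p < N) (p.+1%:R ^+ 2)^-1 <= 2 * (1 - N.+1%:R^-1) :> R.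
Proof.
elim: N => [|N IH]; first by rewrite big_geq // invr1 subrr mulr0.
rewrite big_nat_recr //=; apply: (le_trans (lerD IH (lexx _))).
rewrite -subr_ge0 (_ : _ - _ = N%:R / (N.+1%:R ^+ 2 * N.+2%:R) :> R).
  by rewrite divr_ge0 // mulr_ge0 // exprn_ge0.
have N0 : (0 : R) <= N%:R by [].
rewrite -[N.+2]addn2 -[N.+1]addn1 !natrD; field.
by apply/andP; split; rewrite gt_eqF //; lra.
Qed.

(** With [l] the integer logarithm, $2^l\le p+2\le p^2$ and $\log 2\ge 1/2$ give $l\le 4\log p$; the
    additional 1 is at most $2\log p$. *)
Lemma log_le_ln p : (2 <= p)%N -> (trunc_log 2 p.+2).+1%:R <= 6 * ln p%:R :> R.
Proof.
move=> p2; have pp : 0 < p%:R :> R by rewrite ltr0n (leq_trans _ p2).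
have h1 : 2 ^+ trunc_log 2 p.+2 <= p%:R ^+ 2 :> R.
  rewrite -!natrX ler_nat (leq_trans (trunc_logP _ _)) // -mulnn.
  by rewrite (leq_trans _ (leq_mul p2 (leqnn p))) // mul2n -addnn -addn2 leq_add2l.
have : ln (2 ^+ trunc_log 2 p.+2) <= ln (p%:R ^+ 2) :> R.
  by rewrite ler_ln ?posrE ?exprn_gt0.
rewrite (@lnXn R (trunc_log 2 p.+2) 2) // (@lnXn R 2 p%:R) // => h2.
rewrite -(mulr_natl (ln 2)) -(mulr_natl (ln p%:R)) in h2.
have l2 := @ln2_ge R.
have h3 : ln 2 <= ln p%:R :> R by rewrite ler_ln ?posrE // ler_nat.
have t0 : 0 <= (trunc_log 2 p.+2)%:R :> R by [].
have h4 := ler_wpM2l t0 l2.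
rewrite -natr1; lra.
Qed.

Lemma lnln_pow4 p t : (1 <= p)%N -> (4 ^ p)%:R <= t :> R -> ln p%:R <= ln (ln t) :> R.
Proof.
move=> p1 h; have pp : 0 < p%:R :> R by rewrite ltr0n.
have l4 : 1 <= ln 4 :> R.
  rewrite (_ : 4 = 2 ^+ 2 :> R); last by ring.
  by rewrite (@lnXn R 2 2) // -(mulr_natl (ln 2)); have := @ln2_ge R; lra.
have h1 : p%:R <= ln t.
  apply: (@le_trans _ _ (ln (4 ^ p)%:R)).
    by rewrite natrX (@lnXn R p 4) // -(mulr_natl (ln 4)) ler_peMr // ltW.
  have e0 : 0 < (4 ^ p)%:R :> R by rewrite ltr0n expn_gt0.
  by rewrite ler_ln ?posrE // (lt_le_trans e0 h).
by rewrite ler_ln ?posrE // (lt_le_trans pp h1).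
Qed.

(** With [tau p] of order $4^p\log p$ the events [F p] have summable probabilities. If $g^*_n\le
    c/\phi(n)$ for some [n] between [tau p] and [tau p.+1], then [F p] occurs. *)
Theorem often_lower : exists2 c : R, 0 < c & mu (often c) = 0%E.
Proof.
have [q /andP[q0 q1] hq] := small_ball_upper fdd.
(* With $q^b\le 1/4$ and $l=\lfloor\log_2(p+1)\rfloor$, the exponent $b(l+1)$ gives a probability at
   most $4^{-(l+1)}\le(p+1)^{-2}$. *)
have [b hb] : exists b, q ^+ b <= 4^-1.
  have qn : `|q| < 1 by rewrite ger0_norm.
  have := cvg_geometric (1 : R) qn; move=> /cvgr0Pnorm_lt /(_ 4^-1) h.
  have {}h := h ltac:(by rewrite invr_gt0).
  near \oo => n; exists n; have : `|geometric 1 q n| < 4^-1 by near: n.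
  by rewrite /= mul1r ger0_norm ?exprn_ge0 // => /ltW.
have b0 : (0 < b)%N by case: b hb => // hb; exfalso; move: hb; rewrite expr0; lra.
have bp : 0 < b%:R :> R by rewrite ltr0n.
pose m p := (b * (trunc_log 2 p.+1).+1)%N.
pose tau p := (4 ^ p * m p)%N.
pose F p : set (pathSpace R) := stay (tau p) (2 ^+ p * 1).
have mF p : measurable (F p) by exact: measurable_stay.
have Fle p : (mu (F p) <= ((p.+1%:R ^+ 2)^-1)%:E)%E.
  rewrite /F stay_scaling // (le_trans (hq _)) // lee_fin /m exprM.
  apply: (@le_trans _ _ (4^-1 ^+ (trunc_log 2 p.+1).+1)).
    by rewrite lerXn2r ?nnegrE ?exprn_ge0 // invr_ge0.
  rewrite exprVn lef_pV2 ?posrE ?exprn_gt0 //.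
  rewrite (_ : 4 = 2 ^+ 2 :> R); last by ring.
  rewrite exprAC lerXn2r ?nnegrE ?exprn_ge0 // -natrX ler_nat ltnW //.
  exact: trunc_log_ltn.
have sumF : (\sum_(n <oo) mu (F n) < +oo)%E.
  apply: (@le_lt_trans _ _ 2%:E); last exact: ltry.
  apply: lime_le; first by apply: is_cvg_nneseries => n _ _; exact: measure_ge0.
  apply: nearW => N.
  apply: (@le_trans _ _ (\sum_(0 <= p < N) ((p.+1%:R ^+ 2)^-1)%:E)%E).
    by apply: lee_sum => p _; exact: Fle.
  rewrite sumEFin lee_fin (le_trans (sum_inv_sqr_le N)) //.
  by rewrite ler_piMr // gerBl invr_ge0.
have F0 := lim_sup_set_cvg0 mF sumF.
(* Chosen so that $4c^2b\cdot 6=24/(25b)\le 1$ at the end: the 4 is the ratio of consecutive scales,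
   the 6 is the constant of [log_le_ln]. *)
pose c : R := (5 * b%:R)^-1.
have c0 : 0 < c by rewrite invr_gt0 mulr_gt0.
exists c => //; apply/eqP; rewrite -measure_le0 -F0.
apply: le_measure; rewrite ?inE; first exact: measurable_often.
  by apply: bigcapT_measurable => n; apply: bigcup_measurable => k _; exact: mF.
move=> e /oftenP h P0 _; pose P := maxn P0 2.
have tau_ge p : (4 ^ p <= tau p)%N by rewrite /tau leq_pmulr // /m muln_gt0 b0.
have [n nP hn] := h (tau P).
have ex : exists i, (n < tau (P + i.+1))%N.
  exists n; apply: leq_trans (tau_ge _).
  by apply: (@leq_trans (4 ^ n)); [exact: ltn_expl|rewrite leq_exp2l // addnS leqW // leq_addl].
case: (ex_minnP ex) => i hi imin; pose p := (P + i)%N.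
have pn : (tau p <= n)%N.
  rewrite /p; case: i hi imin @p => [|i] hi imin p; first by rewrite addn0.
  by rewrite leqNgt; apply/negP => /imin; rewrite ltnn.
have np : (n < tau p.+1)%N by rewrite /p -addnS.
have p2 : (2 <= p)%N by rewrite /p (leq_trans (leq_maxr P0 2)) // leq_addr.
exists p; first by rewrite /= /p (leq_trans (leq_maxl P0 2)) // leq_addr.
have p4n : (4 ^ p)%:R <= n%:R :> R by rewrite ler_nat (leq_trans (tau_ge p)).
have n16 : 16 <= n%:R :> R.
  by rewrite (le_trans _ p4n) // ler_nat -[16%N]/(4 ^ 2)%N leq_exp2l.
have f0 := phi_gt0 n16.
apply: stay_le hn => //; first by rewrite divr_ge0 ?ltW.
rewrite mulr1 ler_pdivrMr // -ler_sqr ?nnegrE ?mulr_ge0 ?exprn_ge0 ?(ltW c0) ?(ltW f0) //.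
rewrite exprMn phi_sqr // mulrA ler_pdivlMr; last by lra.
have n_le : n%:R <= 4 * (2 ^+ p) ^+ 2 * (b%:R * (trunc_log 2 p.+2).+1%:R) :> R.
  rewrite (_ : 4 * (2 ^+ p) ^+ 2 = (4 ^ p.+1)%:R :> R); last first.
    rewrite natrX (exprS _ p) -(exprM 2 p 2) mulnC exprM (_ : 2 ^+ 2 = 4 :> R) //.
    by rewrite -natrX.
  by rewrite -!natrM ler_nat ltnW.
apply: (le_trans (ler_wpM2l (sqr_ge0 c) n_le)).
rewrite (_ : c ^+ 2 * _ = (2 ^+ p) ^+ 2 * (4 * c ^+ 2 * b%:R * (trunc_log 2 p.+2).+1%:R)); last by ring.
apply: ler_wpM2l; first exact: sqr_ge0.
apply: (le_trans _ (lnln_pow4 (ltnW p2) p4n)).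
have lp := log_le_ln p2.
apply: (@le_trans _ _ (4 * c ^+ 2 * b%:R * (6 * ln p%:R))).
  apply: ler_wpM2l lp; apply: mulr_ge0 (ltW bp).
  by apply: mulr_ge0 (sqr_ge0 c).
rewrite mulrA ler_piMl //; first by rewrite ln_ge0 // ler1n (leq_trans _ p2).
rewrite /c (_ : 4 * _ * _ * 6 = 24 / 25 * b%:R^-1 :> R); last first.
  by field; rewrite gt_eqF.
have : b%:R^-1 <= 1 :> R by rewrite invf_le1 // ler1n.
lra.
Unshelve. all: by end_near.
Qed.

End lower_bound.

(** * Last-exit decomposition *)

Section last_exit.
Context {R : realType} (mu : probability (pathSpace R) R).
Hypothesis fdd : brownian_fdd mu.
Variables (d t : nat -> nat) (rho : nat -> R).
Hypothesis tS : forall k, t k.+1 = (t k + d k)%N.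

Let E k : set (pathSpace R) := path_shift (t k) @^-1` stay (d k) (rho k).
Let G k : set (pathSpace R) := stay (t k) (rho k).

(* [hit i j], after the shift by [t i], is the union of the [E k], and
   [hit_start i j] that of the [E k `&` G k], for i <= k < i + j.  Splitting
   according to the last [k] for which [E k] occurs, [G k] belongs to the past
   and is independent of the rest, so it only costs a factor 1/2. *)
Fixpoint hit (i j : nat) : set (pathSpace R) :=
  if j is j'.+1 then stay (d i) (rho i) `|` path_shift (d i) @^-1` hit i.+1 j' else set0.

Fixpoint hit_start (i j : nat) : set (pathSpace R) :=
  if j is j'.+1 then (E i `&` G i) `|` hit_start i.+1 j' else set0.

Let mstay n r : measurable (stay n r : set (pathSpace R)) := @measurable_stay R n r.

Let mshift N (V : set (pathSpace R)) : measurable V ->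
  measurable (path_shift N @^-1` V : set (pathSpace R)) :=
  measurable_preimage (measurable_shift N).

Let mE k : measurable (E k) := mshift (t k) (mstay (d k) (rho k)).

Lemma measurable_hit i j : measurable (hit i j).
Proof.
elim: j i => [|j IH] i /=; first exact: measurable0.
by apply: measurableU => //; exact: mshift.
Qed.

Lemma measurable_hit_start i j : measurable (hit_start i j).
Proof.
elim: j i => [|j IH] i /=; first exact: measurable0.
by apply: measurableU => //; apply: measurableI; [exact: mE|exact: mstay].
Qed.

Lemma hit_start_sub i j : hit_start i j `<=` path_shift (t i) @^-1` hit i j.
Proof.
elim: j i => [|j IH] i //= e [[h _]|/IH h]; first by left.
by right; move: h; rewrite /preimage /= tS shiftD.
Qed.

Lemma stay_past n r (V : set (pathSpace R)) : measurable V ->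
  mu (stay n r `&` path_shift n @^-1` V) = (mu (stay n r) * mu V)%E.
Proof.
move=> mV; have := past_future_indep fdd n (mstay n r) mV.
have -> : path_stop n @^-1` stay n r = stay n r.
  have H e : stay n r (path_stop n e) <-> stay n r e by exact: stay_stop.
  by apply/seteqP; split => e h; [exact: (H e).1|exact: (H e).2].
by [].
Qed.

Lemma stay_past_setC n r (V : set (pathSpace R)) : measurable V ->
  mu (~` stay n r `&` path_shift n @^-1` V) = (mu (~` stay n r) * mu V)%E.
Proof.
move=> mV; have := past_future_indep fdd n (measurableC (mstay n r)) mV.
have -> : path_stop n @^-1` (~` stay n r) = ~` stay n r.
  have H e : stay n r (path_stop n e) <-> stay n r e by exact: stay_stop.
  by apply/seteqP; split => e /= h h'; apply: h; apply/H.
by [].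
Qed.

Variable k0 : nat.
Hypothesis Ghalf : forall k, (k0 <= k)%N -> ((2^-1)%:E <= mu (G k))%E.

Lemma hit_start_ge i j : (k0 <= i)%N -> ((2^-1)%:E * mu (hit i j) <= mu (hit_start i j))%E.
Proof.
elim: j i => [|j IH] i ki; first by rewrite /= measure0 mule0.
set S : set (pathSpace R) := stay (d i) (rho i).
set H' : set (pathSpace R) := path_shift (d i) @^-1` hit i.+1 j.
set Y : set (pathSpace R) := path_shift (t i.+1) @^-1` hit i.+1 j.
have mH' : measurable H' by apply: mshift; exact: measurable_hit.
have mY : measurable Y by apply: mshift; exact: measurable_hit.
have mSH : measurable (S `\` H') by apply: measurableD (mstay _ _) mH'.
have mEG : measurable (E i `&` G i) by apply: measurableI; [exact: mE|exact: mstay].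
have hE : mu (hit i j.+1) = (mu (hit i.+1 j) + mu (S `\` H'))%E.
  rewrite /= -/S -/H' setUC -(shift_preserves fdd (d i) (measurable_hit i.+1 j)) -/H'.
  rewrite -measureU //; last by rewrite setDE setICA setICr setI0.
  congr (mu _); apply/seteqP; split => e; last by case=> [|[]]; [left|right].
  by move=> [h|h]; [left|have [h'|h'] := EM (H' e); [left|right]].
have EGY : (E i `&` G i) `\` Y = G i `&` path_shift (t i) @^-1` (S `\` H').
  by apply/seteqP; split => e; rewrite /E /Y /S /H' /= tS shiftD => -[];
     [move=> [? ?] ?; split => //; split|move=> ? [? ?]; split].
have EGYm : mu ((E i `&` G i) `\` Y) = (mu (G i) * mu (S `\` H'))%E.
  by rewrite EGY stay_past.
rewrite hE ge0_muleDr ?measure_ge0 //.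
apply: (@le_trans _ _ (mu (hit_start i.+1 j) + mu ((E i `&` G i) `\` Y))%E).
  apply: leeD; first by apply: IH; rewrite leqW.
  by rewrite EGYm; apply: lee_wpmul2r; [exact: measure_ge0|exact: Ghalf].
have mhs := measurable_hit_start i.+1 j.
have mD : measurable ((E i `&` G i) `\` Y) by exact: measurableD.
rewrite -measureU //; last first.
  by apply/seteqP; split => // e [/hit_start_sub h [_ nY]].
apply: le_measure; rewrite ?inE //=.
- exact: measurableU.
- exact: measurableU.
- by move=> e [h|[h _]]; [right|left].
Qed.

Variable kappa : R.
Hypothesis kappa0 : 0 <= kappa.
Hypothesis hk : forall k, ((kappa / k.+1%:R)%:E <= mu (stay (d k) (rho k)))%E.

(** A finite form of the second Borel-Cantelli lemma: the blocks are independent, and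
    $(1+u+s)(1-p)\le 1+s$ for $u\le p$ drives the induction. *)
Lemma hit_ge i j : (1 + \sum_(l < j) kappa / (i + l).+1%:R) * (1 - fine (mu (hit i j))) <= 1.
Proof.
elim: j i => [|j IH] i; first by rewrite big_ord0 /= measure0 /= subr0 addr0 mulr1.
set S : set (pathSpace R) := stay (d i) (rho i).
set h' := fine (mu (hit i.+1 j)).
set p := fine (mu S).
have mh := measurable_hit i.+1 j.
have h'E : mu (hit i.+1 j) = h'%:E by rewrite probability_fineK.
have pE : mu S = p%:E by rewrite probability_fineK //; exact: mstay.
have hC : mu (~` hit i j.+1) = ((1 - p) * (1 - h'))%:E.
  rewrite /= setCU -/S preimage_setC stay_past_setC; last exact: measurableC.
  by rewrite !probability_setC ?h'E ?pE //; exact: mstay.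
have hE : 1 - fine (mu (hit i j.+1)) = (1 - p) * (1 - h').
  have := probability_setC mu (measurable_hit i j.+1); rewrite hC.
  by rewrite -{1}(probability_fineK mu (measurable_hit i j.+1)) => -[->].
have p1 : p <= 1 by rewrite -lee_fin -pE probability_le1 //; exact: mstay.
have h1 : h' <= 1 by rewrite -lee_fin -h'E probability_le1.
have pk : kappa / i.+1%:R <= p by rewrite -lee_fin -pE; exact: hk.
rewrite hE big_ord_recl addn0.
have -> : \sum_(l < j) kappa / (i + lift ord0 l).+1%:R = \sum_(l < j) kappa / (i.+1 + l).+1%:R.
  by apply: eq_bigr => l _; rewrite /= /bump /= add1n addnS addSn.
set s := \sum_(_ < _) _.
have s0 : 0 <= s by apply: sumr_ge0 => l _; rewrite divr_ge0.
have := IH i.+1; rewrite -/s -/h'.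
have u0 : 0 <= kappa / i.+1%:R by rewrite divr_ge0.
move: (kappa / i.+1%:R) u0 pk => u u0 up IHs.
have a1 : (1 + (u + s)) * (1 - p) <= 1 + s by nra.
apply: le_trans IHs; rewrite mulrA ler_wpM2r //; lra.
Qed.

(** Divergence of the harmonic series brings the sum in [hit_ge] up to 1. *)
Lemma hit_half i : 0 < kappa -> exists j, 2^-1 <= fine (mu (hit i j)).
Proof.
move=> kp.
have [j hj] : exists j, 1 <= \sum_(l < j) kappa / (i + l).+1%:R.
  have nd : nondecreasing_seq (series (@harmonic R)).
    by apply: nondecreasing_series => n _ _; rewrite /harmonic /= invr_ge0.
  have /cvgryPge/(_ (kappa^-1 + series harmonic i)) := nondecreasing_dvgn_lt nd (@dvg_harmonic R).
  move=> [n _ hn].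
  exists n; have := hn (i + n)%N (leq_addl _ _).
  have -> : series harmonic (i + n)%N = \sum_(l < n) (i + l).+1%:R^-1 + series harmonic i :> R.
    elim: n {hn} => [|n IHn]; first by rewrite addn0 big_ord0 add0r.
    rewrite addnS /series /= big_nat_recr //= big_ord_recr /=.
    by rewrite -[X in X + _ = _]/(series harmonic (i + n)%N) IHn addrAC.
  rewrite lerD2r => h.
  by rewrite -mulr_sumr -ler_pdivrMl // mulr1.
exists j; have := hit_ge i j.
have : 0 <= fine (mu (hit i j)) by exact: fine_ge0.
have : fine (mu (hit i j)) <= 1.
  by rewrite -lee_fin probability_fineK ?probability_le1 //; exact: measurable_hit.
move: (fine _) (\sum_(_ < _) _) hj => h s; nra.
Qed.

(** The union over the blocks from [i] on has probability at least $1/2\cdot 1/2$ for all large [i],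
    and this bound passes to the decreasing limit. *)
Theorem last_exit : 0 < kappa -> (0 < mu (lim_sup_set (fun k => E k `&` G k)))%E.
Proof.
move=> kp.
have mEG k : measurable (E k `&` G k) by apply: measurableI; [exact: mE|exact: mstay].
have sub i j : hit_start i j `<=` \bigcup_(k in [set k | (i <= k)%N]) (E k `&` G k).
  elim: j i => [|j IH] i //= e [h|/IH[k /= ik h]]; first by exists i => /=.
  by exists k => //=; exact: ltnW.
have ge i : (k0 <= i)%N -> ((4^-1)%:E <= mu (\bigcup_(k in [set k | (i <= k)%N]) (E k `&` G k)))%E.
  move=> ki; have [j hj] := hit_half i kp.
  apply: (@le_trans _ _ (mu (hit_start i j))).
    apply: (le_trans _ (hit_start_ge j ki)).
    rewrite -(probability_fineK mu (measurable_hit i j)) -EFinM lee_fin; lra.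
  apply: le_measure; rewrite ?inE //; first exact: measurable_hit_start.
  by apply: bigcup_measurable => k _; exact: mEG.
have mT : (mu (\bigcup_(k in [set k | (0 <= k)%N]) (E k `&` G k)) < +oo)%E.
  by apply: probability_lty; apply: bigcup_measurable => k _; exact: mEG.
have cv := @lim_sup_set_cvg _ _ _ mu _ mEG mT.
apply: (@lt_le_trans _ _ (4^-1)%:E); first by rewrite lte_fin invr_gt0.
rewrite -(cvg_lim _ cv) //; apply: lime_ge; first by apply/cvg_ex; eexists; exact: cv.
by exists k0 => // i /= /ge.
Qed.

End last_exit.

(** * Blocks with a small running maximum *)

Section upper_bound.
Context {R : realType} (mu : probability (pathSpace R) R).
Hypothesis fdd : brownian_fdd mu.
Hypothesis bounded : {ae mu, forall e, forall n, exists M : R, stay n M e}.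

Lemma stay_tight n : exists K : nat, forall rho : R, K%:R <= rho ->
  ((2^-1)%:E <= mu (stay n rho))%E.
Proof.
pose F (K : nat) : set (pathSpace R) := stay n K%:R.
have mF K : measurable (F K) by exact: measurable_stay.
have mU : measurable (\bigcup_K F K) by exact: bigcup_measurable.
have nd : nondecreasing_seq F.
  by move=> K K' KK; apply/subsetPset => e; apply: stay_le => //; rewrite ler_nat.
have U1 : mu (\bigcup_K F K) = 1%E.
  rewrite -(@probability_setT _ _ _ mu); apply: ae_eq_measure => //.
  apply: ae_mono bounded => e /(_ n)[M /stay_nat[K hK]]; split => // _.
  by exists K.
have cv : (mu \o F) K @[K --> \oo] --> (1%E : \bar R).
  by rewrite -U1; exact: nondecreasing_cvg_mu.
have h2 : ((2^-1)%:E < 1 :> \bar R)%E by rewrite lte_fin invf_lt1 ?ltr1n.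
have [K _ /(_ K (leqnn K)) hK] := cv _ (open_ereal_gt' h2).
exists K => rho Kr; apply: (le_trans (ltW hK)).
apply: le_measure; rewrite ?inE //; first exact: measurable_stay.
by move=> e; apply: stay_le.
Qed.

(* The lengths of the blocks grow like 4 ^ (k ^ 2) log k: the small-ball
   probabilities of the blocks are of order 1 / k, hence not summable, while the
   whole past of a block is negligible at its scale. *)
Let nn (a k : nat) := (trunc_log 2 k.+1 %/ a).+1.
Let dur (a k : nat) := (4 ^ (k * k) * (4 * nn a k))%N.
Let start (a k : nat) := (\sum_(i < k) dur a i)%N.

(** The past of block $k+1$ is thus shorter than the scale $4^{(k+1)^2}$ of that block by a factor
    of at least $4^{k-1}$. *)
Lemma start_le a k : (start a k.+1 <= 4 ^ (k * k + k + 2))%N.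
Proof.
have dle i : (dur a i <= 4 ^ (i * i + i + 1))%N.
  rewrite /dur -addnA expnD; apply: (leq_mul (leqnn _)).
  rewrite addn1 expnS; apply: (leq_mul (leqnn _)).
  apply: (@leq_trans i.+1); last exact: ltn_expl.
  rewrite /nn ltnS (leq_trans (leq_div _ _)) // -ltnS.
  by rewrite (leq_trans (ltn_expl _ (isT : (1 < 2)%N))) // trunc_logP.
elim: k => [|k IH]; first by rewrite /start big_ord1 (leq_trans (dle 0%N)).
rewrite /start big_ord_recr /= (leq_trans (leq_add IH (dle k.+1))) //.
have h : (4 ^ (k * k + k + 2) <= 4 ^ (k.+1 * k.+1 + k.+1 + 1))%N by rewrite leq_exp2l //; nia.
rewrite (leq_trans (leq_add h (leqnn _))) // addnn -mul2n.
by rewrite [X in (_ <= _ ^ X)%N]addnS expnS leq_mul2r orbT.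
Qed.

(** Here $\log t\le 2(k^2+k+2)\le(k+1)^4$, and $\log(k+1)$ is at most [a * nn a k]. *)
Lemma lnln_start a k t : (0 < a)%N -> (1 <= k)%N -> 16 <= t -> t <= (start a k.+1)%:R ->
  ln (ln t) <= 4 * (a * nn a k)%:R :> R.
Proof.
move=> a0 k1 t16 ht.
have t0 : 0 < t by lra.
have lt := ln_ge2 t16; have lt0 : 0 < ln t by lra.
have kp : 0 < k.+1%:R :> R by rewrite ltr0n.
have ln2 : ln 2 <= 1 :> R by have := @ln_ler_sub1 R 2 ltac:(by []); lra.
have e1 : ln t <= (k.+1 ^ 4)%:R.
  apply: (@le_trans _ _ (ln (4 ^+ (k * k + k + 2)))).
    rewrite ler_ln ?posrE ?exprn_gt0 // (le_trans ht) // -natrX ler_nat.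
    exact: start_le.
  have -> : 4 ^+ (k * k + k + 2) = 2 ^+ (2 * (k * k + k + 2)) :> R.
    by rewrite exprM; congr (_ ^+ _); rewrite -natrX.
  rewrite (@lnXn R _ 2) // -(mulr_natl (ln 2)).
  apply: (@le_trans _ _ (2 * (k * k + k + 2))%:R); first by rewrite ler_piMr.
  rewrite ler_nat -[4%N]/(2 * 2)%N expnM -!mulnn; clear -k1; nia.
have e2 : ln (ln t) <= 4 * ln k.+1%:R.
  apply: (@le_trans _ _ (ln ((k.+1 ^ 4)%:R))).
    by rewrite ler_ln ?posrE // ltr0n expn_gt0.
  by rewrite natrX (@lnXn R 4 k.+1%:R) // -(mulr_natl (ln _)).
apply: (le_trans e2); rewrite ler_wpM2l //.
set l := trunc_log 2 k.+1.
apply: (@le_trans _ _ (ln (2 ^+ l.+1))).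
  by rewrite ler_ln ?posrE ?exprn_gt0 // -natrX ler_nat ltnW // trunc_log_ltn.
rewrite (@lnXn R _ 2) // -(mulr_natl (ln 2)).
apply: (@le_trans _ _ l.+1%:R); first by rewrite ler_piMr.
by rewrite ler_nat /nn -/l mulnC ltn_ceil.
Qed.

Theorem often_upper : exists2 x : R, 0 < x & (0 < mu (often x))%E.
Proof.
have [C C0 [delta d0 hd]] := small_ball_lower fdd bounded.
(* As $2^{-a}\le\delta$, dividing the logarithm of [k.+1] by [a] makes [delta ^+ nn a k] at least
   $2^{-a}/(k+1)$, which is of harmonic order. *)
pose a := (Num.truncn delta^-1).+1.
have a1 : 1 <= a%:R :> R by rewrite ler1n.
have ad : (2 ^+ a)^-1 <= delta.
  rewrite -[leRHS]invrK lef_pV2 ?posrE ?invr_gt0 ?exprn_gt0 //.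
  rewrite (le_trans (ltW (truncnS_gt _))) // -natrX ler_nat ltnW //.
  exact: ltn_expl.
pose rho k : R := 2 ^+ (k * k) * C.
have rho0 k : 0 < rho k by rewrite mulr_gt0 // exprn_gt0.
have tS k : start a k.+1 = (start a k + dur a k)%N by rewrite /start big_ord_recr.
have hk k : (((2 ^+ a)^-1 / k.+1%:R)%:E <= mu (stay (dur a k) (rho k)))%E.
  rewrite stay_scaling // (le_trans _ (hd _)) // lee_fin.
  apply: (@le_trans _ _ ((2 ^+ a)^-1 ^+ nn a k)); last first.
    by rewrite lerXn2r ?nnegrE ?invr_ge0 ?exprn_ge0 // ltW.
  rewrite exprVn -invfM lef_pV2 ?posrE ?mulr_gt0 ?exprn_gt0 //.
  rewrite /nn -exprM mulnS exprD ler_pM2l ?exprn_gt0 //.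
  rewrite (@le_trans _ _ (2 ^+ trunc_log 2 k.+1)) //.
    by rewrite ler_eXn2l ?ltr1n // mulnC leq_divM.
  by rewrite -natrX ler_nat trunc_logP.
have [K hK] := stay_tight 1.
pose i0 := (Num.truncn (K%:R / C)).+1.
have Ghalf k : (i0.+2 <= k)%N -> ((2^-1)%:E <= mu (stay (start a k) (rho k)))%E.
  case: k => [|[|i]] // ii; rewrite !ltnS in ii.
  (* Since $q+i=(i+2)^2$, scaling by $4^q$ reduces the past of block $i+2$ to the unit time interval
     and its radius to $2^iC$. *)
  pose q := (i.+1 * i.+1 + i.+1 + 2)%N.
  have Ki : K%:R <= 2 ^+ i * C.
    rewrite -ler_pdivrMr // (le_trans (ltW (truncnS_gt _))) // -natrX ler_nat.
    by rewrite (leq_trans ii) // ltnW // ltn_expl.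
  apply: (le_trans (hK _ Ki)); rewrite -(stay_scaling fdd q).
  apply: le_measure; rewrite ?inE; [exact: measurable_stay|exact: measurable_stay|].
  move=> e; apply: stay_le.
  - by rewrite muln1; exact: start_le.
  - by rewrite !mulr_ge0 ?exprn_ge0 // ltW.
  - rewrite mulrA -exprD /rho (_ : (q + i = i.+2 * i.+2)%N) // /q; clear; nia.
have kap0 : 0 < (2 ^+ a)^-1 :> R by rewrite invr_gt0 exprn_gt0.
have pos := last_exit fdd tS Ghalf (ltW kap0) hk kap0.
(* The bounds on $t$ and $\log\log t$ give $(3\rho_k)^2\log\log t\le 9C^2a\,t\le x^2t$; the factor 3
   comes from [stay_concat]. *)
pose x := 3 * C * a%:R.
exists x; first by rewrite !mulr_gt0.
apply: (lt_le_trans pos); apply: ae_le_measure.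
- apply: bigcapT_measurable => n; apply: bigcup_measurable => k _.
  apply: measurableI; last exact: measurable_stay.
  exact: measurable_preimage (measurable_shift _) (measurable_stay _ _).
- exact: measurable_often.
apply: ae_mono (ae_area_cvg fdd) => e cv h; apply/oftenP => n.
have [k /= nk [hE hG]] := h n.+1 Logic.I.
have k1 : (1 <= k)%N by rewrite (leq_trans _ nk).
have dt : (dur a k <= start a k.+1)%N by rewrite tS leq_addl.
have kd : (4 ^ (k * k) * 4 <= dur a k)%N by apply: (leq_mul (leqnn _)); exact: leq_pmulr.
exists (start a k.+1).
  apply: leq_trans dt; apply: leq_trans kd.
  apply: (@leq_trans k); first exact: ltnW.
  apply: (@leq_trans (4 ^ k)); first exact/ltnW/ltn_expl.
  by rewrite (@leq_trans (4 ^ (k * k))) ?leq_pmulr // leq_exp2l // leq_pmulr.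
set t : R := (start a k.+1)%:R.
have t16 : 16 <= t.
  rewrite ler_nat; apply: leq_trans dt; apply: leq_trans kd.
  rewrite -[16%N]/(4 ^ 1 * 4)%N leq_mul2r /= leq_exp2l // muln_gt0; exact/andP.
have p0 := phi_gt0 t16; have t0 : 0 < t by lra.
have := stay_concat cv (ltW (rho0 k)) hG hE; rewrite -tS.
apply: stay_le => //; first by rewrite mulr_ge0 // ltW.
rewrite ler_pdivlMr // -ler_sqr ?nnegrE ?mulr_ge0 ?(ltW p0) ?(ltW (rho0 k)) ?(ltW C0) //.
rewrite exprMn phi_sqr // mulrA ler_pdivrMr //.
have ll := lnln_start (isT : (0 < a)%N) k1 t16 (lexx _).
have dR : (2 ^+ (k * k)) ^+ 2 * (4 * (nn a k)%:R) <= t.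
  rewrite -!exprM mulnC exprM (_ : 2 ^+ 2 = 4 :> R); last by rewrite -natrX.
  by rewrite -natrX -!natrM ler_nat.
have c9 : 0 <= 9 * C ^+ 2 * a%:R :> R by apply: mulr_ge0 (ltW (lt_le_trans ltr01 a1)); apply: mulr_ge0 (sqr_ge0 C).
apply: (@le_trans _ _ (9 * C ^+ 2 * a%:R * ((2 ^+ (k * k)) ^+ 2 * (4 * (nn a k)%:R)))).
  rewrite natrM in ll.
  rewrite [leRHS](_ : _ = (3 * rho k) ^+ 2 * (4 * (a%:R * (nn a k)%:R))); last by rewrite /rho; ring.
  by apply: ler_wpM2l ll; exact: sqr_ge0.
apply: (le_trans (ler_wpM2l c9 dR)).
rewrite ler_pM2r // (_ : x ^+ 2 = 9 * C ^+ 2 * a%:R * a%:R); last by rewrite /x; ring.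
by rewrite ler_peMr.
Qed.

End upper_bound.

(** * Existence of the critical level *)

Section critical_constant.
Context {R : realType} (mu : probability (pathSpace R) R).
Hypothesis fdd : brownian_fdd mu.
Hypothesis bounded : {ae mu, forall e, forall n, exists M : R, stay n M e}.

(** The event [often y] lies inside [often_below y] and contains [often_below x] for [x < y], so the
    zero-one law settles it for every nonnegative [y] other than the infimum. *)
Theorem critical_constant : exists2 c : R, 0 < c &
  forall y, (0 <= y -> y < c -> mu (often y) = 0%E) /\ (c < y -> mu (often y) = 1%E).
Proof.
have [c0 c0p mc0] := often_lower fdd.
have [x1 x1p mx1] := often_upper fdd bounded.
pose S := [set x : R | 0 <= x /\ mu (often_below x) = 1%E].
have mo y := @measurable_often R y; have mb y := @measurable_often_below R y.
have sub1 (x : R) : 0 <= x -> often x `<=` often_below x.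
  by move=> x0 e h i _; apply: often_le h => //; rewrite lerDl invr_ge0.
have sub2 (x y : R) : 0 <= x -> x < y -> often_below x `<=` often y.
  move=> x0 xy e h; pose i := Num.truncn (y - x)^-1.
  have hi : i.+1%:R^-1 <= y - x.
    rewrite -[leRHS]invrK lef_pV2 ?posrE ?invr_gt0 ?subr_gt0 //.
    by rewrite ltW // truncnS_gt.
  apply: (often_le _ _ (h i Logic.I)); first by rewrite addr_ge0 // invr_ge0.
  by rewrite addrC -lerBrDr.
have S1 : S x1.
  split; first exact: ltW.
  have [h|//] := zero_one fdd bounded (ltW x1p); exfalso; move: mx1.
  apply/negP; rewrite -leNgt -h; apply: le_measure; rewrite ?inE //.
  exact/sub1/ltW.
have Slb : lbound S c0.
  move=> x [x0 hx]; rewrite leNgt; apply/negP => xc.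
  suff : (mu (often_below x) <= 0)%E by rewrite hx leNgt lte_fin ltr01.
  by rewrite -mc0; apply: le_measure; rewrite ?inE //; exact: sub2.
have hS : has_inf S by split; [exists x1|exists c0].
have cc : c0 <= inf S by apply: lb_le_inf => //; exists x1.
exists (inf S); first exact: lt_le_trans cc.
move=> y; split => [y0 yc|cy].
  have [h|h] := zero_one fdd bounded y0; last first.
    by exfalso; move: yc; apply/negP; rewrite -leNgt; apply: (ge_inf hS.2).
  apply/eqP; rewrite -measure_le0 -h; apply: le_measure; rewrite ?inE //.
  exact: sub1.
have [x [x0 hx] xy] := inf_lt hS.1 cy.
apply/eqP; rewrite eq_le probability_le1 //= -hx.
by apply: le_measure; rewrite ?inE //; exact: sub2.
Qed.

End critical_constant.

(** * Realisations of Brownian motion *)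

Section path_law.
Context {R : realType} d (T : measurableType d) (P : probability T R).
Variables (X : T -> pathSpace R) (mX : measurable_fun setT X).

Definition path_law : probability (pathSpace R) R :=
  distribution P (mfun_Sub (mem_set mX) : {mfun T >-> pathSpace R}).

Lemma path_lawE V : path_law V = P (X @^-1` V).
Proof. by []. Qed.

Lemma ae_path_law (Q : pathSpace R -> Prop) :
  {ae path_law, forall e, Q e} -> {ae P, forall w, Q (X w)}.
Proof.
move=> [N [mN N0 sN]]; exists (X @^-1` N); split => //.
  exact: measurable_preimage.
by move=> w h; apply: sN.
Qed.

Lemma path_law_ae (Q : set (pathSpace R)) : measurable Q ->
  {ae P, forall w, Q (X w)} -> {ae path_law, forall e, Q e}.
Proof.
move=> mQ h; exists (~` Q); split => //; first exact: measurableC.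
rewrite path_lawE.
have mC : measurable (X @^-1` ~` Q) by apply: measurable_preimage => //; exact: measurableC.
by apply/eqP; rewrite -measure_le0 -(measure0 P); apply: ae_le_measure => //; exact: ae_mono h.
Qed.

End path_law.

Lemma brownian_law_unique (R : realType) (m1 m2 : probability (pathSpace R) R) :
  brownian_fdd m1 -> brownian_fdd m2 -> forall V, measurable V -> m1 V = m2 V.
Proof.
move=> f1 f2; apply: path_measure_unique; first exact: probability_lty.
move=> m B mB; exact: (etrans (fdd_grid f1 m (4 ^ m) mB) (esym (fdd_grid f2 m (4 ^ m) mB))).
Qed.

Section transfer.
Context {R : realType} {d : measure_display} {T : measurableType d} (P : probability T R).
Variables (W : 'I_2 -> R -> T -> R) (A : R -> T -> R).
Hypotheses (hW : is_BM2 P W) (hA : is_levy_area P W A).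

Definition sample_path (w : T) : pathSpace R := fun j t => W j t w.

Lemma co_sample_path w j t : co (sample_path w) j t = W j t w.
Proof. by have [_ [h _]] := hW; rewrite /co /sample_path h subr0. Qed.

Lemma measurable_sample_path : measurable_fun setT sample_path.
Proof.
have [h _] := hW; apply: measurable_to_path => j p k.
rewrite (_ : (fun _ => _) = W j (dy p k)) //.
by apply/funext => w; exact: co_sample_path.
Qed.

Let mX := measurable_sample_path.

Lemma brownian_fdd_sample_path : brownian_fdd (path_law P mX).
Proof.
have [_ [_ [_ h]]] := hW.
move=> n t B t0 tS _ mB; rewrite path_lawE.
have iE (k : 'I_n) : (inord k : 'I_n.+1) = k :> nat by rewrite inordK // ltnS ltnW.
have := h n (fun i => t i) (fun k j => B k j) t0.
have st (k : 'I_n) : t (inord k : 'I_n.+1) < t (lift ord0 k) by rewrite iE; exact: tS.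
move=> /(_ st (fun k j => mB k j)).
move=> E; apply: (etrans _ (etrans E _)); last first.
  by apply: eq_bigr => k _; apply: eq_bigr => j _; rewrite iE lift0.
congr (P _); apply/seteqP; split => w.
  by move=> H k j; have := H k j (ltn_ord k); rewrite !co_sample_path iE lift0.
move=> H k j kn; have := H (Ordinal kn) j.
by rewrite !co_sample_path iE lift0.
Qed.

Lemma measurable_levy_sum t n : measurable_fun setT (levy_sum W t n).
Proof.
have [h _] := hW.
apply: measurable_funM => //; apply: measurable_sum => k.
by apply: measurable_funB; apply: measurable_funM => //; exact: measurable_funB.
Qed.

(** The Riemann sums converge almost surely to the area of the path, and in mean square to [A]. By
    Fatou's lemma the lower limit of the squared distance to [A] vanishes almost surely, so the
    limits agree without any subsequence. *)
Lemma ae_area p k : {ae P, forall w, A (dy p k) w = area p k (sample_path w)}.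
Proof.
have [mA [_ l2]] := hA.
pose f n w := (((levy_sum W (dy p k) n w - A (dy p k) w) ^+ 2)%:E)%E.
have mf n : measurable_fun setT (f n).
  apply/measurable_EFinP; apply: measurable_funX; apply: measurable_funB => //.
  exact: measurable_levy_sum.
have f0 n w : setT w -> (0 <= f n w)%E by move=> _; rewrite lee_fin sqr_ge0.
have ml : measurable_fun setT (fun w => limn_einf (f ^~ w)).
  apply: measurableT_comp => //; apply: (@measurable_fun_limn_esup _ _ _ _ (fun n w => - f n w)%E).
  by move=> n; exact: measurableT_comp.
have l0 w : (0 <= limn_einf (f ^~ w))%E.
  rewrite limn_einf_lim; apply: lime_ge; first exact: is_cvg_einfs.
  by apply: nearW => n; apply: le_ereal_inf_tmp => _ [m /= _ <-]; exact: f0.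
have I0 : (\int[P]_w limn_einf (f ^~ w) = 0)%E.
  apply/eqP; rewrite eq_le integral_ge0 // andbT.
  apply: (le_trans (fatou P measurableT mf f0)).
  have cv := l2 _ (dy_ge0 p k).
  rewrite (_ : (fun n => _) = (fun n => \int[P]_w f n w)%E) // in cv.
  by rewrite is_cvg_limn_einfE ?(cvg_lim _ cv) //; apply/cvg_ex; eexists; exact: cv.
have ae0 : {ae P, forall w, limn_einf (f ^~ w) = 0%E}.
  have /ae_eq_integral_abs : measurable_fun setT (fun w => limn_einf (f ^~ w)) by [].
  move=> /(_ P measurableT) [h _].
  have : ae_eq P setT (fun w => limn_einf (f ^~ w)) (cst 0%E).
    by apply: h; under eq_integral do rewrite gee0_abs //.
  by apply: ae_mono => w; apply.
apply: ae_mono2 ae0 (ae_path_law (ae_cvg_levy_sum brownian_fdd_sample_path p k)) => w h cv.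
have sE : (fun n => levy_sum (fun j t e => co e j t) (dy p k) n (sample_path w)) =
          (fun n => levy_sum W (dy p k) n w).
  apply/funext => n; rewrite /levy_sum; congr (_ * _).
  by apply: eq_bigr => i _; rewrite !co_sample_path.
rewrite sE in cv.
have cr : (levy_sum W (dy p k) n w - A (dy p k) w) ^+ 2 @[n --> \oo] -->
    (area p k (sample_path w) - A (dy p k) w) ^+ 2.
  have cd : levy_sum W (dy p k) n w - A (dy p k) w @[n --> \oo] -->
      area p k (sample_path w) - A (dy p k) w by apply: cvgB => //; exact: cvg_cst.
  exact: (cvgM cd cd).
have cf : f n w @[n --> \oo] --> ((area p k (sample_path w) - A (dy p k) w) ^+ 2)%:E.
  by apply: cvg_EFin; [exact: nearW|exact: cr].
have [E _] := cvg_limn_einf_sup cf.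
rewrite h in E; case: E => /esym/eqP; rewrite sqrf_eq0 subr_eq0 => /eqP ->.
by [].
Qed.

End transfer.

(** * The running maximum of a realisation *)

Section running_max.
Context {R : realType}.

Lemma hnorm_le (x y z rho : R) : 0 <= rho -> (hnorm x y z <= rho) = (h4 x y z <= rho ^+ 4).
Proof.
move=> r0; have n0 : 0 <= hnorm x y z by exact: powR_ge0.
rewrite -(ler_pXn2r (isT : (0 < 4)%N)) ?nnegrE // -(powR_mulrn 4 n0) /hnorm -powRrM.
by rewrite mulVf // powRr1 // h4_ge0.
Qed.

Lemma dense_dy (F : R -> R) (n : nat) (b : R) : {within `[0, +oo[, continuous F} ->
  (forall p k, (k <= n * 2 ^ p)%N -> F (dy p k) <= b) ->
  forall s, 0 <= s <= n%:R -> F s <= b.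
Proof.
move=> /continuous_within_itvcyP[cF _] h s /andP[].
(* At 0 continuity is one-sided only, but 0 is itself dyadic. *)
rewrite le_eqVlt => /orP[/eqP <-|s0] sn; first by rewrite -(dy0 0); exact: h.
have {}cF : F x @[x --> s] --> F s by apply: cF; rewrite in_itv /= andbT.
(* Approximation from below keeps the dyadic times within $[0,n]$. *)
pose k p := Num.truncn (s * 2 ^+ p).
have kE p : (k p)%:R <= s * 2 ^+ p < (k p).+1%:R.
  by apply: truncn_itv; rewrite mulr_ge0 ?exprn_ge0 // ltW.
have dks p : `|dy p (k p) - s| <= 2^-1 ^+ p.
  have e0 : 0 < 2 ^+ p :> R by rewrite exprn_gt0.
  have /andP[a1 a2] := kE p; rewrite unlock distrC ger0_norm; last first.
    by rewrite subr_ge0 ler_pdivrMr.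
  rewrite exprVn lerBlDr -[X in X + _]mul1r -mulrDl ler_pdivlMr //.
  by rewrite addrC natr1 ltW.
have cv : dy p (k p) @[p --> \oo] --> s.
  apply/cvgrPdist_le => eps eps0.
  have half : `|2^-1 : R| < 1 by rewrite ger0_norm ?invr_ge0 // invf_lt1 // ltr1n.
  have /cvgr0Pnorm_le/(_ eps eps0) := cvg_expr half.
  apply: filterS => p; rewrite ger0_norm ?exprn_ge0 ?invr_ge0 // => hp.
  by rewrite distrC (le_trans (dks p)).
have cFk : F (dy p (k p)) @[p --> \oo] --> F s by exact: (cvg_comp _ _ cv cF).
rewrite -(cvg_lim (@Rhausdorff R) cFk); apply: limr_le; first by apply/cvg_ex; eexists; exact: cFk.
apply: nearW => p; apply: h; rewrite -(@ler_dy R p) dy_intM.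
have /andP[a1 _] := kE p; rewrite unlock ler_pdivrMr ?exprn_gt0 // (le_trans a1) //.
by rewrite ler_wpM2r // exprn_ge0.
Qed.

Section gstar.
Context {T : Type} (W : 'I_2 -> R -> T -> R) (A : R -> T -> R) (w : T).
Hypothesis cW : forall j, {within `[0, +oo[, continuous (fun t => W j t w)}.
Hypothesis cA : {within `[0, +oo[, continuous (fun t => A t w)}.

Let F (s : R) := h4 (W ord0 s w) (W ord_max s w) (A s w).

Let cF : {within `[0, +oo[, continuous F}.
Proof.
move=> s; rewrite /F /h4 /=.
have c0 := @cW ord0 s; have c1 := @cW ord_max s; have c2 := @cA s.
have sq (U : topologicalType) (x : U) (f : U -> R) : {for x, continuous f} ->
    {for x, continuous (fun u => f u ^+ 2)} by move=> cf; exact: (continuousM cf cf).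
exact: (continuousD (sq _ _ _ (continuousD (sq _ _ _ c0) (sq _ _ _ c1))) (sq _ _ _ c2)).
Qed.

Lemma gstar_le t rho : 0 <= t -> 0 <= rho ->
  gstar W A t w <= rho <-> forall s, 0 <= s <= t -> F s <= rho ^+ 4.
Proof.
move=> t0 r0; rewrite /gstar; set S := (X in sup X).
have S0 : S !=set0 by eexists; exists 0 => //=; rewrite in_itv /= lexx t0.
have hub : has_ubound S.
  have /(EVT_max t0)[c _ hc] : {within `[0, t], continuous F}.
    by apply: continuous_subspaceW cF; apply: subset_itvl; rewrite bnd_simp.
  have [M M0 hM] : exists2 M : R, 0 <= M & F c <= M ^+ 4.
    (* A number that is at least 1 does not exceed its fourth power. *)
    exists (1 + F c); first by rewrite addr_ge0 // h4_ge0.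
    have F0 : 0 <= F c by exact: h4_ge0.
    have h1 : 1 <= 1 + F c by lra.
    by rewrite exprS; have := ler_peMr (le_trans ler01 h1) (exprn_ege1 3 h1); lra.
  exists M => _ [s /= hs <-]; rewrite hnorm_le //; apply: le_trans hM.
  exact: hc.
split => [h s hs|h].
  rewrite /F -hnorm_le //; apply: le_trans h; apply: ub_le_sup => //.
  by exists s => //=; rewrite in_itv.
apply: ge_sup => // _ [s /= hs <-]; rewrite hnorm_le //.
by apply: h; move: hs; rewrite in_itv.
Qed.

Lemma gstar_ge0 t : 0 <= gstar W A t w.
Proof.
rewrite /gstar; set S := (X in sup X).
(* Without a least upper bound the real supremum is 0 by default. *)
have [hS|hS] := pselect (has_sup S); last by rewrite sup_out.
have [x Sx] := hS.1; apply: le_trans (ub_le_sup hS.2 Sx).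
by case: Sx => s _ <-; exact: powR_ge0.
Qed.

Lemma gstar_mono s t : 0 <= s -> s <= t -> gstar W A s w <= gstar W A t w.
Proof.
move=> s0 st; apply/(gstar_le s0 (gstar_ge0 t)) => u /andP[u0 us].
apply: ((gstar_le (le_trans s0 st) (gstar_ge0 t)).1 (lexx _)).
by rewrite u0 (le_trans us).
Qed.

Lemma gstar_stay (e : 'I_2 -> R -> R) n rho : 0 <= rho ->
  (forall j t, co e j t = W j t w) -> (forall p k, area p k e = A (dy p k) w) ->
  gstar W A n%:R w <= rho <-> stay n rho e.
Proof.
move=> r0 cE aE.
have hE p k : hpt p k e = F (dy p k) by rewrite /hpt !cE aE.
apply: (iff_trans (gstar_le (ler0n _ n) r0)); split => [h p k kn|h].
  by rewrite hE; apply: h; rewrite dy_ge0 /= -(@dy_intM R p) ler_dy.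
by apply: (dense_dy cF) => p k kn; rewrite -hE; exact: h.
Qed.

End gstar.
End running_max.

(** * From integer to real times *)

Section liminf_phi.
Context {R : realType} (g : R -> R) (c : R).
Hypothesis c0 : 0 < c.
Hypothesis g_mono : forall s t, 0 <= s -> s <= t -> g s <= g t.
Hypothesis g_often : forall y, c < y ->
  forall N, exists2 n, (N <= n)%N & g n%:R <= y / phi n%:R.
Hypothesis g_above : forall y, 0 <= y -> y < c ->
  exists N, forall n, (N <= n)%N -> y / phi n%:R < g n%:R.

(** With [n] the integer part of [t], $g(t)\ge g(n)>z/\phi(n)$, and [phi_compare] gives
    $\phi(t)/\phi(n)\ge\sqrt{n/(n+1)}$. The passage from [z] to [y] pays for this ratio when [n] is
    large. *)
Lemma phi_mul_ge y : 0 <= y -> y < c -> exists T0 : R, forall t, T0 <= t -> y <= phi t * g t.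
Proof.
move=> y0 yc; pose z := (y + c) / 2.
have yz : y < z by rewrite /z; lra.
have zc : z < c by rewrite /z; lra.
have z0 : 0 <= z by lra.
have [N hN] := g_above z0 zc.
have D0 : 0 < z ^+ 2 - y ^+ 2 by rewrite subr_gt0 ltr_sqr ?nnegrE.
pose M := (N + 16 + (Num.truncn (y ^+ 2 / (z ^+ 2 - y ^+ 2))).+1)%N.
exists M%:R => t Mt.
have t0 : 0 <= t by apply: le_trans Mt.
pose n := Num.truncn t.
have /andP[nt tn] : n%:R <= t < n.+1%:R by exact: truncn_itv.
have Mn : (M <= n)%N by rewrite -ltnS -(ltr_nat R); exact: le_lt_trans tn.
have n16 : 16 <= n%:R :> R.
  by rewrite ler_nat (leq_trans _ Mn) // /M -addnA addnCA leq_addr.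
have hn : z / phi n%:R < g n%:R by apply: hN; rewrite (leq_trans _ Mn) // /M -addnA leq_addr.
have ny : y ^+ 2 <= (z ^+ 2 - y ^+ 2) * n%:R.
  rewrite [leRHS]mulrC -ler_pdivrMr // (le_trans (ltW (truncnS_gt _))) // ler_nat.
  by rewrite (leq_trans _ Mn) // leq_addl.
have t16 : 16 <= t by lra.
have pn := phi_gt0 n16; have pt := phi_gt0 t16.
have gt : z / phi n%:R <= g t by rewrite (le_trans (ltW hn)) // g_mono.
apply: (le_trans _ (ler_wpM2l (ltW pt) gt)).
rewrite mulrCA mulrA ler_pdivlMr //.
have np : 0 < n%:R :> R by lra.
rewrite -ler_sqr ?nnegrE ?(mulr_ge0 y0 (ltW pn)) ?(mulr_ge0 z0 (ltW pt)) //.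
rewrite -(ler_pM2r np) (exprMn 2 y (phi n%:R)) (exprMn 2 z (phi t)).
have cmp := phi_compare n16 nt.
have p2 : 0 <= phi t ^+ 2 by exact: sqr_ge0.
have h1 : phi n%:R ^+ 2 * n%:R <= phi t ^+ 2 * (n%:R + 1).
  by apply: (le_trans cmp); apply: (ler_wpM2l p2); rewrite natr1 ltW.
have h2 := ler_wpM2l (sqr_ge0 y) h1.
have h3 := ler_wpM2l p2 ny.
move: (n%:R : R) (phi t ^+ 2) (phi n%:R ^+ 2) (y ^+ 2) (z ^+ 2) h2 h3 => m a b u v h2 h3; lra.
Qed.

Lemma liminf_phi : liminf_pinfty (fun t => phi t * g t) = c%:E.
Proof.
apply/eqP; rewrite eq_le; apply/andP; split.
  apply: ub_ereal_sup => _ [T0 _ <-]; apply/lee_addgt0Pr => eps eps0.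
  have ce : c < c + eps by rewrite ltrDl.
  have [n nN hn] := g_often ce (16 + (Num.truncn T0).+1)%N.
  have n16 : 16 <= n%:R :> R by rewrite ler_nat (leq_trans _ nN) // leq_addr.
  apply: (@le_trans _ _ (phi n%:R * g n%:R)%:E); last first.
    by rewrite -EFinD lee_fin mulrC -ler_pdivlMr // phi_gt0.
  apply: ereal_inf_lbound; exists n%:R => //=.
  by rewrite (le_trans (ltW (truncnS_gt _))) // ler_nat (leq_trans _ nN) // leq_addl.
apply/lee_subgt0Pr => eps eps0.
pose y := Num.max 0 (c - eps).
have y0 : 0 <= y by rewrite le_max lexx.
have yc : y < c by rewrite gt_max c0 /= ltrBlDr ltrDl.
have [T0 hT] := phi_mul_ge y0 yc.
apply: (@le_trans _ _ y%:E); first by rewrite -EFinB lee_fin le_max lexx orbT.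
apply: (@le_trans _ _ (ereal_inf ((fun t => (phi t * g t)%:E) @` [set t | T0 <= t]))).
  by apply: le_ereal_inf_tmp => _ [t /= ht <-]; rewrite lee_fin; exact: hT.
by apply: ereal_sup_ubound; exists T0.
Qed.

End liminf_phi.

(** * Almost sure value of the lower limit *)

Section realisation.
Context {R : realType} {d : measure_display} {T : measurableType d} (P : probability T R).
Variables (W : 'I_2 -> R -> T -> R) (A : R -> T -> R).
Hypotheses (hW : is_BM2 P W) (hA : is_levy_area P W A).

Let law := path_law P (measurable_sample_path hW).

Lemma ae_gstar_stay : {ae P, forall w, forall n rho, 0 <= rho ->
  gstar W A n%:R w <= rho <-> stay n rho (sample_path W w)}.
Proof.
have : {ae P, forall w, forall p k, A (dy p k) w = area p k (sample_path W w)}.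
  by apply: ae_foralln => p; apply: ae_foralln => k; exact: (ae_area hW hA).
apply: ae_mono => w h n rho r0.
have [_ [_ [cW _]]] := hW; have [_ [cA _]] := hA.
exact: (@gstar_stay R T W A w (fun j => @cW j w) (@cA w) _ n rho r0 (co_sample_path hW w) (fun p k => esym (h p k))).
Qed.

(** Continuity of the realisation bounds its running maximum. The bounds are taken integral, so that
    the event is measurable and can be transferred to the law. *)
Lemma ae_bounded_stay : {ae law, forall e, forall n, exists M : R, stay n M e}.
Proof.
pose Q : set (pathSpace R) := [set e | forall n, exists K : nat, stay n K%:R e].
have mQ : measurable Q.
  rewrite (_ : Q = \bigcap_n \bigcup_K (stay n K%:R : set (pathSpace R))).
    apply: bigcapT_measurable => n; apply: bigcup_measurable => K _.
    exact: measurable_stay.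
  apply/seteqP; split => e h n; first by have [K hK] := h n; exists K.
  by have [K _ hK] := h n Logic.I; exists K.
have : {ae law, forall e, Q e}.
  apply: path_law_ae => //; apply: ae_mono ae_gstar_stay => w h n.
  have [M hM] : exists M : R, stay n M (sample_path W w).
    by exists (gstar W A n%:R w); apply/h; [exact: gstar_ge0|].
  by have [K] := stay_nat hM; exists K.
by apply: ae_mono => e h n; have [K hK] := h n; exists K%:R.
Qed.

Lemma ae_liminf_gstar (c : R) : 0 < c ->
  (forall y, 0 <= y -> y < c -> law (often y) = 0%E) ->
  (forall y, c < y -> law (often y) = 1%E) ->
  {ae P, forall w, liminf_pinfty (fun t => phi t * gstar W A t w) = c%:E}.
Proof.
move=> c0 lo hi.
(* Countably many levels on either side of [c]; the lower ones are written $c-c/(i+2)$ to stay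
   nonnegative. *)
pose lw i := c - c / i.+2%:R; pose up i := c + i.+1%:R^-1.
have lw0 i : 0 <= lw i by rewrite subr_ge0 ler_pdivrMr // ler_peMr ?ler1n // ltW.
have lwc i : lw i < c by rewrite gtrBl divr_gt0.
have upc i : c < up i by rewrite ltrDl invr_gt0.
have mo y := @measurable_often R y.
have ae_lo : {ae P, forall w, forall i, ~ often (lw i) (sample_path W w)}.
  apply: ae_foralln => i; apply: (@ae_path_law _ _ _ P _ (measurable_sample_path hW) (fun e => ~ often (lw i) e)).
  by apply: measure0_ae_not => //; exact: lo.
have ae_hi : {ae P, forall w, forall i, often (up i) (sample_path W w)}.
  apply: ae_foralln => i; apply: (@ae_path_law _ _ _ P _ (measurable_sample_path hW) (often (up i))).
  have l0 : law (~` often (up i)) = 0%E by rewrite probability_setC // hi // subee.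
  by apply: ae_mono (measure0_ae_not (measurableC (mo _)) l0) => e /contrapT.
have ae_both : {ae P, forall w, (forall i, ~ often (lw i) (sample_path W w)) /\
    (forall i, often (up i) (sample_path W w))} by exact: ae_mono2 ae_lo ae_hi.
apply: ae_mono2 ae_both ae_gstar_stay => w [wlo whi] ws.
have [_ [_ [cW _]]] := hW; have [_ [cA _]] := hA.
apply: (@liminf_phi R (fun t => gstar W A t w)) => //.
- by move=> s t; apply: gstar_mono => // j; exact: cW.
- move=> y cy N; pose i := Num.truncn (y - c)^-1.
  have iy : up i <= y.
    rewrite /up addrC -lerBrDr -[leRHS]invrK lef_pV2 ?posrE ?invr_gt0 ?subr_gt0 //.
    by rewrite ltW // truncnS_gt.
  have /oftenP/(_ (N + 16)%N)[n nN hn] :=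
    often_le (ltW (lt_trans c0 (upc i))) iy (whi i).
  exists n; first by rewrite (leq_trans _ nN) // leq_addr.
  apply/ws => //; rewrite divr_ge0 //; first by rewrite (le_trans (ltW c0)) // ltW.
  by rewrite ltW // phi_gt0 // ler_nat (leq_trans _ nN) // leq_addl.
- move=> y y0 yc; pose i := Num.truncn (c / (c - y)).
  have iy : y <= lw i.
    rewrite /lw lerBrDr -lerBrDl ler_pdivrMr // mulrC -ler_pdivrMr ?subr_gt0 //.
    by rewrite (le_trans (ltW (truncnS_gt _))) // ler_nat.
  have : ~ often y (sample_path W w) by move=> /(often_le y0 iy); exact: wlo.
  move=> /oftenP/existsNP[N hN]; exists (N + 16)%N => n nN.
  rewrite ltNge; apply/negP => h; apply: hN; exists n.
    by rewrite (leq_trans _ nN) // leq_addr.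
  apply/ws => //; rewrite divr_ge0 //.
  by rewrite ltW // phi_gt0 // ler_nat (leq_trans _ nN) // leq_addl.
Qed.

End realisation.

Theorem theorem3p1 (R : realType) :
  exists c : R, 0 < c /\
    forall (d : measure_display) (T : measurableType d) (P : probability T R)
      (W : 'I_2 -> R -> T -> R) (A : R -> T -> R),
      is_BM2 P W -> is_levy_area P W A ->
      {ae P, forall w, liminf_pinfty (fun t => phi t * gstar W A t w) = c%:E}.
Proof.
(* If no law has these properties there is no realisation and any constant serves; otherwise the
   constant of one such law serves all realisations, which share that law. *)
have [[mu [fdd bounded]]|none] := pselect (exists mu : probability (pathSpace R) R,
    brownian_fdd mu /\ {ae mu, forall e, forall n, exists M : R, stay n M e}); last first.
  exists 1; split => // d T P W A hW hA; exfalso; apply: none.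
  exists (path_law P (measurable_sample_path hW)); split.
    exact: brownian_fdd_sample_path.
  exact: ae_bounded_stay hA.
have [c c0 hc] := critical_constant fdd bounded.
exists c; split => // d T P W A hW hA.
have lawE := brownian_law_unique (brownian_fdd_sample_path hW) fdd.
apply: (@ae_liminf_gstar R d T P W A hW hA c c0) => [y y0 yc|y cy];
  (rewrite lawE; last exact: measurable_often).
  exact: (hc y).1.
exact: (hc y).2.
Qed.
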